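(* Let $R$ be a commutative noetherian ring and let $\varphi\colon R\rightarrow A$ be a ring homomorphism making $A$ a finite $R$-algebra. The following are equivalent: (1) $\varphi\colon R\rightarrow A$ has ascent and descent of Gorenstein projective property. (2) The localization $\varphi_{\mathfrak p}\colon R_{\mathfrak p}\rightarrow A_{\mathfrak p}$ has ascent and descent of Gorenstein projective property for each prime ideal $\mathfrak p$ of $R$. (3) The localization $\varphi_{\mathfrak m}\colon R_{\mathfrak m}\rightarrow A_{\mathfrak m}$ has ascent and descent of Gorenstein projective property for each maximal ideal $\mathfrak m$ of $R$.
   Context: Rings are associative with unit, not necessarily commutative. An $A$-module means a left $A$-module; right $A$-modules are identified with modules over $A^{\mathrm{op}}$. $A$ is a finite $R$-algebra via $\varphi$: the image of $\varphi$ lies in the center of $A$ and $A$ is finitely generated as an $R$-module. For a prime $\mathfrak p$ of $R$, $A_{\mathfrak p}=R_{\mathfrak p}\otimes_R A$, a finite $R_{\mathfrak p}$-algebra via the induced map $\varphi_{\mathfrak p}$. Gorenstein projective modules: for a noetherian ring $B$, an acyclic complex $\mathbf P=\cdots\to P_1\xrightarrow{\partial_1}P_0\xrightarrow{\partial_0}P_{-1}\to\cdots$ of projective $B$-modules is totally acyclic if $\mathrm{Hom}_B(\mathbf P,Q)$ is acyclic for every projective $B$-module $Q$. A $B$-module $M$ is Gorenstein projective if there is a totally acyclic complex $\mathbf P$ with $M\cong \mathrm{Im}(\partial_0)$. A ring homomorphism $\psi\colon S\to B$ between noetherian rings has ascent and descent of Gorenstein projective property if: (i) each finitely generated $B$-module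 is Gorenstein projective over $B$ if and only if it is Gorenstein projective over $S$ (by restriction along $\psi$); and (ii) each finitely generated $B^{\mathrm{op}}$-module is Gorenstein projective over $B^{\mathrm{op}}$ if and only if it is Gorenstein projective over $S^{\mathrm{op}}$. *)

(* Defs.v *)
From HB Require Import structures.
From mathcomp Require Import all_boot all_order all_algebra.
From mathcomp Require Import boolp ring.

Set Implicit Arguments.
Unset Strict Implicit.
Unset Printing Implicit Defensive.

Import GRing.Theory.

Local Open Scope ring_scope.
Local Open Scope quotient_scope.

(* Rings are [pzRingType]s: the zero ring is allowed, because the localization
   of a nonzero algebra at a prime outside its support is the zero ring. Every
   type carries a choiceType structure (axioms of [boolp]), so [lmodType B]
   ranges over all left B-modules and [{pred R}] over all subsets of R. *)

Section Ideals.
Variable R : comPzRingType.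
Implicit Types I p m : {pred R}.

Definition ideal I : Prop :=
  0 \in I /\ forall a, {in I &, forall u v, a * u + v \in I}.

Definition noetherian : Prop :=
  forall I, ideal I ->
    exists n (g : 'I_n -> R), forall x : R,
      x \in I <-> exists c : 'I_n -> R, x = \sum_(i < n) c i * g i.

Definition prime_ideal p : Prop :=
  [/\ ideal p, 1 \notin p & forall u v, u * v \in p -> u \in p \/ v \in p].

Definition maximal_ideal m : Prop :=
  [/\ ideal m, 1 \notin m
    & forall I, ideal I -> {subset m <= I} -> 1 \notin I -> {subset I <= m}].

Lemma idealMl I a u : ideal I -> u \in I -> a * u \in I.
Proof. by move=> [I0 IP] Iu; rewrite -[_ * _]addr0 IP. Qed.

Lemma idealD I u v : ideal I -> u \in I -> v \in I -> u + v \in I.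
Proof. by move=> [I0 IP] Iu Iv; rewrite -[u]mul1r IP. Qed.

Lemma maximal_prime m : maximal_ideal m -> prime_ideal m.
Proof.
move=> [mI m1 mP]; split=> // u v uv_m.
have [um|uNm] := boolP (u \in m); [by left | right].
pose J : {pred R} := fun x => `[< exists r y, y \in m /\ x = r * u + y >].
have JP x : reflect (exists r y, y \in m /\ x = r * u + y) (x \in J).
  exact: asboolP.
have mJ : {subset m <= J}.
  by move=> y ym; apply/JP; exists 0, y; rewrite mul0r add0r.
have JI : ideal J.
  split=> [|a x y]; first by apply: mJ; case: mI.
  move=> /JP[r [x' [x'm ->]]] /JP[s [y' [y'm ->]]].
  apply/JP; exists (a * r + s), (a * x' + y'); split.
    by apply: idealD => //; apply: idealMl.
  by rewrite mulrDr mulrDl !mulrA addrACA.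
have [J1|J1] := boolP (1 \in J); last first.
  case/negP: uNm; apply: (mP J) => //.
  by apply/JP; exists 1, 0; rewrite mul1r addr0; case: mI.
move/JP: J1 => [r [y [ym e1]]].
rewrite -[v]mul1r e1 mulrDl -mulrA.
by apply: idealD => //; [apply: idealMl | rewrite mulrC; apply: idealMl].
Qed.

Lemma prime_mulr_closed p : prime_ideal p -> mulr_closed [predC p].
Proof.
move=> [_ p1 pP]; split=> [|u v]; rewrite !inE // => up vp.
by apply/negP => /pP[]; apply/negP.
Qed.

End Ideals.

Section FractionRing.
Variables (R : comPzRingType) (S : {pred R}) (Sm : mulr_closed S).

Definition fracPair : Type := (R * {s : R | s \in S})%type.
HB.instance Definition _ := Choice.on fracPair.

Local Notation den x := (sval x.2).

Definition frac_rel (x y : fracPair) : bool :=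
  `[< exists2 u, u \in S & u * (x.1 * den y) = u * (y.1 * den x) >].

Let S1 : 1 \in S. Proof. by case: Sm. Qed.

Let SM u v : u \in S -> v \in S -> u * v \in S.
Proof. by case: Sm => _; apply. Qed.

Let denS (x : fracPair) : den x \in S. Proof. exact: valP. Qed.

Lemma frac_rel_equiv : equiv_class_of frac_rel.
Proof.
split=> [x|x y|y x z].
- by apply/asboolP; exists 1.
- by apply/asboolP/asboolP => -[u uS e]; exists u.
- move=> /asboolP[u uS e] /asboolP[v vS e']; apply/asboolP.
  exists (u * v * den y); first by rewrite !SM.
  transitivity (v * den z * (u * (x.1 * den y))); first by ring.
  rewrite e; transitivity (u * den x * (v * (y.1 * den z))); first by ring.
  by rewrite e'; ring.
Qed.

Canonical frac_equiv := EquivRelPack frac_rel_equiv.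
Canonical frac_encModRel := defaultEncModRel frac_rel.

(* S^-1 R *)
Definition fracRing : Type := {eq_quot frac_rel}.
HB.instance Definition _ := Choice.on fracRing.
HB.instance Definition _ : EqQuotient fracPair frac_rel fracRing :=
  EqQuotient.on fracRing.

Lemma frac_eqP (x y : fracPair) :
  (\pi_fracRing x = \pi_fracRing y) <->
  exists2 u, u \in S & u * (x.1 * den y) = u * (y.1 * den x).
Proof.
split=> [/eqP|h]; first by rewrite piE => /asboolP.
by apply/eqP; rewrite piE; apply/asboolP.
Qed.

Definition den_mul (x y : fracPair) : {s : R | s \in S} :=
  exist _ (den x * den y) (SM (denS x) (denS y)).
Definition den1 : {s : R | s \in S} := exist _ 1 S1.

Definition frac (r : R) (s : {s : R | s \in S}) : fracRing :=
  \pi_fracRing (r, s).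
Definition frac0 := frac 0 den1.
Definition frac1 := frac 1 den1.
Definition frac_opp (x : fracRing) : fracRing :=
  frac (- (repr x).1) (repr x).2.
Definition frac_add (x y : fracRing) : fracRing :=
  frac ((repr x).1 * den (repr y) + (repr y).1 * den (repr x))
       (den_mul (repr x) (repr y)).
Definition frac_mul (x y : fracRing) : fracRing :=
  frac ((repr x).1 * (repr y).1) (den_mul (repr x) (repr y)).

Lemma fracP (x : fracRing) : {y : fracPair | x = \pi_fracRing y}.
Proof. by exists (repr x); rewrite reprK. Qed.

Let repr_frac (x : fracPair) : exists2 u, u \in S &
  u * ((repr (\pi_fracRing x)).1 * den x)
    = u * (x.1 * den (repr (\pi_fracRing x))).
Proof. by apply/frac_eqP; rewrite reprK. Qed.

Lemma frac_oppE x : frac_opp (\pi_fracRing x) = frac (- x.1) x.2.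
Proof.
have [u uS e] := repr_frac x; apply/frac_eqP; exists u => //=.
by rewrite /= !mulNr !mulrN; congr (- _).
Qed.

Lemma frac_addE x y :
  frac_add (\pi_fracRing x) (\pi_fracRing y)
    = frac (x.1 * den y + y.1 * den x) (den_mul x y).
Proof.
have [u uS e] := repr_frac x; have [v vS e'] := repr_frac y.
apply/frac_eqP; exists (u * v); first exact: SM.
rewrite /=.
set x' := repr (\pi_fracRing x) in e *; set y' := repr (\pi_fracRing y) in e' *.
transitivity (v * den y' * den y * (u * (x'.1 * den x))
   + u * den x' * den x * (v * (y'.1 * den y))); first by ring.
by rewrite e e'; ring.
Qed.

Lemma frac_mulE x y :
  frac_mul (\pi_fracRing x) (\pi_fracRing y) = frac (x.1 * y.1) (den_mul x y).
Proof.
have [u uS e] := repr_frac x; have [v vS e'] := repr_frac y.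
apply/frac_eqP; exists (u * v); first exact: SM.
rewrite /=.
set x' := repr (\pi_fracRing x) in e *; set y' := repr (\pi_fracRing y) in e' *.
transitivity ((u * (x'.1 * den x)) * (v * (y'.1 * den y))); first by ring.
by rewrite e e'; ring.
Qed.

Let fracE := (frac_oppE, frac_addE, frac_mulE).

Lemma frac_addA : associative frac_add.
Proof.
move=> x y z; case: (fracP x) (fracP y) (fracP z) => {}x -> [{}y ->] [{}z ->].
by rewrite !fracE; apply/frac_eqP; exists 1; rewrite //=; ring.
Qed.

Lemma frac_addC : commutative frac_add.
Proof.
move=> x y; case: (fracP x) (fracP y) => {}x -> [{}y ->].
by rewrite !fracE; apply/frac_eqP; exists 1; rewrite //=; ring.
Qed.

Lemma frac_add0 : left_id frac0 frac_add.
Proof.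
move=> x; case: (fracP x) => {}x ->.
by rewrite !fracE; apply/frac_eqP; exists 1; rewrite //=; ring.
Qed.

Lemma frac_addN : left_inverse frac0 frac_opp frac_add.
Proof.
move=> x; case: (fracP x) => {}x ->.
by rewrite !fracE; apply/frac_eqP; exists 1; rewrite //=; ring.
Qed.

HB.instance Definition _ :=
  GRing.isZmodule.Build fracRing frac_addA frac_addC frac_add0 frac_addN.

Lemma frac_mulA : associative frac_mul.
Proof.
move=> x y z; case: (fracP x) (fracP y) (fracP z) => {}x -> [{}y ->] [{}z ->].
by rewrite !fracE; apply/frac_eqP; exists 1; rewrite //=; ring.
Qed.

Lemma frac_mulC : commutative frac_mul.
Proof.
move=> x y; case: (fracP x) (fracP y) => {}x -> [{}y ->].
by rewrite !fracE; apply/frac_eqP; exists 1; rewrite //=; ring.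
Qed.

Lemma frac_mul1 : left_id frac1 frac_mul.
Proof.
move=> x; case: (fracP x) => {}x ->.
by rewrite !fracE; apply/frac_eqP; exists 1; rewrite //=; ring.
Qed.

Lemma frac_mulDl : left_distributive frac_mul frac_add.
Proof.
move=> x y z; case: (fracP x) (fracP y) (fracP z) => {}x -> [{}y ->] [{}z ->].
by rewrite !fracE; apply/frac_eqP; exists 1; rewrite //=; ring.
Qed.

HB.instance Definition _ := GRing.Zmodule_isComPzRing.Build fracRing
  frac_mulA frac_mulC frac_mul1 frac_mulDl.

Definition frac_inj (r : R) : fracRing := frac r den1.

Lemma frac_inj_zmod_morphism : zmod_morphism frac_inj.
Proof.
move=> r t; rewrite -[RHS]/(frac_add (frac_inj r) (frac_opp (frac_inj t))).
rewrite [frac_opp _]frac_oppE frac_addE.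
by apply/frac_eqP; exists 1; rewrite //=; ring.
Qed.

Lemma frac_inj_monoid_morphism : monoid_morphism frac_inj.
Proof.
split=> [//|r t]; rewrite -[RHS]/(frac_mul (frac_inj r) (frac_inj t)) !fracE.
by apply/frac_eqP; exists 1; rewrite //=; ring.
Qed.

HB.instance Definition _ :=
  GRing.isZmodMorphism.Build R fracRing frac_inj frac_inj_zmod_morphism.
HB.instance Definition _ :=
  GRing.isMonoidMorphism.Build R fracRing frac_inj frac_inj_monoid_morphism.

End FractionRing.

Definition restrict (S B : pzRingType) (psi : {rmorphism S -> B})
  (M : lmodType B) : Type := M.

Section RestrictionOfScalars.
Variables (S B : pzRingType) (psi : {rmorphism S -> B}) (M : lmodType B).

HB.instance Definition _ := GRing.Zmodule.on (restrict psi M).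

Let scale (s : S) (x : restrict psi M) : restrict psi M := psi s *: (x : M).

Fact restrict_scalerA a b x : scale a (scale b x) = scale (a * b) x.
Proof. by rewrite /scale rmorphM scalerA. Qed.

Fact restrict_scale1r : left_id 1 scale.
Proof. by move=> x; rewrite /scale rmorph1 scale1r. Qed.

Fact restrict_scalerDr : right_distributive scale +%R.
Proof. by move=> a x y; rewrite /scale scalerDr. Qed.

Fact restrict_scalerDl x : {morph scale^~ x : a b / a + b}.
Proof. by move=> a b; rewrite /scale rmorphD scalerDl. Qed.

HB.instance Definition _ := GRing.Zmodule_isLmodule.Build S (restrict psi M)
  restrict_scalerA restrict_scale1r restrict_scalerDr restrict_scalerDl.

End RestrictionOfScalars.

(* psi : S^op -> B^op *)
Definition opp_hom (S B : pzRingType) (psi : {rmorphism S -> B}) :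
  S^c -> B^c := psi.

Section OppHom.
Variables (S B : pzRingType) (psi : {rmorphism S -> B}).

Fact opp_hom_zmod_morphism : zmod_morphism (opp_hom psi).
Proof. exact: (rmorphB psi). Qed.

Fact opp_hom_monoid_morphism : monoid_morphism (opp_hom psi).
Proof. by split=> [|x y]; [exact: (rmorph1 psi) | exact: (rmorphM psi)]. Qed.

HB.instance Definition _ :=
  GRing.isZmodMorphism.Build S^c B^c (opp_hom psi) opp_hom_zmod_morphism.
HB.instance Definition _ :=
  GRing.isMonoidMorphism.Build S^c B^c (opp_hom psi) opp_hom_monoid_morphism.

End OppHom.

Section TensorProduct.
Variables (R : comPzRingType) (M N : lmodType R).

(* A formal sum of pure tensors is a list of pairs. The formal sums modulo the
   congruence below form an abelian group: the opposite of m (x) n is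
   (- m) (x) n, so that formal differences are not needed. *)
Inductive tensor_cong : seq (M * N) -> seq (M * N) -> Prop :=
| tensor_cong_refl s : tensor_cong s s
| tensor_cong_sym s t : tensor_cong s t -> tensor_cong t s
| tensor_cong_trans s t u :
    tensor_cong s t -> tensor_cong t u -> tensor_cong s u
| tensor_cong_cat s1 t1 s2 t2 :
    tensor_cong s1 t1 -> tensor_cong s2 t2 -> tensor_cong (s1 ++ s2) (t1 ++ t2)
| tensor_cong_catC s t : tensor_cong (s ++ t) (t ++ s)
| tensor_cong_0l n : tensor_cong [:: (0, n)] [::]
| tensor_cong_Dl m1 m2 n :
    tensor_cong [:: (m1 + m2, n)] [:: (m1, n); (m2, n)]
| tensor_cong_Dr m n1 n2 :
    tensor_cong [:: (m, n1 + n2)] [:: (m, n1); (m, n2)]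
| tensor_cong_bal r m n : tensor_cong [:: (r *: m, n)] [:: (m, r *: n)].

Definition tensor_rel (s t : seq (M * N)) : bool := `[< tensor_cong s t >].

Lemma tensor_rel_equiv : equiv_class_of tensor_rel.
Proof.
split=> [s|s t|t s u].
- exact/asboolP/tensor_cong_refl.
- by apply/asboolP/asboolP; apply: tensor_cong_sym.
- by move=> /asboolP st /asboolP tu; apply/asboolP/(tensor_cong_trans st).
Qed.

Canonical tensor_equiv := EquivRelPack tensor_rel_equiv.
Canonical tensor_encModRel := defaultEncModRel tensor_rel.

Definition tensor : Type := {eq_quot tensor_rel}.
HB.instance Definition _ := Choice.on tensor.
HB.instance Definition _ : EqQuotient (seq (M * N)) tensor_rel tensor :=
  EqQuotient.on tensor.

Lemma tensor_eqP (s t : seq (M * N)) :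
  (\pi_tensor s = \pi_tensor t) <-> tensor_cong s t.
Proof.
split=> [/eqP|h]; first by rewrite piE => /asboolP.
by apply/eqP; rewrite piE; apply/asboolP.
Qed.

Let repr_tensor (s : seq (M * N)) : tensor_cong (repr (\pi_tensor s)) s.
Proof. by apply/tensor_eqP; rewrite reprK. Qed.

Definition tensor_zero : tensor := \pi_tensor [::].
Definition tensor_add (u v : tensor) : tensor := \pi_tensor (repr u ++ repr v).
Definition tensor_opp (u : tensor) : tensor :=
  \pi_tensor [seq (- x.1, x.2) | x <- repr u].

Lemma tensor_addE s t :
  tensor_add (\pi_tensor s) (\pi_tensor t) = \pi_tensor (s ++ t).
Proof. exact/tensor_eqP/tensor_cong_cat. Qed.

Let opp_cong s t : tensor_cong s t ->
  tensor_cong [seq (- x.1, x.2) | x <- s] [seq (- x.1, x.2) | x <- t].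
Proof.
elim=> /= {s t}.
- by move=> s; apply: tensor_cong_refl.
- by move=> s t _; apply: tensor_cong_sym.
- by move=> s t u _ st _; apply: tensor_cong_trans.
- by move=> s1 t1 s2 t2 _ h1 _ h2; rewrite !map_cat; apply: tensor_cong_cat.
- by move=> s t; rewrite !map_cat; apply: tensor_cong_catC.
- by move=> n; rewrite oppr0; apply: tensor_cong_0l.
- by move=> m1 m2 n; rewrite opprD; apply: tensor_cong_Dl.
- by move=> m n1 n2; apply: tensor_cong_Dr.
- by move=> r m n; rewrite -scalerN; apply: tensor_cong_bal.
Qed.

Lemma tensor_oppE s :
  tensor_opp (\pi_tensor s) = \pi_tensor [seq (- x.1, x.2) | x <- s].
Proof. exact/tensor_eqP/opp_cong. Qed.

Lemma tensorP (u : tensor) : {s | u = \pi_tensor s}.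
Proof. by exists (repr u); rewrite reprK. Qed.

Fact tensor_addA : associative tensor_add.
Proof.
move=> u v w; case: (tensorP u) (tensorP v) (tensorP w) => s -> [t ->] [x ->].
by rewrite !tensor_addE catA.
Qed.

Fact tensor_addC : commutative tensor_add.
Proof.
move=> u v; case: (tensorP u) (tensorP v) => s -> [t ->].
by rewrite !tensor_addE; apply/tensor_eqP/tensor_cong_catC.
Qed.

Fact tensor_add0 : left_id tensor_zero tensor_add.
Proof. by move=> u; case: (tensorP u) => s ->; rewrite !tensor_addE. Qed.

Fact tensor_addN : left_inverse tensor_zero tensor_opp tensor_add.
Proof.
move=> u; case: (tensorP u) => s ->; rewrite tensor_oppE.
elim: s => [|[m n] s IH]; first by rewrite tensor_addE.
have consE x t :
    \pi_tensor (x :: t) = tensor_add (\pi_tensor [:: x]) (\pi_tensor t).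
  by rewrite tensor_addE.
rewrite /= [in LHS]consE [\pi_tensor ((m, n) :: s)]consE.
rewrite [tensor_add (\pi_tensor [:: (- m, n)]) _]tensor_addC tensor_addA.
rewrite -[tensor_add (tensor_add _ _) (\pi_tensor [:: (m, n)])]tensor_addA.
have -> : tensor_add (\pi_tensor [:: (- m, n)]) (\pi_tensor [:: (m, n)])
          = tensor_zero.
  rewrite tensor_addE; apply/tensor_eqP.
  apply: tensor_cong_trans (tensor_cong_0l n).
  by rewrite -(addNr m); apply/tensor_cong_sym/tensor_cong_Dl.
by rewrite [tensor_add _ tensor_zero]tensor_addC tensor_add0.
Qed.

HB.instance Definition _ := GRing.isZmodule.Build tensor
  tensor_addA tensor_addC tensor_add0 tensor_addN.

Definition pure (m : M) (n : N) : tensor := \pi_tensor [:: (m, n)].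

Lemma pureDl m1 m2 n : pure (m1 + m2) n = pure m1 n + pure m2 n.
Proof.
rewrite -[RHS]/(tensor_add _ _) tensor_addE.
exact/tensor_eqP/tensor_cong_Dl.
Qed.

Lemma pureDr m n1 n2 : pure m (n1 + n2) = pure m n1 + pure m n2.
Proof.
rewrite -[RHS]/(tensor_add _ _) tensor_addE.
exact/tensor_eqP/tensor_cong_Dr.
Qed.

Lemma pure_bal r m n : pure (r *: m) n = pure m (r *: n).
Proof. exact/tensor_eqP/tensor_cong_bal. Qed.

Lemma pi_sum s : \pi_tensor s = \sum_(x <- s) pure x.1 x.2.
Proof.
elim: s => [|[m n] s IH]; first by rewrite big_nil.
by rewrite big_cons -IH -[RHS]/(tensor_add _ _) tensor_addE.
Qed.

Lemma tensor_ind (P : tensor -> Prop) :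
  P 0 -> (forall m n u, P u -> P (pure m n + u)) -> forall u, P u.
Proof.
move=> P0 PD u; case: (tensorP u) => s ->; rewrite pi_sum.
by elim: s => [|x s IH]; rewrite ?big_nil // big_cons; apply: PD.
Qed.

Section UniversalProperty.
Variables (G : zmodType) (f : M -> N -> G).

Definition balanced : Prop :=
  [/\ forall m1 m2 n, f (m1 + m2) n = f m1 n + f m2 n,
      forall m n1 n2, f m (n1 + n2) = f m n1 + f m n2
    & forall r m n, f (r *: m) n = f m (r *: n)].

Definition tensor_lift (u : tensor) : G := \sum_(x <- repr u) f x.1 x.2.

Hypothesis fB : balanced.

Lemma balanced_sum s t :
  tensor_cong s t -> \sum_(x <- s) f x.1 x.2 = \sum_(x <- t) f x.1 x.2.
Proof.
case: fB => fDl fDr fZ; elim=> {s t} //.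
- by move=> s t u _ -> _ ->.
- by move=> s1 t1 s2 t2 _ e1 _ e2; rewrite !big_cat /= e1 e2.
- by move=> s t; rewrite !big_cat /= addrC.
- move=> n; rewrite big_seq1 big_nil /=.
  by apply: (addrI (f 0 n)); rewrite -fDl !addr0.
- by move=> m1 m2 n; rewrite !big_cons !big_nil /= !addr0.
- by move=> m n1 n2; rewrite !big_cons !big_nil /= !addr0.
- by move=> r m n; rewrite !big_seq1 /=.
Qed.

Lemma tensor_lift_pure m n : tensor_lift (pure m n) = f m n.
Proof. by rewrite /tensor_lift (balanced_sum (repr_tensor _)) big_seq1. Qed.

Lemma tensor_liftD u v : tensor_lift (u + v) = tensor_lift u + tensor_lift v.
Proof.
rewrite -[u + v]/(tensor_add u v) /tensor_add /tensor_lift.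
by rewrite (balanced_sum (repr_tensor _)) big_cat.
Qed.

Lemma tensor_lift0 : tensor_lift 0 = 0.
Proof. by apply: (addrI (tensor_lift 0)); rewrite -tensor_liftD !addr0. Qed.

End UniversalProperty.
End TensorProduct.

Section TensorRing.
Variables (R B : comPzRingType) (A : pzRingType).
Variables (f : {rmorphism R -> B}) (phi : {rmorphism R -> A}).

Definition central_hom : Prop := forall r a, phi r * a = a * phi r.

(* The ring B (x)_R A. The centrality proof [phiC] is only used by its
   multiplication. *)
Definition tensorRing (phiC : central_hom) : Type :=
  tensor (restrict f B^o) (restrict phi A^o).

Hypothesis phiC : central_hom.
Local Notation T := (tensorRing phiC).

HB.instance Definition _ := GRing.Zmodule.on T.

Definition tpure (b : B) (a : A) : T :=
  @pure R (restrict f B^o) (restrict phi A^o) b a.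

Let inner (b : B) (a : A) (b' : B) (a' : A) : T := tpure (b * b') (a * a').

Let tlift (G : zmodType) (g : B -> A -> G) (u : T) : G :=
  @tensor_lift R (restrict f B^o) (restrict phi A^o) G g u.

Definition tensor_one : T := tpure 1 1.
Definition tensor_mul (u v : T) : T :=
  tlift (fun b a => tlift (inner b a) v) u.

Let tpureDl b1 b2 a : tpure (b1 + b2) a = tpure b1 a + tpure b2 a.
Proof. exact: pureDl. Qed.

Let tpureDr b a1 a2 : tpure b (a1 + a2) = tpure b a1 + tpure b a2.
Proof. exact: pureDr. Qed.

Let tpure_bal r b a : tpure (f r * b) a = tpure b (phi r * a).
Proof. exact: (@pure_bal R (restrict f B^o) (restrict phi A^o)). Qed.

Let bal (G : zmodType) (g : B -> A -> G) :=
  @balanced R (restrict f B^o) (restrict phi A^o) G g.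

Let inner_bal b a : bal (inner b a).
Proof.
split=> [b1 b2 a'|b' a1 a2|r b' a']; rewrite /inner.
- by rewrite mulrDr tpureDl.
- by rewrite mulrDr tpureDr.
- by rewrite -[r *: b']/(f r * b') -[r *: a']/(phi r * a') mulrCA tpure_bal
             !mulrA phiC.
Qed.

Let tlift_add (G : zmodType) (g h k : B -> A -> G) u :
  (forall b a, g b a = h b a + k b a) -> tlift g u = tlift h u + tlift k u.
Proof. by move=> e; rewrite /tlift /tensor_lift -big_split; apply: eq_bigr. Qed.

Let tlift_eq (G : zmodType) (g h : B -> A -> G) u :
  (forall b a, g b a = h b a) -> tlift g u = tlift h u.
Proof. by move=> e; apply: eq_bigr. Qed.

Let outer_bal v : bal (fun b a => tlift (inner b a) v).
Proof.
split=> [b1 b2 a|b a1 a2|r b a].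
- by apply: tlift_add => b' a'; rewrite /inner mulrDl tpureDl.
- by apply: tlift_add => b' a'; rewrite /inner mulrDl tpureDr.
- apply: tlift_eq => b' a'; rewrite /inner.
  by rewrite -[r *: b]/(f r * b) -[r *: a]/(phi r * a) -!mulrA tpure_bal.
Qed.

Lemma tensor_mul_pure b a b' a' :
  tensor_mul (tpure b a) (tpure b' a') = tpure (b * b') (a * a').
Proof.
rewrite /tensor_mul /tlift (tensor_lift_pure (outer_bal _)).
exact: (tensor_lift_pure (inner_bal _ _)).
Qed.

Fact tensor_mulDl : left_distributive tensor_mul +%R.
Proof. by move=> u v w; apply: (tensor_liftD (outer_bal w)). Qed.

Fact tensor_mulDr : right_distributive tensor_mul +%R.
Proof.
move=> u v w; apply: tlift_add => b a.
exact: (tensor_liftD (inner_bal b a)).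
Qed.

Let tensor_mul0l v : tensor_mul 0 v = 0.
Proof. exact: (tensor_lift0 (outer_bal v)). Qed.

Let tensor_mul0r u : tensor_mul u 0 = 0.
Proof. by apply: (addrI (tensor_mul u 0)); rewrite -tensor_mulDr !addr0. Qed.

Let T_ind (P : T -> Prop) :
  P 0 -> (forall b a u, P u -> P (tpure b a + u)) -> forall u, P u.
Proof. exact: (@tensor_ind R (restrict f B^o) (restrict phi A^o)). Qed.

Fact tensor_mul1l : left_id tensor_one tensor_mul.
Proof.
move=> u; elim/T_ind: u => [|b a u IH]; first exact: tensor_mul0r.
by rewrite tensor_mulDr IH tensor_mul_pure !mul1r.
Qed.

Fact tensor_mul1r : right_id tensor_one tensor_mul.
Proof.
move=> u; elim/T_ind: u => [|b a u IH]; first exact: tensor_mul0l.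
by rewrite tensor_mulDl IH tensor_mul_pure !mulr1.
Qed.

Fact tensor_mulA : associative tensor_mul.
Proof.
move=> u; elim/T_ind: u => [v w|b1 a1 u IHu v w].
  by rewrite !tensor_mul0l.
rewrite !tensor_mulDl -IHu; congr (_ + _); move: {u IHu} v w => v.
elim/T_ind: v => [w|b2 a2 v IHv w].
  by rewrite !(tensor_mul0l, tensor_mul0r).
rewrite !(tensor_mulDl, tensor_mulDr) -IHv; congr (_ + _); move: {v IHv} w => w.
elim/T_ind: w => [|b3 a3 w IHw]; first by rewrite !tensor_mul0r.
by rewrite !tensor_mulDr IHw !tensor_mul_pure !mulrA.
Qed.

HB.instance Definition _ := GRing.Zmodule_isPzRing.Build T
  tensor_mulA tensor_mul1l tensor_mul1r tensor_mulDl tensor_mulDr.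

(* B -> B (x)_R A *)
Definition tensor_hom (b : B) : T := tpure b 1.

Fact tensor_hom_zmod_morphism : zmod_morphism tensor_hom.
Proof.
move=> b c; rewrite /tensor_hom; apply: (addIr (tpure c 1)).
by rewrite -tpureDl !subrK.
Qed.

Fact tensor_hom_monoid_morphism : monoid_morphism tensor_hom.
Proof.
split=> // b c; rewrite -[RHS]/(tensor_mul _ _).
by rewrite tensor_mul_pure mulr1.
Qed.

HB.instance Definition _ :=
  GRing.isZmodMorphism.Build B T tensor_hom tensor_hom_zmod_morphism.
HB.instance Definition _ :=
  GRing.isMonoidMorphism.Build B T tensor_hom tensor_hom_monoid_morphism.

End TensorRing.

Section Modules.
Variable B : pzRingType.

Definition fin_gen (M : lmodType B) : Prop :=
  exists n (g : 'I_n -> M), forall x : M,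
    exists c : 'I_n -> B, x = \sum_(i < n) c i *: g i.

Definition projective (P : lmodType B) : Prop :=
  forall (M N : lmodType B) (g : {linear M -> N}) (f : {linear P -> N}),
    (forall y, exists x, g x = y) ->
    exists h : {linear P -> M}, forall x, g (h x) = f x.

(* Complexes of left B-modules, with homological indexing by the integers. *)
Record complex := Complex {
  cobj :> int -> lmodType B;
  cdiff : forall i, {linear cobj i -> cobj (i - 1)};
  cdiffK : forall i x, cdiff (i - 1) (cdiff i x) = 0 }.

(* Exactness at P_(i-1), for all i. *)
Definition acyclic (P : complex) : Prop :=
  forall i (x : P (i - 1)), cdiff P (i - 1) x = 0 -> exists y, cdiff P i y = x.

(* Exactness of Hom_B(P, Q) at Hom_B(P_(i-1), Q), for all i; the differentials
   of Hom_B(P, Q) are the precompositions with those of P. *)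
Definition hom_acyclic (P : complex) (Q : lmodType B) : Prop :=
  forall i (f : {linear P (i - 1) -> Q}), (forall x, f (cdiff P i x) = 0) ->
    exists g : {linear P (i - 1 - 1) -> Q},
      forall x, g (cdiff P (i - 1) x) = f x.

Definition totally_acyclic (P : complex) : Prop :=
  [/\ forall i, projective (P i), acyclic P
    & forall Q, projective Q -> hom_acyclic P Q].

(* An isomorphism from M to the image of d, composed with the inclusion of this
   image in N. *)
Definition iso_image (M L N : lmodType B) (d : {linear L -> N}) : Prop :=
  exists2 u : {linear M -> N}, injective u
    & forall y, (exists x, u x = y) <-> (exists z, d z = y).

Definition Gorenstein_projective (M : lmodType B) : Prop :=
  exists2 P : complex, totally_acyclic P & iso_image M (cdiff P 0).

End Modules.

Definition ascent_descent (S B : pzRingType) (psi : {rmorphism S -> B}) :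
    Prop :=
  (forall M : lmodType B, fin_gen M ->
     (Gorenstein_projective M <-> Gorenstein_projective (restrict psi M))) /\
  (forall M : lmodType B^c, fin_gen M ->
     (Gorenstein_projective M <->
      Gorenstein_projective (@restrict S^c B^c (opp_hom psi) M))).

Section Localization.
Variables (R : comPzRingType) (A : pzRingType) (phi : {rmorphism R -> A}).
Variables (phiC : central_hom phi) (p : {pred R}) (pP : prime_ideal p).

Definition loc_base : comPzRingType := fracRing (prime_mulr_closed pP).

Definition loc_alg : pzRingType :=
  tensorRing (frac_inj (prime_mulr_closed pP)) phiC.

Definition loc_hom : {rmorphism loc_base -> loc_alg} :=
  tensor_hom (frac_inj (prime_mulr_closed pP)) phiC.

End Localization.

(* Main.v *)
Require Import Defs.
From HB Require Import structures.
From mathcomp Require Import all_boot all_order all_algebra.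
From mathcomp Require Import boolp.
From mathcomp Require classical_sets.

Set Implicit Arguments.
Unset Strict Implicit.
Unset Printing Implicit Defensive.

Import GRing.Theory.
Local Open Scope ring_scope.

(* Let W = Hom_R(A, R), so that Hom_A(-, W) = Hom_R(-, R) on A-modules. The
   homomorphism phi has ascent and descent for left modules if and only if A is
   Gorenstein projective over R and add A = add W as left A-modules.
   Indeed, if ascent and descent hold, then A, hence its dual W, is Gorenstein
   projective over R, so W is Gorenstein projective over A and embeds in some A^n
   with Gorenstein projective cokernel. This cokernel is also Gorenstein
   projective over R, so the form w |-> w(1) on W extends to A^n; the extension
   yields an A-linear retraction, and W is in add A. Generators of W over R embed
   A in W^n, and this splits as well. Conversely, add A = add W lets
   one exchange exactness of Hom_A(-, A) and of Hom_R(-, R).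
   The criterion localizes, and it is local because A and W are finitely presented
   over R. It is applied to R -> A and to R^op -> A^op. *)

(** * Submodules, quotients and exact sequences *)

(** Ascent and descent quantify over all finitely generated modules, and there is no evident way to
    extend a Gorenstein projective module over a localization to one over A; this is why the
    property is first traded for a statement about the two modules A and W. Complete resolutions may
    have arbitrarily large terms and are tested against all projectives, whereas Hom commutes with
    localization only on finitely presented modules. Everything is therefore done with totally
    reflexive modules: complexes of finitely generated free modules, tested against the ring alone.
    The link between the two is that a map from a finitely generated module to a projective one
    factors through a finitely generated free module. Restricting a free A-complex to R yields terms
    that are powers of A, totally reflexive but not free over R. Hence the stability theorem:
    resolving by totally reflexive modules instead of free ones yields no new modules. Ext groups
    never appear; extending linear maps along an injection ([hom_ext]) replaces them, and infinite
    resolutions are replaced by classes of modules closed under taking one more syzygy. *)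

Section LinearOf.
Variables (B : pzRingType) (U V : lmodType B) (f : U -> V).
Hypothesis f_lin : linear f.

Definition linear_of of linear f : U -> V := f.
HB.instance Definition _ :=
  GRing.isLinear.Build B U V *:%R (linear_of f_lin) f_lin.

Lemma ex_linear : exists g : {linear U -> V}, g =1 f.
Proof. by exists (linear_of f_lin). Qed.

End LinearOf.

Section Submodule.
Variables (B : pzRingType) (M : lmodType B).

Definition submodule (N : {pred M}) : Prop :=
  0 \in N /\ forall a x y, x \in N -> y \in N -> a *: x + y \in N.

Section Sub.
Variables (N : {pred M}) (NP : submodule N).

Definition in_sub of submodule N : {pred M} := N.
Local Notation S := (in_sub NP).

Fact in_sub_addr : {in S &, forall x y, x + y \in S}.
Proof. by move=> x y xN yN; rewrite -[x]scale1r; apply: (proj2 NP). Qed.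
Fact in_sub_scaler a : {in S, forall x, a *: x \in S}.
Proof.
by move=> x xN; rewrite -[_ *: _]addr0; apply: (proj2 NP) => //; case: NP.
Qed.
Fact in_sub_submod : GRing.subsemimod_closed S.
Proof.
split; last by move=> a x; apply: in_sub_scaler.
by split; [case: NP | apply: in_sub_addr].
Qed.
HB.instance Definition _ := GRing.isSubSemiModClosed.Build B M S in_sub_submod.

Record sub_type := SubType { sub_val :> M; sub_valP : sub_val \in S }.
HB.instance Definition _ := [isSub for sub_val].
HB.instance Definition _ := [Choice of sub_type by <:].
HB.instance Definition _ := [SubChoice_isSubLmodule of sub_type by <:].

End Sub.
End Submodule.

Lemma ex_submodule (B : pzRingType) (M : lmodType B) (N : {pred M}) :
  submodule N -> exists (K : lmodType B) (i : {linear K -> M}),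
    injective i /\ forall x, x \in N <-> exists k, i k = x.
Proof.
move=> NP; pose i : {linear sub_type NP -> M} := \val.
exists (sub_type NP), i; split=> [|x]; first exact: val_inj.
split=> [xN|[k <-]]; first by exists (SubType (xN : x \in in_sub NP)).
exact: (sub_valP k).
Qed.

Section Quotient.
Variables (B : pzRingType) (M : lmodType B) (N : {pred M}).
Hypothesis NP : submodule N.

Let N0 : 0 \in N. Proof. by case: NP. Qed.
Let NZ a x : x \in N -> a *: x \in N.
Proof. by move=> xN; rewrite -[_ *: _]addr0; apply: (proj2 NP). Qed.
Let ND x y : x \in N -> y \in N -> x + y \in N.
Proof. by move=> xN yN; rewrite -[x]scale1r; apply: (proj2 NP). Qed.
Let NN x : x \in N -> - x \in N.
Proof. by move=> xN; rewrite -scaleN1r NZ. Qed.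

(* The quotient is carried by the canonical representatives of the cosets. *)
Definition coset_repr of submodule N : M -> M :=
  fun x => choose [pred y | x - y \in N] x.

Local Notation rep := (coset_repr NP).

Let rep_mem x : x - rep x \in N.
Proof. by have := @chooseP _ [pred y | x - y \in N] x; rewrite inE subrr; apply. Qed.

Let rep_eq x y : x - y \in N -> rep x = rep y.
Proof.
move=> xy; rewrite /coset_repr.
have e : [pred z | x - z \in N] =1 [pred z | y - z \in N].
  move=> z /=; apply/idP/idP => h.
    by rewrite -(subrK x y) -addrA ND // -opprB NN.
  by rewrite -(subrK y x) -addrA ND.
rewrite (eq_choose e); apply: choose_id => /=; last by rewrite subrr.
by rewrite -opprB NN.
Qed.

Let rep_id x : rep (rep x) = rep x.
Proof. by apply: rep_eq; rewrite -opprB NN. Qed.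

Record quot_type := QuotType { quot_val : M; _ : rep quot_val == quot_val }.
HB.instance Definition _ := [isSub for quot_val].
HB.instance Definition _ := [Choice of quot_type by <:].

Definition quot_pi (x : M) : quot_type := QuotType (introT eqP (rep_id x)).

Let piP x y : quot_pi x = quot_pi y <-> x - y \in N.
Proof.
split=> [/(congr1 quot_val) /= e|xy]; last exact/val_inj/rep_eq.
have -> : x - y = (x - rep x) + (rep y - y) by rewrite -e addrA subrK.
by rewrite ND // -opprB NN.
Qed.

Let piK (u : quot_type) : quot_pi (quot_val u) = u.
Proof. by case: u => x xP; apply: val_inj => /=; apply/eqP. Qed.

Definition quot_add (u v : quot_type) := quot_pi (quot_val u + quot_val v).
Definition quot_opp (u : quot_type) := quot_pi (- quot_val u).
Definition quot_scale a (u : quot_type) := quot_pi (a *: quot_val u).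

Let addE x y : quot_add (quot_pi x) (quot_pi y) = quot_pi (x + y).
Proof.
apply/piP => /=; rewrite opprD addrACA.
by apply: ND; rewrite -opprB NN.
Qed.
Let oppE x : quot_opp (quot_pi x) = quot_pi (- x).
Proof. by apply/piP => /=; rewrite -opprD NN // -opprB NN. Qed.
Let scaleE a x : quot_scale a (quot_pi x) = quot_pi (a *: x).
Proof. by apply/piP => /=; rewrite -scalerBr NZ // -opprB NN. Qed.

Fact quot_addA : associative quot_add.
Proof. by move=> u v w; rewrite -(piK u) -(piK v) -(piK w) !addE addrA. Qed.
Fact quot_addC : commutative quot_add.
Proof. by move=> u v; rewrite -(piK u) -(piK v) !addE addrC. Qed.
Fact quot_add0 : left_id (quot_pi 0) quot_add.
Proof. by move=> u; rewrite -(piK u) !addE add0r. Qed.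
Fact quot_addN : left_inverse (quot_pi 0) quot_opp quot_add.
Proof. by move=> u; rewrite -(piK u) oppE addE addNr. Qed.
HB.instance Definition _ :=
  GRing.isZmodule.Build quot_type quot_addA quot_addC quot_add0 quot_addN.

Fact quot_scalerA a b u : quot_scale a (quot_scale b u) = quot_scale (a * b) u.
Proof. by rewrite -(piK u) !scaleE scalerA. Qed.
Fact quot_scale1r : left_id 1 quot_scale.
Proof. by move=> u; rewrite -(piK u) scaleE scale1r. Qed.
Fact quot_scalerDr : right_distributive quot_scale +%R.
Proof.
move=> a u v; rewrite -(piK u) -(piK v) -[LHS]/(quot_scale a (quot_add _ _)).
by rewrite addE !scaleE -[RHS]/(quot_add _ _) addE scalerDr.
Qed.
Fact quot_scalerDl u : {morph quot_scale^~ u : a b / a + b}.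
Proof.
move=> a b; rewrite -(piK u) !scaleE -[RHS]/(quot_add _ _) addE.
by rewrite scalerDl.
Qed.
HB.instance Definition _ := GRing.Zmodule_isLmodule.Build B quot_type
  quot_scalerA quot_scale1r quot_scalerDr quot_scalerDl.

Lemma ex_quotient : exists (C : lmodType B) (q : {linear M -> C}),
  (forall y, exists x, q x = y) /\ forall x, q x = 0 <-> x \in N.
Proof.
have pi_lin : linear quot_pi.
  move=> a x y; rewrite -[RHS]/(quot_add (quot_scale a (quot_pi x)) _).
  by rewrite scaleE addE.
have [q qE] := ex_linear pi_lin.
exists quot_type, q; split=> [u|x]; first by exists (quot_val u); rewrite qE.
by rewrite qE -[in X in X <-> _](_ : quot_pi 0 = 0) // piP subr0.
Qed.

End Quotient.

Section FunctionModule.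
Variables (B : pzRingType) (T : Type) (V : lmodType B).

(** Used in two ways: the finitely supported functions on a module form a free cover of it, and the
    functions on an ordinal are the powers of a module that need not be free. *)
Definition fun_mod : Type := T -> V.
HB.instance Definition _ := gen_eqMixin fun_mod.
HB.instance Definition _ := gen_choiceMixin fun_mod.

Let add (f g : fun_mod) : fun_mod := fun x => f x + g x.
Let opp (f : fun_mod) : fun_mod := fun x => - f x.
Let zero : fun_mod := fun=> 0.
Let scale a (f : fun_mod) : fun_mod := fun x => a *: f x.

Fact fun_addA : associative add.
Proof. by move=> f g h; apply: funext => x; apply: addrA. Qed.
Fact fun_addC : commutative add.
Proof. by move=> f g; apply: funext => x; apply: addrC. Qed.
Fact fun_add0 : left_id zero add.
Proof. by move=> f; apply: funext => x; apply: add0r. Qed.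
Fact fun_addN : left_inverse zero opp add.
Proof. by move=> f; apply: funext => x; apply: addNr. Qed.
HB.instance Definition _ :=
  GRing.isZmodule.Build fun_mod fun_addA fun_addC fun_add0 fun_addN.

Fact fun_scalerA a b f : scale a (scale b f) = scale (a * b) f.
Proof. by apply: funext => x; apply: scalerA. Qed.
Fact fun_scale1r : left_id 1 scale.
Proof. by move=> f; apply: funext => x; apply: scale1r. Qed.
Fact fun_scalerDr : right_distributive scale +%R.
Proof. by move=> a f g; apply: funext => x; apply: scalerDr. Qed.
Fact fun_scalerDl f : {morph scale^~ f : a b / a + b}.
Proof. by move=> a b; apply: funext => x; apply: scalerDl. Qed.
HB.instance Definition _ := GRing.Zmodule_isLmodule.Build B fun_mod
  fun_scalerA fun_scale1r fun_scalerDr fun_scalerDl.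

End FunctionModule.

Section ShortExact.
Variable B : pzRingType.
Implicit Types U V X Y Z N K C : lmodType B.

Definition ses X Y Z (i : {linear X -> Y}) (p : {linear Y -> Z}) : Prop :=
  [/\ injective i, forall z, exists y, p y = z
    & forall y, p y = 0 <-> exists x, i x = y].

Lemma ses_comp0 X Y Z (i : {linear X -> Y}) (p : {linear Y -> Z}) x :
  ses i p -> p (i x) = 0.
Proof. by case=> _ _ /(_ (i x))[_]; apply; exists x. Qed.

Lemma linear_inj X Y (f : {linear X -> Y}) :
  (forall x, f x = 0 -> x = 0) -> injective f.
Proof.
move=> f0 x y fxy; apply/eqP; rewrite -subr_eq0; apply/eqP/f0.
by rewrite linearB fxy subrr.
Qed.

Lemma ker_submodule X Y (f : {linear X -> Y}) :
  submodule [pred x | f x == 0].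
Proof.
split=> [|a x y]; rewrite !inE ?raddf0 // linearP => /eqP-> /eqP->.
by rewrite scaler0 addr0.
Qed.

Lemma im_submodule X Y (f : {linear X -> Y}) :
  submodule [pred y | `[< exists x, f x = y >]].
Proof.
split=> [|a x y]; rewrite !inE.
  by apply/asboolP; exists 0; rewrite raddf0.
move=> /asboolP[x' <-] /asboolP[y' <-]; apply/asboolP.
by exists (a *: x' + y'); rewrite linearP.
Qed.

Lemma ex_kernel Y Z (p : {linear Y -> Z}) : (forall z, exists y, p y = z) ->
  exists (K : lmodType B) (i : {linear K -> Y}), ses i p.
Proof.
move=> p_surj; have [K [i [i_inj iP]]] := ex_submodule (ker_submodule p).
exists K, i; split=> // y; rewrite -iP inE.
by split=> [->|/eqP].
Qed.

Lemma ex_cokernel X Y (i : {linear X -> Y}) : injective i ->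
  exists (C : lmodType B) (q : {linear Y -> C}), ses i q.
Proof.
move=> i_inj; have [C [q [q_surj qP]]] := ex_quotient (im_submodule i).
exists C, q; split=> // y; rewrite qP inE; split=> [/asboolP //|h].
exact/asboolP.
Qed.

Lemma factor_surj Y Z N (p : {linear Y -> Z}) (f : {linear Y -> N}) :
  (forall z, exists y, p y = z) -> (forall y, p y = 0 -> f y = 0) ->
  exists g : {linear Z -> N}, forall y, g (p y) = f y.
Proof.
move=> /choice[s sK] pf.
have fs y : f (s (p y)) = f y.
  by apply/eqP; rewrite -subr_eq0 -linearB pf // linearB sK subrr.
have lin : linear (fun z => f (s z)).
  by move=> a x y; rewrite -{1}(sK x) -{1}(sK y) -linearP fs linearP.
have [g gE] := ex_linear lin.
by exists g => y; rewrite gE.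
Qed.

Lemma factor_inj X Y N (i : {linear X -> Y}) (f : {linear N -> Y}) :
  injective i -> (forall n, exists x, i x = f n) ->
  exists g : {linear N -> X}, forall n, i (g n) = f n.
Proof.
move=> i_inj /choice[s sK].
have lin : linear s by move=> a x y; apply: i_inj; rewrite linearP !sK linearP.
have [g gE] := ex_linear lin.
by exists g => n; rewrite gE.
Qed.

Lemma ses_factor X Y Z N (i : {linear X -> Y}) (p : {linear Y -> Z})
    (f : {linear Y -> N}) :
  ses i p -> (forall x, f (i x) = 0) ->
  exists g : {linear Z -> N}, forall y, g (p y) = f y.
Proof.
move=> [_ p_surj ip] fi; apply: factor_surj => // y /ip[x <-]; exact: fi.
Qed.

Lemma ses_lift X Y Z N (i : {linear X -> Y}) (p : {linear Y -> Z})
    (f : {linear N -> Y}) :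
  ses i p -> (forall n, p (f n) = 0) ->
  exists g : {linear N -> X}, forall n, i (g n) = f n.
Proof.
move=> [i_inj _ ip] pf; apply: factor_inj => // n; exact/ip/pf.
Qed.

End ShortExact.

(** * Free modules and the vanishing of Ext^1(-, B) *)

Section FreeModules.
Variable B : pzRingType.
Implicit Types U V X Y Z N K C M : lmodType B.

Lemma ex_free_map M n (x : 'I_n -> M) :
  exists f : {linear 'rV[B]_n -> M}, forall v, f v = \sum_i v 0 i *: x i.
Proof.
apply: ex_linear => a u v; rewrite scaler_sumr -big_split /=.
by apply: eq_bigr => i _; rewrite !mxE scalerDl scalerA.
Qed.

Lemma free_mapE M n (f : {linear 'rV[B]_n -> M}) v :
  f v = \sum_i v 0 i *: f (delta_mx 0 i).
Proof.
rewrite {1}[v]row_sum_delta linear_sum.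
by apply: eq_bigr => i _; rewrite linearZ.
Qed.

Lemma ex_row M n (f : 'I_n -> {linear M -> B^o}) :
  exists g : {linear M -> 'rV[B]_n}, forall x i, g x 0 i = f i x.
Proof.
have lin : linear (fun x => \row_i f i x : 'rV[B]_n).
  by move=> a x y; apply/rowP => i; rewrite !mxE linearP.
have [g gE] := ex_linear lin.
by exists g => x i; rewrite gE mxE.
Qed.

Lemma ex_coord n (i : 'I_n) :
  exists c : {linear 'rV[B]_n -> B^o}, forall v, c v = v 0 i.
Proof. by apply: ex_linear => a u v; rewrite !mxE. Qed.

Lemma free_lift n Y Z (p : {linear Y -> Z}) (f : {linear 'rV[B]_n -> Z}) :
  (forall z, exists y, p y = z) ->
  exists g : {linear 'rV[B]_n -> Y}, forall v, p (g v) = f v.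
Proof.
move=> /choice[s sK]; have [g gE] := ex_free_map (fun i => s (f (delta_mx 0 i))).
exists g => v; rewrite gE linear_sum free_mapE.
by apply: eq_bigr => i _; rewrite linearZ sK.
Qed.

Lemma free_projective n : projective 'rV[B]_n.
Proof. by move=> Y Z p f; apply: free_lift. Qed.

Lemma fin_genP M :
  fin_gen M <-> exists n (p : {linear 'rV[B]_n -> M}), forall x, exists v, p v = x.
Proof.
split=> [[n [g gP]]|[n [p p_surj]]].
  have [p pE] := ex_free_map g; exists n, p => x; have [c ->] := gP x.
  by exists (\row_i c i); rewrite pE; apply: eq_bigr => i _; rewrite mxE.
exists n, (fun i => p (delta_mx 0 i)) => x; have [v <-] := p_surj x.
by exists (v 0); apply: free_mapE.
Qed.

Definition hom_ext N X Y (i : {linear X -> Y}) : Prop :=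
  forall f : {linear X -> N}, exists g : {linear Y -> N}, forall x, g (i x) = f x.

(** This is Ext^1(X, B) = 0. Quantifying over all extensions of X makes the condition usable for any
    presentation of X. *)
Definition ext0 X : Prop := forall (U V : lmodType B) (i : {linear U -> V})
  (p : {linear V -> X}), ses i p -> hom_ext B^o i.

Lemma hom_ext_free n X Y (i : {linear X -> Y}) :
  hom_ext B^o i -> hom_ext 'rV[B]_n i.
Proof.
move=> iB f.
have /choice[g gP] : forall k, exists g : {linear Y -> B^o},
    forall x, g (i x) = f x 0 k.
  move=> k; have [c cE] := ex_coord k.
  by have [g gE] := iB (c \o f); exists g => x; rewrite gE /= cE.
have [h hE] := ex_row g; exists h => x.
by apply/rowP => k; rewrite hE gP.
Qed.

Lemma hom_ext_comp N X Y Z (i : {linear X -> Y}) (j : {linear Y -> Z}) :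
  hom_ext N i -> hom_ext N j -> hom_ext N (j \o i).
Proof.
move=> iN jN f; have [g gE] := iN f; have [h hE] := jN g.
by exists h => x; rewrite /= hE gE.
Qed.

Lemma ext0_projective P : projective P -> ext0 P.
Proof.
move=> Pproj U V i p ip f; have [_ p_surj _] := ip.
have [s sK] := Pproj _ _ p idfun p_surj.
have [r rE] : exists r : {linear V -> U}, forall v, i (r v) = v - s (p v).
  have h v : p ((idfun \- (s \o p)) v) = 0 by rewrite /= linearB /= sK subrr.
  by have [r rE] := ses_lift ip h; exists r => v; rewrite rE.
exists (f \o r) => u /=; congr (f _); have [i_inj _ _] := ip; apply: i_inj.
by rewrite rE (ses_comp0 _ ip) raddf0 subr0.
Qed.

(** Exactness of Hom(Y, B) -> Hom(K, B) -> Ext^1(X, B) -> Ext^1(Y, B): one presentation of X along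
    which forms extend settles all the others. *)
Lemma ext0_quot K Y X (i : {linear K -> Y}) (p : {linear Y -> X}) :
  ses i p -> hom_ext B^o i -> ext0 Y -> ext0 X.
Proof.
move=> ip iB Yext U V j q jq f.
have [i_inj p_surj ipE] := ip; have [j_inj q_surj jqE] := jq.
(* [Q] is the pullback of [p] and [q]. It is an extension of Y by U through [a], and of V by K
   through [b]. *)
pose d : {linear (Y * V)%type -> X} := (p \o fst) \- (q \o snd).
have [Q [e [e_inj eP]]] := ex_submodule (ker_submodule d).
have dE y v : p y = q v <-> exists z, e z = (y, v).
  rewrite -eP inE /= subr_eq0; split=> [->|/eqP //]; exact: eqxx.
have deE z : p (e z).1 = q (e z).2 by apply/dE; exists z; case: (e z).
have [a aE] : exists a : {linear U -> Q}, forall u, e (a u) = (0, j u).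
  have lin : linear (fun u => (0, j u) : (Y * V)%type).
    by move=> c x y; apply/pair_equal_spec; rewrite /= linearP scaler0 addr0.
  have [g gE] := ex_linear lin.
  have h u : exists z, e z = g u.
    by rewrite gE; apply/dE; rewrite raddf0 (ses_comp0 _ jq).
  by have [a aE] := factor_inj e_inj h; exists a => u; rewrite aE gE.
have [b bE] : exists b : {linear K -> Q}, forall k, e (b k) = (i k, 0).
  have lin : linear (fun k => (i k, 0) : (Y * V)%type).
    by move=> c x y; apply/pair_equal_spec; rewrite /= linearP scaler0 addr0.
  have [g gE] := ex_linear lin.
  have h u : exists z, e z = g u.
    by rewrite gE; apply/dE; rewrite raddf0 (ses_comp0 _ ip).
  by have [a' a'E] := factor_inj e_inj h; exists a' => u; rewrite a'E gE.
have aQ : ses a (fst \o e : {linear Q -> Y}).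
  split=> [u v uv|y|z /=].
  - by apply: j_inj; have := congr1 (snd \o e) uv; rewrite /= !aE.
  - have [v qv] := q_surj (p y); have /dE[z ze] := esym qv.
    by exists z; rewrite /= ze.
  - split=> [z0|[u <-]]; last by rewrite aE.
    have /esym := deE z; rewrite z0 raddf0 => /jqE[u ju].
    by exists u; apply: e_inj; rewrite aE ju -z0; case: (e z).
have [g gE] := Yext _ _ _ _ aQ f.
(* [g] extends [f] to the pullback but need not vanish on K. Extending its restriction from K to Y
   and subtracting makes it descend to V, without changing it on U, where the component in Y is
   zero. *)
have [h hE] := iB (g \o b).
have eV v : exists z, (e z).2 = v.
  have [y py] := p_surj (q v); have /dE[z ze] := py.
  by exists z; rewrite ze.
have kerV z : (snd \o e) z = 0 -> (g \- (h \o (fst \o e))) z = 0.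
  move=> /= z0; have := deE z; rewrite z0 raddf0 => /ipE[k ik].
  have -> : z = b k by apply: e_inj; rewrite bE ik -z0; case: (e z).
  by rewrite bE /= hE subrr.
have [r rE] := factor_surj (p := snd \o e) eV kerV.
by exists r => u; have := rE (a u); rewrite /= aE /= gE raddf0 subr0.
Qed.

(** A form on U is extended in two stages, through the preimage W of X1 in V: W/U is X1 and V/W is
    X2. *)
Lemma ext0_extension X1 X X2 (i : {linear X1 -> X}) (p : {linear X -> X2}) :
  ses i p -> ext0 X1 -> ext0 X2 -> ext0 X.
Proof.
move=> ip X1e X2e U V j q jq f.
have [i_inj p_surj ipE] := ip; have [j_inj q_surj jqE] := jq.
have pq_surj z : exists v, (p \o q) v = z.
  have [x <-] := p_surj z; have [v <-] := q_surj x; by exists v.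
have [W [w wP]] := ex_kernel pq_surj.
have [a aE] : exists a : {linear U -> W}, forall u, w (a u) = j u.
  by apply: (ses_lift wP) => u; rewrite /= (ses_comp0 _ jq) raddf0.
have [b bE] : exists b : {linear W -> X1}, forall x, i (b x) = q (w x).
  by apply: (ses_lift (f := q \o w) ip) => x; apply: (ses_comp0 _ wP).
have [w_inj _ wE] := wP.
have ab : ses a b.
  split=> [u v /(congr1 w)|x|x].
  - by rewrite !aE => /j_inj.
  - have [v qv] := q_surj (i x).
    have /wE[y wy] : (p \o q) v = 0 by rewrite /= qv (ses_comp0 _ ip).
    by exists y; apply: i_inj; rewrite bE wy.
  - split=> [bx|[u <-]].
      have /jqE[u ju] : q (w x) = 0 by rewrite -bE bx raddf0.
      by exists u; apply: w_inj; rewrite aE.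
    by apply: i_inj; rewrite bE aE (ses_comp0 _ jq) raddf0.
have [g gE] := X1e _ _ _ _ ab f; have [h hE] := X2e _ _ _ _ wP g.
by exists h => u; rewrite -aE hE gE.
Qed.

End FreeModules.

(** Splits off the first coordinate. Inductions on the rank use it because a free module over an
    algebra, once restricted to the base ring, is no longer a row space. *)
Lemma ex_ses_row_mx (B : pzRingType) n :
  exists i : {linear B^o -> 'rV[B]_(1 + n)},
    ses i (rsubmx : {linear 'rV[B]_(1 + n) -> 'rV[B]_n}).
Proof.
have [i iE] : exists i : {linear B^o -> 'rV[B]_(1 + n)},
    forall r, i r = row_mx (r%:M : 'rV_1) 0.
  apply: ex_linear => a r s; rewrite scale_row_mx add_row_mx scaler0 addr0.
  by rewrite raddfD /= -scale_scalar_mx.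
exists i; split=> [|v|v]; last first.
- split=> [v0|[r <-]]; last by rewrite iE /= row_mxKr.
  exists (lsubmx v 0 0); rewrite iE -[RHS]hsubmxK v0.
  by congr (row_mx _ _); rewrite [RHS]mx11_scalar.
- by exists (row_mx 0 v); rewrite /= row_mxKr.
apply: linear_inj => r; rewrite iE -row_mx0 => /eq_row_mx[/matrixP/(_ 0 0)].
by rewrite !mxE eqxx mulr1n.
Qed.

(** * Totally reflexive modules *)

Section Horseshoe.
Variable B : pzRingType.
Implicit Types U V X Y Z N K C M F : lmodType B.

(** The kernel of the composite F -> Y -> Z is the preimage of X in F, hence an extension of X by
    K. *)
Lemma ses_comp_epi X Y Z F K (i : {linear X -> Y}) (p : {linear Y -> Z})
    (k : {linear K -> F}) (q : {linear F -> Y}) : ses i p -> ses k q ->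
  exists K' (k' : {linear K' -> F}) (a : {linear K -> K'}) (b : {linear K' -> X}),
    ses k' (p \o q) /\ ses a b.
Proof.
move=> ip kq; have [i_inj p_surj ipE] := ip; have [k_inj q_surj kqE] := kq.
have pq_surj z : exists v, (p \o q) v = z.
  have [x <-] := p_surj z; have [v <-] := q_surj x; by exists v.
have [K' [k' kpq]] := ex_kernel pq_surj; have [k'_inj _ k'E] := kpq.
have [a aE] : exists a : {linear K -> K'}, forall u, k' (a u) = k u.
  by apply: (ses_lift kpq) => u; rewrite /= (ses_comp0 _ kq) raddf0.
have [b bE] : exists b : {linear K' -> X}, forall u, i (b u) = q (k' u).
  by apply: (ses_lift (f := q \o k') ip) => u; apply: (ses_comp0 _ kpq).
exists K', k', a, b; split=> //; split=> [u v /(congr1 k')|x|x].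
- by rewrite !aE => /k_inj.
- have [v qv] := q_surj (i x).
  have /k'E[y ky] : (p \o q) v = 0 by rewrite /= qv (ses_comp0 _ ip).
  by exists y; apply: i_inj; rewrite bE ky.
- split=> [bx|[u <-]].
    have /kqE[u ku] : q (k' x) = 0 by rewrite -bE bx raddf0.
    by exists u; apply: k'_inj; rewrite aE.
  by apply: i_inj; rewrite bE aE (ses_comp0 _ kq) raddf0.
Qed.

(** The cokernel of the composite X -> Y -> F is an extension of C = F/Y by Z = Y/X. *)
Lemma ses_comp_mono X Y Z F C (i : {linear X -> Y}) (p : {linear Y -> Z})
    (j : {linear Y -> F}) (q : {linear F -> C}) : ses i p -> ses j q ->
  exists C' (q' : {linear F -> C'}) (a : {linear Z -> C'}) (b : {linear C' -> C}),
    ses (j \o i) q' /\ ses a b.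
Proof.
move=> ip jq; have [i_inj p_surj ipE] := ip; have [j_inj q_surj jqE] := jq.
have ji_inj : injective (j \o i) by apply: inj_comp.
have [C' [q' jiq]] := ex_cokernel ji_inj; have [_ q'_surj q'E] := jiq.
have [a aE] : exists a : {linear Z -> C'}, forall y, a (p y) = q' (j y).
  by apply: (ses_factor (f := q' \o j) ip) => x; apply: (ses_comp0 _ jiq).
have [b bE] : exists b : {linear C' -> C}, forall v, b (q' v) = q v.
  by apply: (ses_factor jiq) => x; apply: (ses_comp0 _ jq).
exists C', q', a, b; split=> //; split=> [|c|c].
- apply: linear_inj => z; have [y <-] := p_surj z.
  rewrite aE => /q'E[x /j_inj <-]; exact: ses_comp0 ip.
- by have [v <-] := q_surj c; exists (q' v).
- have [v <-] := q'_surj c; rewrite bE; split=> [/jqE[y <-]|[z]].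
    by exists (p y); rewrite aE.
  by have [y <-] := p_surj z; rewrite aE -bE => <-; rewrite bE (ses_comp0 _ jq).
Qed.

Lemma horseshoe_left X1 X X2 n1 n2 K1 K2
    (i : {linear X1 -> X}) (p : {linear X -> X2})
    (k1 : {linear K1 -> 'rV[B]_n1}) (q1 : {linear 'rV[B]_n1 -> X1})
    (k2 : {linear K2 -> 'rV[B]_n2}) (q2 : {linear 'rV[B]_n2 -> X2}) :
  ses i p -> ses k1 q1 -> ses k2 q2 ->
  exists K (k : {linear K -> 'rV[B]_(n1 + n2)}) (q : {linear 'rV[B]_(n1 + n2) -> X})
    (a : {linear K1 -> K}) (b : {linear K -> K2}), ses k q /\ ses a b.
Proof.
move=> ip kq1 kq2; have [i_inj p_surj ipE] := ip.
have [k1_inj q1_surj kqE1] := kq1; have [k2_inj q2_surj kqE2] := kq2.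
have [l lE] := free_lift q2 p_surj.
pose q : {linear 'rV[B]_(n1 + n2) -> X} :=
  ((i \o q1) \o lsubmx) \+ (l \o rsubmx).
have qE v w : q (row_mx v w) = i (q1 v) + l w.
  by rewrite /q /= row_mxKl row_mxKr.
have pq w : p (q w) = q2 (rsubmx w).
  by rewrite -[w]hsubmxK qE linearD (ses_comp0 _ ip) add0r row_mxKr.
have q_surj x : exists w, q w = x.
  have [w2 w2E] := q2_surj (p x).
  have /ipE[x1 x1E] : p (x - l w2) = 0 by rewrite linearB lE w2E subrr.
  have [w1 w1E] := q1_surj x1; exists (row_mx w1 w2).
  by rewrite qE w1E x1E subrK.
have [K [k kq]] := ex_kernel q_surj; have [k_inj _ kqE] := kq.
have [a aE] : exists a : {linear K1 -> K}, forall u, k (a u) = row_mx (k1 u) 0.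
  have lin : linear (fun u => row_mx (k1 u) 0 : 'rV[B]_(n1 + n2)).
    by move=> c x y; rewrite linearP scale_row_mx add_row_mx scaler0 addr0.
  have [g gE] := ex_linear lin.
  have h u : q (g u) = 0 by rewrite gE qE (ses_comp0 _ kq1) !raddf0 addr0.
  by have [a aE] := ses_lift kq h; exists a => u; rewrite aE gE.
have [b bE] : exists b : {linear K -> K2}, forall u, k2 (b u) = rsubmx (k u).
  by apply: (ses_lift (f := rsubmx \o k) kq2) => u; rewrite /= -pq (ses_comp0 _ kq) raddf0.
exists K, k, q, a, b; split=> //; split=> [|u|u].
- apply: linear_inj => u /(congr1 k); rewrite aE raddf0.
  rewrite -row_mx0 => /eq_row_mx[ku _].
  by apply: k1_inj; rewrite ku raddf0.
- have /ipE[x x_eq] : p (l (k2 u)) = 0 by rewrite lE (ses_comp0 _ kq2).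
  have [v vE] := q1_surj x.
  have /kqE[w wE] : q (row_mx (- v) (k2 u)) = 0.
    by rewrite qE !linearN vE x_eq addNr.
  by exists w; apply: k2_inj; rewrite bE wE row_mxKr.
- split=> [bu|[v <-]]; last first.
    by apply: k2_inj; rewrite bE aE row_mxKr raddf0.
  have r0 : rsubmx (k u) = 0 by rewrite -bE bu raddf0.
  have ku : k u = row_mx (lsubmx (k u)) 0 by rewrite -{1}[k u]hsubmxK r0.
  have : q (k u) = 0 by rewrite (ses_comp0 _ kq).
  rewrite ku qE raddf0 addr0 -[0](raddf0 i) => /i_inj/kqE1[v vE].
  by exists v; apply: k_inj; rewrite aE ku vE.
Qed.

(** Free modules are not injective, so the embedding of X1 extends to X only because forms extend
    along [i]; this is the price of reversing the arrows of the usual horseshoe lemma. *)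
Lemma horseshoe_right X1 X X2 n1 n2 C1 C2
    (i : {linear X1 -> X}) (p : {linear X -> X2})
    (j1 : {linear X1 -> 'rV[B]_n1}) (q1 : {linear 'rV[B]_n1 -> C1})
    (j2 : {linear X2 -> 'rV[B]_n2}) (q2 : {linear 'rV[B]_n2 -> C2}) :
  ses i p -> ses j1 q1 -> ses j2 q2 ->
  hom_ext B^o i -> hom_ext B^o j1 -> hom_ext B^o j2 ->
  exists C (j : {linear X -> 'rV[B]_(n1 + n2)}) (q : {linear 'rV[B]_(n1 + n2) -> C})
    (a : {linear C1 -> C}) (b : {linear C -> C2}),
    [/\ ses j q, hom_ext B^o j & ses a b].
Proof.
move=> ip jq1 jq2 iB jB1 jB2; have [i_inj p_surj ipE] := ip.
have [j1_inj q1_surj jqE1] := jq1; have [j2_inj q2_surj jqE2] := jq2.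
have [e eE] := hom_ext_free iB j1.
have [j jE] : exists j : {linear X -> 'rV[B]_(n1 + n2)},
    forall x, j x = row_mx (e x) (j2 (p x)).
  by apply: ex_linear => c x y; rewrite !linearP scale_row_mx add_row_mx.
have j_inj : injective j.
  apply: linear_inj => x; rewrite jE -row_mx0 => /eq_row_mx[e0 jp0].
  have /ipE[y yE] : p x = 0 by apply: j2_inj; rewrite jp0 raddf0.
  by move: e0; rewrite -yE eE -[0](raddf0 j1) => /j1_inj ->; rewrite raddf0.
have [C [q jq]] := ex_cokernel j_inj; have [_ q_surj jqE] := jq.
have [l lE] : exists l : {linear 'rV[B]_n1 -> 'rV[B]_(n1 + n2)},
    forall v, l v = row_mx v 0.
  by apply: ex_linear => c x y; rewrite scale_row_mx add_row_mx scaler0 addr0.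
have [a aE] : exists a : {linear C1 -> C}, forall v, a (q1 v) = q (row_mx v 0).
  have h x : (q \o l) (j1 x) = 0.
    rewrite /= lE -eE; have := ses_comp0 (i x) jq.
    by rewrite jE (ses_comp0 _ ip) raddf0.
  by have [a aE] := ses_factor jq1 h; exists a => v; rewrite aE /= lE.
have [b bE] : exists b : {linear C -> C2}, forall w, b (q w) = q2 (rsubmx w).
  apply: (ses_factor (f := q2 \o rsubmx) jq) => x.
  by rewrite /= jE row_mxKr (ses_comp0 _ jq2).
exists C, j, q, a, b; split=> //.
- move=> f; have [g1 g1E] := jB1 (f \o i).
  have h x : (f \- (g1 \o e)) (i x) = 0 by rewrite /= eE g1E subrr.
  have [f2 f2E] := ses_factor ip h; have [g2 g2E] := jB2 f2.
  exists ((g1 \o lsubmx) \+ (g2 \o rsubmx)) => x /=.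
  by rewrite jE row_mxKl row_mxKr g2E f2E /= addrC subrK.
- split=> [|c|c].
  + apply: linear_inj => c; have [v <-] := q1_surj c; rewrite aE => /jqE[x].
    rewrite jE => /eq_row_mx[ex /eqP]; rewrite raddf_eq0 // => /eqP/ipE[y yx].
    by rewrite -ex -yx eE (ses_comp0 _ jq1).
  + have [v <-] := q2_surj c; exists (q (row_mx 0 v)).
    by rewrite bE row_mxKr.
  + have [w <-] := q_surj c; rewrite bE; split=> [/jqE2[x2]|[d]].
      have [x <-] := p_surj x2 => wE.
      exists (q1 (lsubmx w - e x)); rewrite aE.
      have -> : row_mx (lsubmx w - e x) 0 = w - j x.
        rewrite jE -{2}[w]hsubmxK -wE opp_row_mx add_row_mx subrr //.
      by rewrite linearB (ses_comp0 _ jq) subr0.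
    have [v <-] := q1_surj d; rewrite aE => vw.
    by rewrite -bE -vw bE row_mxKr raddf0.
Qed.

End Horseshoe.

Section TotallyReflexive.
Variable B : pzRingType.
Implicit Types U V X Y Z N K C M F : lmodType B.

(** Exactness under Hom(-, B) is part of the notion, so one relation serves in both directions: K is
    a syzygy of X, and X a cosyzygy of K. *)
Definition syzygy X K : Prop :=
  exists n (i : {linear K -> 'rV[B]_n}) (p : {linear 'rV[B]_n -> X}),
    ses i p /\ hom_ext B^o i.

(* Greatest fixpoints: an infinite resolution, resp. coresolution, by finitely
   generated free modules that Hom(-, B) keeps exact. *)
Definition left_resolved X : Prop := exists P : lmodType B -> Prop,
  P X /\ forall Z, P Z -> exists K, syzygy Z K /\ P K.
Definition right_resolved X : Prop := exists P : lmodType B -> Prop,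
  P X /\ forall Z, P Z -> exists C, syzygy C Z /\ P C.
Definition tot_refl X : Prop := left_resolved X /\ right_resolved X.

Lemma left_resolved_syz X :
  left_resolved X -> exists K, syzygy X K /\ left_resolved K.
Proof.
move=> [P [PX Pstep]]; have [K [XK PK]] := Pstep X PX.
by exists K; split=> //; exists P.
Qed.

Lemma right_resolved_cosyz X :
  right_resolved X -> exists C, syzygy C X /\ right_resolved C.
Proof.
move=> [P [PX Pstep]]; have [C [XC PC]] := Pstep X PX.
by exists C; split=> //; exists P.
Qed.

Lemma left_resolved_cons X K : syzygy X K -> left_resolved K -> left_resolved X.
Proof.
move=> XK [P [PK Pstep]]; exists (fun Z => P Z \/ Z = X); split; first by right.
move=> Z [/Pstep[L [ZL PL]]|->]; first by exists L; split=> //; left.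
by exists K; split=> //; left.
Qed.

Lemma right_resolved_cons C X :
  syzygy C X -> right_resolved C -> right_resolved X.
Proof.
move=> XC [P [PC Pstep]]; exists (fun Z => P Z \/ Z = X); split; first by right.
move=> Z [/Pstep[L [ZL PL]]|->]; first by exists L; split=> //; left.
by exists C; split=> //; left.
Qed.

Lemma tot_refl_syz X : tot_refl X -> exists K, syzygy X K /\ tot_refl K.
Proof.
move=> [/left_resolved_syz[K [XK LK]] RX]; exists K; split=> //; split=> //.
exact: right_resolved_cons RX.
Qed.

Lemma tot_refl_cosyz X : tot_refl X -> exists C, syzygy C X /\ tot_refl C.
Proof.
move=> [LX /right_resolved_cosyz[C [XC RC]]]; exists C; split=> //; split=> //.
exact: left_resolved_cons LX.
Qed.

Lemma syzygy_ext0 X K : syzygy X K -> ext0 X.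
Proof.
move=> [n [i [p [ip iB]]]]; apply: (ext0_quot ip iB).
exact/ext0_projective/free_projective.
Qed.

Lemma left_resolved_ext0 X : left_resolved X -> ext0 X.
Proof. by move=> /left_resolved_syz[K [/syzygy_ext0]]. Qed.

Lemma tot_refl_ext0 X : tot_refl X -> ext0 X.
Proof. by move=> [/left_resolved_ext0]. Qed.

Lemma tot_refl_fin_gen X : tot_refl X -> fin_gen X.
Proof.
move=> [/left_resolved_syz[K [[n [i [p [[_ p_surj _] _]]]] _]] _].
by apply/fin_genP; exists n, p.
Qed.

(** * Stability: resolutions by totally reflexive modules *)

Section Stability.
Variable P : lmodType B -> Prop.

Section Left.
Hypothesis Pl : forall X, P X -> exists X' Y (i : {linear X' -> Y})
  (p : {linear Y -> X}), [/\ ses i p, hom_ext B^o i, P X' & left_resolved Y].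

(* The modules in P and the resolved ones, closed under extensions: unlike P,
   this class contains a syzygy of each of its members. *)
Inductive left_closure : lmodType B -> Prop :=
| LeftClosureP X : P X -> left_closure X
| LeftClosureL X : left_resolved X -> left_closure X
| LeftClosureE X1 X X2 (i : {linear X1 -> X}) (p : {linear X -> X2}) :
    ses i p -> left_closure X1 -> left_closure X2 -> left_closure X.

Lemma left_closure_ext0 X : left_closure X -> ext0 X.
Proof.
elim=> {X} [X /Pl[X' [Y [i [p [ip iB _ /left_resolved_ext0]]]]]|X|].
- exact: ext0_quot ip iB.
- exact: left_resolved_ext0.
- by move=> X1 X X2 i p ip _ X1e _; apply: ext0_extension ip X1e.
Qed.

(** For X in P, covering Y by a free module turns the kernel into an extension of a member of P by a
    resolved module. Exactness under Hom(-, B) is not carried along here; it follows afterwards from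
    [left_closure_ext0]. *)
Lemma left_closure_step X : left_closure X ->
  exists n K (k : {linear K -> 'rV[B]_n}) (q : {linear 'rV[B]_n -> X}),
    ses k q /\ left_closure K.
Proof.
elim=> {X} [X /Pl[X' [Y [i [p [ip _ PX' YL]]]]]|X XL|].
- have [K [[n [k [q [kq _]]]] KL]] := left_resolved_syz YL.
  have [K' [k' [a [b [kpq ab]]]]] := ses_comp_epi ip kq.
  exists n, K', k', (p \o q); split=> //; apply: LeftClosureE ab _ _.
    exact: LeftClosureL.
  exact: LeftClosureP.
- have [K [[n [k [q [kq _]]]] KL]] := left_resolved_syz XL.
  by exists n, K, k, q; split=> //; apply: LeftClosureL.
- move=> X1 X X2 i p ip _ [n1 [K1 [k1 [q1 [kq1 C1]]]]].
  move=> _ [n2 [K2 [k2 [q2 [kq2 C2]]]]].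
  have [K [k [q [a [b [kq ab]]]]]] := horseshoe_left ip kq1 kq2.
  by exists (n1 + n2)%N, K, k, q; split=> //; apply: LeftClosureE ab C1 C2.
Qed.

Lemma left_closure_resolved X : left_closure X -> left_resolved X.
Proof.
move=> XC; exists left_closure; split=> // {XC} {}X XC.
have [n [K [k [q [kq KC]]]]] := left_closure_step XC.
exists K; split=> //; exists n, k, q; split=> //; exact: (left_closure_ext0 XC kq).
Qed.

End Left.

Section Right.
Hypothesis Pe : forall X, P X -> ext0 X.
Hypothesis Pr : forall X, P X -> exists X' Y (i : {linear X -> Y})
  (p : {linear Y -> X'}), [/\ ses i p, hom_ext B^o i, P X' & tot_refl Y].

(** [horseshoe_right] requires forms to extend along the injection of each extension, so every
    member must have vanishing Ext^1. This is why [Pe] is assumed, and why the modules added to P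
    are totally reflexive rather than merely right resolved. *)
Inductive right_closure : lmodType B -> Prop :=
| RightClosureP X : P X -> right_closure X
| RightClosureL X : tot_refl X -> right_closure X
| RightClosureE X1 X X2 (i : {linear X1 -> X}) (p : {linear X -> X2}) :
    ses i p -> right_closure X1 -> right_closure X2 -> right_closure X.

Lemma right_closure_ext0 X : right_closure X -> ext0 X.
Proof.
elim=> {X} [X /Pe //|X|X1 X X2 i p ip _ X1e _]; first exact: tot_refl_ext0.
exact: ext0_extension ip X1e.
Qed.

Lemma right_closure_step X : right_closure X ->
  exists C, syzygy C X /\ right_closure C.
Proof.
elim=> {X} [X /Pr[X' [Y [i [p [ip iB PX' YT]]]]]|X XT|].
- have [C [[n [j [q [jq jB]]]] CT]] := tot_refl_cosyz YT.
  have [C' [q' [a [b [jiq ab]]]]] := ses_comp_mono ip jq.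
  exists C'; split.
    by exists n, (j \o i), q'; split=> //; apply: hom_ext_comp.
  by apply: RightClosureE ab (RightClosureP PX') (RightClosureL CT).
- have [C [XC CT]] := tot_refl_cosyz XT.
  by exists C; split=> //; apply: RightClosureL.
- move=> X1 X X2 i p ip _ [C1 [[n1 [j1 [q1 [jq1 jB1]]]] CC1]].
  move=> X2C [C2 [[n2 [j2 [q2 [jq2 jB2]]]] CC2]].
  have iB := right_closure_ext0 X2C ip.
  have [C [j [q [a [b [jq jB ab]]]]]] := horseshoe_right ip jq1 jq2 iB jB1 jB2.
  exists C; split; last exact: RightClosureE ab CC1 CC2.
  by exists (n1 + n2)%N, j, q.
Qed.

Lemma right_closure_resolved X : right_closure X -> right_resolved X.
Proof.
by move=> XC; exists right_closure; split=> // Z; apply: right_closure_step.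
Qed.

End Right.

(** The left half comes first: it yields the vanishing of Ext^1 on P that the right half needs. *)
Lemma tot_refl_stable :
  (forall X, P X -> exists X' Y (i : {linear X' -> Y}) (p : {linear Y -> X}),
     [/\ ses i p, hom_ext B^o i, P X' & tot_refl Y]) ->
  (forall X, P X -> exists X' Y (i : {linear X -> Y}) (p : {linear Y -> X'}),
     [/\ ses i p, hom_ext B^o i, P X' & tot_refl Y]) ->
  forall X, P X -> tot_refl X.
Proof.
move=> Pl Pr X PX.
have Pl' Z : P Z -> exists X' Y (i : {linear X' -> Y}) (p : {linear Y -> Z}),
    [/\ ses i p, hom_ext B^o i, P X' & left_resolved Y].
  by move=> /Pl[X' [Y [i [p [ip iB PX' [YL _]]]]]]; exists X', Y, i, p.
split; first exact/(left_closure_resolved Pl')/LeftClosureP.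
apply: (right_closure_resolved _ Pr); last exact: RightClosureP.
by move=> Z PZ; apply: (left_closure_ext0 Pl'); apply: LeftClosureP.
Qed.

End Stability.

(** For empty P, the two closures consist of the iterated extensions of resolved modules. *)
Lemma tot_refl_extension X1 X X2 (i : {linear X1 -> X}) (p : {linear X -> X2}) :
  ses i p -> tot_refl X1 -> tot_refl X2 -> tot_refl X.
Proof.
move=> ip X1T X2T; split.
  apply: (@left_closure_resolved (fun=> False)) => //.
  by apply: LeftClosureE ip _ _; apply: LeftClosureL; [case: X1T | case: X2T].
apply: (@right_closure_resolved (fun=> False)) => //.
by apply: RightClosureE ip _ _; apply: RightClosureL.
Qed.

End TotallyReflexive.

(** * From arbitrary projective modules to finitely generated free ones *)

Section ProjectiveModules.
Variable B : pzRingType.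
Implicit Types U V X Y Z N K C M F P Q : lmodType B.

Lemma ex_free_cover M : exists (F : lmodType B) (ev : F -> M -> B)
    (p : {linear F -> M}),
  [/\ forall y, linear (ev^~ y : F -> B^o), forall x, exists f, p f = x
    & forall f, exists s : seq M, forall t, uniq t -> {subset s <= t} ->
        p f = \sum_(y <- t) ev f y *: y].
Proof.
pose N : {pred fun_mod M B^o} :=
  fun f => `[< exists s : seq M, forall y, y \notin s -> f y = 0 >].
have NP : submodule N.
  split=> [|a f g /asboolP[s sP] /asboolP[t tP]]; apply/asboolP.
    by exists [::].
  exists (s ++ t) => y; rewrite mem_cat negb_or => /andP[/sP fy /tP gy].
  by rewrite -[LHS]/(a *: f y + g y) fy gy scaler0 addr0.
have [F [i [i_inj iP]]] := ex_submodule NP.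
have /choice[s sP] : forall f : F, exists s : seq M,
    forall y, y \notin s -> i f y = 0.
  by move=> f; apply/asboolP/iP; exists f.
pose p f := \sum_(y <- undup (s f)) (i f y : B) *: y.
have pE f t : uniq t -> {subset s f <= t} -> p f = \sum_(y <- t) (i f y : B) *: y.
  move=> t_uniq st; rewrite /p (bigID (fun y => i f y == 0)) /=.
  rewrite [in RHS](bigID (fun y => i f y == 0)) /=.
  have z r : \sum_(y <- r | i f y == 0) (i f y : B) *: y = 0.
    by apply: big1 => y /eqP->; rewrite scale0r.
  rewrite !z !add0r.
  rewrite -big_filter -[in RHS]big_filter; apply: perm_big.
  apply: uniq_perm; rewrite ?filter_uniq ?undup_uniq // => y.
  rewrite !mem_filter mem_undup; case: eqVneq => //= fy.
  have ys : y \in s f by apply: contra_neqT fy => /sP.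
  by rewrite ys st.
have p_lin : linear p.
  move=> a f g; pose t := undup (s (a *: f + g) ++ s f ++ s g).
  have tu : uniq t by apply: undup_uniq.
  rewrite !(pE _ t tu); try by move=> y yt; rewrite mem_undup !mem_cat yt ?orbT.
  rewrite scaler_sumr -big_split; apply: eq_bigr => y _ /=.
  by rewrite linearP scalerA -scalerDl.
have [q qE] := ex_linear p_lin.
exists F, (fun f => i f), q; split=> [y a f g|x|f]; first by rewrite linearP.
  pose d : fun_mod M B^o := fun y => (y == x)%:R.
  have /iP[f fE] : d \in N.
    by apply/asboolP; exists [:: x] => y; rewrite inE /d => /negPf->.
  pose t := undup (x :: s f); have tu : uniq t by apply: undup_uniq.
  exists f; rewrite qE (pE _ t tu); last first.
    by move=> y ys; rewrite mem_undup inE ys orbT.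
  rewrite (big_rem x) ?mem_undup ?inE ?eqxx // fE {1}/d eqxx scale1r /=.
  rewrite big_seq big1 ?addr0 // => y; rewrite mem_rem_uniq // /d.
  by case/andP=> /= /negPf-> _; rewrite scale0r.
by exists (s f) => t tu st; rewrite qE (pE _ t).
Qed.

(** A section of the free cover of P yields coordinate forms. P may be infinitely generated, but
    finitely many elements involve only finitely many coordinates. *)
Lemma dual_basis P m (x : 'I_m -> P) : projective P ->
  exists n (u : 'I_n -> {linear P -> B^o}) (e : 'I_n -> P),
    forall k, x k = \sum_j (u j (x k) : B) *: e j.
Proof.
move=> Pproj; have [F [ev [p [ev_lin p_surj pP]]]] := ex_free_cover P.
have [h hE] := Pproj _ _ p idfun p_surj.
have /choice[s sP] := fun k => pP (h (x k)).
pose t := undup (flatten [seq s k | k <- enum 'I_m]).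
have /choice[u uE] : forall j : 'I_(size t), exists u : {linear P -> B^o},
    forall z, u z = ev (h z) (tnth (in_tuple t) j).
  by move=> j; apply: ex_linear => a y z; rewrite linearP ev_lin.
exists (size t), u, (tnth (in_tuple t)) => k.
rewrite -[LHS]hE (sP k t) ?undup_uniq // => [|y ys].
  by rewrite big_tnth; apply: eq_bigr => j _; rewrite uE.
rewrite mem_undup; apply/flattenP; exists (s k) => //.
by apply: map_f; rewrite mem_enum.
Qed.

(** The dual basis for the images of the generators of X gives [u] and [e]. Thanks to this,
    exactness against B alone implies exactness against every projective module. *)
Lemma factor_projective P X (f : {linear X -> P}) : projective P -> fin_gen X ->
  exists n (u : {linear X -> 'rV[B]_n}) (e : {linear 'rV[B]_n -> P}),
    forall x, f x = e (u x).
Proof.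
move=> Pproj [m [g gP]].
have [n [u [e ueP]]] := dual_basis (fun k => f (g k)) Pproj.
have [r rE] := ex_row (fun j => u j \o f); have [l lE] := ex_free_map e.
exists n, r, l => x; have [c ->] := gP x; rewrite !linear_sum.
apply: eq_bigr => k _; rewrite !linearZ ueP lE; congr (_ *: _).
by apply: eq_bigr => j _; rewrite rE.
Qed.

Lemma hom_ext_projective P X Y (i : {linear X -> Y}) :
  projective P -> fin_gen X -> hom_ext B^o i -> hom_ext P i.
Proof.
move=> Pproj Xfg iB f; have [n [u [e ueE]]] := factor_projective f Pproj Xfg.
have [g gE] := hom_ext_free iB u.
by exists (e \o g) => x; rewrite /= gE ueE.
Qed.

Lemma projective_torsionless P x : projective P ->
  (forall u : {linear P -> B^o}, u x = 0) -> x = 0.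
Proof.
move=> Pproj ux; have [n [u [e ueP]]] := dual_basis (fun _ : 'I_1 => x) Pproj.
by rewrite (ueP ord0) big1 // => j _; rewrite ux scale0r.
Qed.

Lemma free_regular : projective (B^o : lmodType B).
Proof.
move=> Y Z p f p_surj; have [y yE] := p_surj (f 1).
have [g gE] : exists g : {linear B^o -> Y}, forall b, g b = (b : B) *: y.
  by apply: ex_linear => a b c; rewrite scalerDl scalerA.
by exists g => b; rewrite gE linearZ yE -linearZ; congr (f _); apply: mulr1.
Qed.

Lemma fin_gen_free n : fin_gen ('rV[B]_n).
Proof. by apply/fin_genP; exists n, idfun => v; exists v. Qed.

Lemma tot_refl_Gorenstein M : tot_refl M -> Gorenstein_projective M.
Proof.
move=> MT; pose T := {Z : lmodType B | tot_refl Z}.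
(* Bundling each module with its total reflexivity turns the choice of a syzygy, and of a cosyzygy,
   into functions on [T] that can be iterated. *)
have /choice[f fP] : forall Z : T, exists K : T, syzygy (sval Z) (sval K).
  by move=> [Z ZT]; have [K [ZK KT]] := tot_refl_syz ZT; exists (exist _ K KT).
have /choice[g gP] : forall Z : T, exists C : T, syzygy (sval C) (sval Z).
  by move=> [Z ZT]; have [C [ZC CT]] := tot_refl_cosyz ZT; exists (exist _ C CT).
pose M0 : T := exist _ M MT.
(* The free module of degree i covers X (i - 1) with kernel X i, so the image of the differential in
   degree 0 is X (-1). Hence M sits at index -1 = [Negz 0], and index 0 already carries one
   syzygy. *)
pose X (i : int) : lmodType B :=
  sval (match i with Posz n => iter n.+1 f M0 | Negz n => iter n g M0 end).
have XP0 i : syzygy (X (i - 1)) (X i).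
  case: i => [[|n]|n]; first exact: fP.
    have -> : Posz n.+1 - 1 = Posz n by rewrite -addn1 PoszD addrK.
    exact: fP.
  have -> : Negz n - 1 = Negz n.+1.
    by rewrite !NegzE -opprD -[1]/(Posz 1) -PoszD addn1.
  exact: gP.
have XP i : {t : {n : nat & ({linear X i -> 'rV[B]_n} *
      {linear 'rV[B]_n -> X (i - 1)})%type} |
    ses (projT2 t).1 (projT2 t).2 /\ hom_ext B^o (projT2 t).1}.
  apply: cid; have [n [e [p [ep eB]]]] := XP0 i; by exists (existT _ n (e, p)).
pose n i := projT1 (sval (XP i)).
pose e i : {linear X i -> 'rV[B]_(n i)} := (projT2 (sval (XP i))).1.
pose p i : {linear 'rV[B]_(n i) -> X (i - 1)} := (projT2 (sval (XP i))).2.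
have ep i : ses (e i) (p i) by case: (svalP (XP i)).
have eB i : hom_ext B^o (e i) by case: (svalP (XP i)).
pose d i : {linear 'rV[B]_(n i) -> 'rV[B]_(n (i - 1))} := e (i - 1) \o p i.
have dK i x : d (i - 1) (d i x) = 0.
  by rewrite /d /= (ses_comp0 _ (ep (i - 1))) raddf0.
exists (Complex dK); last first.
  exists (e (-1)); first by case: (ep (-1)).
  move=> y; split=> [[x <-]|[z <-]]; last by exists (p 0 z).
  by have [_ /(_ x)[z <-] _] := ep 0; exists z.
split=> [i|i x|Q Qproj i u ud]; first exact: free_projective.
  rewrite /= /d /= => x0; have [e_inj _ _] := ep (i - 1 - 1).
  have [_ _ /(_ x)[px _]] := ep (i - 1).
  have /px[z <-] : p (i - 1) x = 0 by apply: e_inj; rewrite x0 raddf0.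
  by have [_ /(_ z)[y <-] _] := ep i; exists y.
have ue x : u (e (i - 1) x) = 0.
  by have [_ /(_ x)[z <-] _] := ep i; apply: ud.
have [v vE] := ses_factor (ep (i - 1)) ue.
have Xfg : fin_gen (X (i - 1 - 1)).
  have [_ ps _] := ep (i - 1); apply/fin_genP.
  by exists (n (i - 1)), (p (i - 1)).
have [w wE] := hom_ext_projective Qproj Xfg (eB (i - 1 - 1)) v.
by exists w => x; rewrite /= /d /= wE vE.
Qed.

End ProjectiveModules.

(** * Noetherian modules and finite algebras *)

Section FiniteGeneration.
Variable B : pzRingType.
Implicit Types U V X Y Z N K C M F P Q : lmodType B.

Lemma fin_gen_surj X Y (p : {linear X -> Y}) :
  (forall y, exists x, p x = y) -> fin_gen X -> fin_gen Y.
Proof.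
move=> p_surj /fin_genP[n [q q_surj]]; apply/fin_genP; exists n, (p \o q) => y.
by have [x <-] := p_surj y; have [v <-] := q_surj x; exists v.
Qed.

Lemma fin_gen_extension X1 X X2 (i : {linear X1 -> X}) (p : {linear X -> X2}) :
  ses i p -> fin_gen X1 -> fin_gen X2 -> fin_gen X.
Proof.
move=> [i_inj p_surj ipE] /fin_genP[n1 [q1 q1_surj]] /fin_genP[n2 [q2 q2_surj]].
have [l lE] := free_lift q2 p_surj.
apply/fin_genP; exists (n1 + n2)%N, (((i \o q1) \o lsubmx) \+ (l \o rsubmx)) => x.
have [w2 w2E] := q2_surj (p x).
have /ipE[x1 x1E] : p (x - l w2) = 0 by rewrite linearB lE w2E subrr.
have [w1 w1E] := q1_surj x1; exists (row_mx w1 w2).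
by rewrite /= row_mxKl row_mxKr w1E x1E subrK.
Qed.

Definition noetherian_mod M : Prop :=
  forall K (i : {linear K -> M}), injective i -> fin_gen K.

Lemma noetherian_mod_extension X Y Z (i : {linear X -> Y}) (p : {linear Y -> Z}) :
  ses i p -> noetherian_mod X -> noetherian_mod Z -> noetherian_mod Y.
Proof.
move=> ip Xn Zn K e e_inj.
have [I [j [j_inj jE]]] := ex_submodule (im_submodule (p \o e)).
have [r rE] : exists r : {linear K -> I}, forall k, j (r k) = p (e k).
  apply: (factor_inj (f := p \o e) j_inj) => k.
  by apply/jE; rewrite inE; apply/asboolP; exists k.
have r_surj y : exists k, r k = y.
  have /jE/asboolP[k kE] : exists y', j y' = j y by exists y.
  by exists k; apply: j_inj; rewrite rE.
have [K1 [k ker_r]] := ex_kernel r_surj; have [k_inj _ _] := ker_r.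
apply: (fin_gen_extension ker_r _ (Zn _ _ j_inj)).
have h x : p ((e \o k) x) = 0 by rewrite /= -rE (ses_comp0 _ ker_r) raddf0.
have [a aE] := ses_lift ip h; apply: (Xn _ a) => x y /(congr1 i).
by rewrite !aE => /e_inj/k_inj.
Qed.

Lemma noetherian_mod_surj Y Z (p : {linear Y -> Z}) :
  (forall z, exists y, p y = z) -> noetherian_mod Y -> noetherian_mod Z.
Proof.
move=> p_surj Yn K e e_inj; have [C [q eq]] := ex_cokernel e_inj.
have qp_surj z : exists y, (q \o p) y = z.
  have [_ qs _] := eq; have [x <-] := qs z; have [y <-] := p_surj x.
  by exists y.
have [K' [k kqp]] := ex_kernel qp_surj; have [k_inj _ kE] := kqp.
have [a aE] : exists a : {linear K' -> K}, forall x, e (a x) = p (k x).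
  by apply: (ses_lift (f := p \o k) eq) => x; apply: (ses_comp0 _ kqp).
apply: (@fin_gen_surj K' K a); last exact: Yn k_inj.
move=> x; have [y yE] := p_surj (e x).
have /kE[z zE] : (q \o p) y = 0 by rewrite /= yE (ses_comp0 _ eq).
by exists z; apply: e_inj; rewrite aE zE.
Qed.

End FiniteGeneration.

Section Noetherian.
Variables (R : comPzRingType) (R_noetherian : noetherian R).

Lemma noetherian_mod_regular : noetherian_mod (R^o : lmodType R).
Proof.
move=> K e e_inj; pose I : {pred R} := fun r => `[< exists k, e k = r >].
have IP r : reflect (exists k, e k = r) (r \in I) by apply: asboolP.
have II : ideal I.
  split; first by apply/IP; exists 0; rewrite raddf0.
  move=> a u v /IP[x <-] /IP[y <-]; apply/IP.
  by exists (a *: x + y); rewrite linearP.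
have [n [g gP]] := R_noetherian II.
have /choice[h hE] : forall i, exists k, e k = g i.
  move=> i; apply/IP/gP; exists (fun j => (j == i)%:R).
  rewrite (bigD1 i) //= eqxx mul1r big1 ?addr0 // => j /negPf->.
  by rewrite mul0r.
exists n, h => x; have /IP/gP[c cE] : exists k, e k = e x by exists x.
exists c; apply: e_inj; rewrite cE linear_sum.
by apply: eq_bigr => i _; rewrite linearZ /= hE.
Qed.

Lemma noetherian_mod_free n : noetherian_mod ('rV[R]_n).
Proof.
elim: n => [|n IHn].
  move=> K e e_inj; exists 0%N, (fun=> 0) => x; exists (fun=> 0).
  by apply: e_inj; apply/rowP => -[].
have [i ip] := ex_ses_row_mx R n.
apply: (noetherian_mod_extension ip); last exact: IHn.
exact: noetherian_mod_regular.
Qed.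

Lemma fin_gen_noetherian_mod (M : lmodType R) : fin_gen M -> noetherian_mod M.
Proof.
move=> /fin_genP[n [p p_surj]].
exact: noetherian_mod_surj p_surj (@noetherian_mod_free n).
Qed.

End Noetherian.

Section RestrictMap.
Variables (S B : pzRingType) (psi : {rmorphism S -> B}) (M N : lmodType B).

Definition restrict_map (f : {linear M -> N}) :
  restrict psi M -> restrict psi N := f.

Fact restrict_map_linear f : linear (restrict_map f).
Proof. by move=> a x y; apply: linearP. Qed.
HB.instance Definition _ f := GRing.isLinear.Build S (restrict psi M)
  (restrict psi N) *:%R (restrict_map f) (restrict_map_linear f).

(* Packaged with its type, since unification sees through [restrict_map]. *)
Definition restrict_lin (f : {linear M -> N}) :
  {linear restrict psi M -> restrict psi N} := restrict_map f.

End RestrictMap.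
Arguments restrict_lin {S B} psi {M N} f.

Lemma ses_restrict (S B : pzRingType) (psi : {rmorphism S -> B})
    (X Y Z : lmodType B) (i : {linear X -> Y}) (p : {linear Y -> Z}) :
  ses i p -> ses (restrict_lin psi i) (restrict_lin psi p).
Proof. by []. Qed.

Section FiniteAlgebra.
Variables (R : comPzRingType) (A : pzRingType) (phi : {rmorphism R -> A}).
Hypotheses (R_noetherian : noetherian R) (phiC : central_hom phi).
Hypothesis A_finite : fin_gen (restrict phi A^o).
Implicit Types U V X Y Z N K C M F P Q : lmodType A.

Lemma fin_gen_restrict M : fin_gen M <-> fin_gen (restrict phi M).
Proof.
split=> [/fin_genP[n [p p_surj]]|[n [g gP]]]; last first.
  by exists n, g => x; have [c ->] := gP x; exists (fun i => phi (c i)).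
apply: (@fin_gen_surj R _ _ (restrict_lin phi p) p_surj).
elim: n {p p_surj} => [|n IHn].
  by exists 0%N, (fun=> 0) => x; exists (fun=> 0); apply/rowP => -[].
have [i ip] := ex_ses_row_mx A n.
apply: (fin_gen_extension (ses_restrict phi ip)); last exact: IHn.
exact: A_finite.
Qed.

Lemma fin_gen_sub K M (i : {linear K -> M}) :
  injective i -> fin_gen M -> fin_gen K.
Proof.
move=> i_inj /fin_gen_restrict/(fin_gen_noetherian_mod R_noetherian) Mn.
exact/fin_gen_restrict/(Mn _ (restrict_lin phi i)).
Qed.

(** A map is determined by its values on k generators, which embeds Hom_A(X, N) in N^k as an
    R-submodule; R being noetherian, it is finitely generated. *)
Lemma hom_fin_gen X N : fin_gen X -> fin_gen N ->
  exists n (h : 'I_n -> {linear X -> N}), forall f : {linear X -> N},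
    exists c : 'I_n -> R, forall x, f x = \sum_i phi (c i) *: h i x.
Proof.
move=> [k [x xP]] /fin_gen_restrict/fin_genP[m [q q_surj]].
pose qr j (w : 'rV[R]_(k * m)) : N := q (row j (vec_mx w)).
have qrP j a v w : qr j (a *: v + w) = phi a *: qr j v + qr j w.
  by rewrite /qr !linearP.
(* R^m covers N, so R^(km) covers N^k: the block [qr j w] is the would-be value at the j-th
   generator, and [W] is the preimage of Hom_A(X, N). *)
pose W : {pred 'rV[R]_(k * m)} :=
  fun w => `[< exists f : {linear X -> N}, forall j, f (x j) = qr j w >].
have WP : submodule W.
  split=> [|a v w /asboolP[f fE] /asboolP[g gE]]; apply/asboolP.
    by exists \0 => j; rewrite /qr !raddf0.
  have [h hE] : exists h : {linear X -> N}, forall x, h x = phi a *: f x + g x.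
    apply: ex_linear => b y z; rewrite !linearP !scalerDr !scalerA phiC.
    by rewrite addrACA.
  by exists h => j; rewrite hE fE gE qrP.
have [K [e [e_inj eE]]] := ex_submodule WP.
have [n [g gP]] := noetherian_mod_free R_noetherian e_inj.
have /choice[h hE] : forall i, exists f : {linear X -> N},
    forall j, f (x j) = qr j (e (g i)).
  by move=> i; apply/asboolP/eE; exists (g i).
exists n, h => f.
have /choice[t tE] : forall j, exists v, q v = f (x j) by move=> j; apply: q_surj.
pose w := mxvec (\matrix_(j < k) t j).
have wE j : qr j w = f (x j) by rewrite /qr /w mxvecK rowK tE.
have /eE[y yE] : w \in W by apply/asboolP; exists f => j; rewrite wE.
have [c cE] := gP y; exists c => z.
have fx j : f (x j) = \sum_i phi (c i) *: h i (x j).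
  rewrite -wE -yE cE linear_sum /qr !linear_sum.
  by apply: eq_bigr => i _; rewrite hE /qr !linearZ.
have [b ->] := xP z; rewrite linear_sum.
under [RHS]eq_bigr do rewrite linear_sum scaler_sumr.
rewrite exchange_big; apply: eq_bigr => j _ /=.
rewrite linearZ /= fx scaler_sumr; apply: eq_bigr => i _.
by rewrite linearZ /= !scalerA phiC.
Qed.

(** The coordinates of [i] generate Hom_A(X, A) over R, so each form is an R-combination of them. A
    form on A^n multiplies the coordinates by coefficients on the right, and these coefficients are
    central. *)
Lemma free_approximation X : fin_gen X ->
  exists n (i : {linear X -> 'rV[A]_n}), hom_ext A^o i.
Proof.
move=> Xfg; have Afg : fin_gen A^o by apply/fin_gen_restrict.
have [n [h hP]] := hom_fin_gen Xfg Afg.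
have [i iE] := ex_row h; exists n, i => f; have [c cE] := hP f.
have [g gE] := @ex_free_map A A^o n (fun i => phi (c i)).
exists g => x; rewrite gE cE; apply: eq_bigr => j _.
by rewrite iE; apply/esym/phiC.
Qed.

End FiniteAlgebra.

(** * From complete resolutions to resolutions by finitely generated free modules *)

Section CompleteResolutions.
Variable B : pzRingType.
Implicit Types U V X Y Z N K C M F P Q : lmodType B.

(** Allowing any index, where [Gorenstein_projective] fixes 0, gives access to the neighbouring
    images without shifting the complex. *)
Definition complex_image Y : Prop :=
  exists2 P : complex B, totally_acyclic P & exists i, iso_image Y (cdiff P i).

Lemma complex_image_syz Y : complex_image Y ->
  exists K P (i : {linear K -> P}) (p : {linear P -> Y}),
  [/\ ses i p, projective P, complex_image K
    & forall Q, projective Q -> hom_ext Q i].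
Proof.
move=> [P PT [i0]]; have [Pproj Pac Phom] := PT.
(* Acyclicity is stated at indices of the form i - 1, and P (i0 + 1 - 1) is not convertible to P i0;
   renaming the index avoids any transport. *)
have [i ->] : exists i, i0 = i - 1 - 1 by exists (i0 + 1 + 1); rewrite !addrK.
move=> {i0} [u u_inj uE].
have [K [e [e_inj eE]]] := ex_submodule (im_submodule (cdiff P (i - 1))).
have {}eE x : (exists k, e k = x) <-> exists y, cdiff P (i - 1) y = x.
  by rewrite -eE inE; split=> [/asboolP //|h]; apply/asboolP.
have [p pE] : exists p : {linear P (i - 1 - 1) -> Y},
    forall x, u (p x) = cdiff P (i - 1 - 1) x.
  by apply: factor_inj => // x; apply/uE; exists x.
have ep : ses e p.
  split=> // [y|x].
    have /uE[x xE] : exists y', u y' = u y by exists y.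
    by exists x; apply: u_inj; rewrite pE.
  split=> [px|/eE[y <-]]; last by apply: u_inj; rewrite pE cdiffK raddf0.
  by apply/eE/Pac; rewrite -pE px raddf0.
exists K, (P (i - 1 - 1)), e, p; split=> //.
  exists P => //; exists (i - 1); exists e => // y; exact: eE.
move=> Q Qproj f.
have [d dE] : exists d : {linear P (i - 1) -> K},
    forall x, e (d x) = cdiff P (i - 1) x.
  by apply: factor_inj => // x; apply/eE; exists x.
have fd x : (f \o d) (cdiff P i x) = 0.
  by rewrite /= (_ : d _ = 0) ?raddf0 //; apply: e_inj; rewrite dE cdiffK raddf0.
have [g gE] := Phom Q Qproj i (f \o d) fd.
exists g => k; have /eE[y yE] : exists k', e k' = e k by exists k.
rewrite -yE gE /=; congr (f _); apply: e_inj.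
by rewrite dE yE.
Qed.

Lemma complex_image_cosyz Y : complex_image Y ->
  exists C P (i : {linear Y -> P}) (p : {linear P -> C}),
  [/\ ses i p, projective P, complex_image C
    & forall Q, projective Q -> hom_ext Q i].
Proof.
move=> [P PT [i0]]; have [Pproj Pac Phom] := PT.
have [i ->] : exists i, i0 = i - 1 by exists (i0 + 1); rewrite addrK.
move=> {i0} [u u_inj uE].
have [C [e [e_inj eE]]] := ex_submodule (im_submodule (cdiff P (i - 1 - 1))).
have {}eE x : (exists k, e k = x) <-> exists y, cdiff P (i - 1 - 1) y = x.
  by rewrite -eE inE; split=> [/asboolP //|h]; apply/asboolP.
have [p pE] : exists p : {linear P (i - 1 - 1) -> C},
    forall x, e (p x) = cdiff P (i - 1 - 1) x.
  by apply: factor_inj => // x; apply/eE; exists x.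
have up : ses u p.
  split=> // [y|x].
    have /eE[x xE] : exists y', e y' = e y by exists y.
    by exists x; apply: e_inj; rewrite pE.
  split=> [px|/uE[y <-]]; last by apply: e_inj; rewrite pE cdiffK raddf0.
  by apply/uE/Pac; rewrite -pE px raddf0.
exists C, (P (i - 1 - 1)), u, p; split=> //.
  exists P => //; exists (i - 1 - 1); exists e => // y; exact: eE.
move=> Q Qproj f.
have [d dE] : exists d : {linear P (i - 1) -> Y},
    forall x, u (d x) = cdiff P (i - 1) x.
  by apply: factor_inj => // x; apply/uE; exists x.
have fd x : (f \o d) (cdiff P i x) = 0.
  by rewrite /= (_ : d _ = 0) ?raddf0 //; apply: u_inj; rewrite dE cdiffK raddf0.
have [g gE] := Phom Q Qproj i (f \o d) fd.
exists g => k; have /uE[y yE] : exists k', u k' = u k by exists k.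
rewrite -yE gE /=; congr (f _); apply: u_inj.
by rewrite dE yE.
Qed.

(* Unlike being such an image, this property visibly passes from a finitely
   generated X to its finitely generated syzygies and cosyzygies, although the
   terms of the complexes need not be finitely generated. *)
Definition stable_retract X : Prop :=
  exists Y P (a : {linear X -> Y}) (b : {linear Y -> X})
    (c : {linear X -> P}) (d : {linear P -> X}),
  [/\ complex_image Y, projective P & forall x, b (a x) + d (c x) = x].

Lemma complex_image_torsionless Y y : complex_image Y ->
  (forall u : {linear Y -> B^o}, u y = 0) -> y = 0.
Proof.
move=> /complex_image_cosyz[C [P [i [p [ip Pproj _ _]]]]] uy.
have [i_inj _ _] := ip; apply: i_inj; rewrite raddf0.
by apply: projective_torsionless Pproj _ => u; apply: (uy (u \o i)).
Qed.

(** The maps [al] and [be] lift to the covers F and P0 and induce maps between the kernels K and L.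
    On K their composite differs from the identity by a map through F, which is projective. *)
Lemma stable_retract_syz X K F (k : {linear K -> F}) (p : {linear F -> X}) :
  stable_retract X -> projective F -> ses k p ->
  hom_ext B^o k /\ stable_retract K.
Proof.
move=> [Y [P [al [be [ga [de [YC Pproj idE]]]]]]] Fproj kp.
have [L [P0 [l [p0 [lp0 P0proj LC lB]]]]] := complex_image_syz YC.
have [k_inj p_surj kpE] := kp; have [l_inj p0_surj lpE] := lp0.
have [a aE] := Fproj _ _ p0 (al \o p) p0_surj.
have [b bE] := P0proj _ _ p (be \o p0) p_surj.
have [d dE] := Pproj _ _ p de p_surj.
have [a' a'E] : exists a' : {linear K -> L}, forall x, l (a' x) = a (k x).
  apply: (ses_lift (f := a \o k) lp0) => x.
  by rewrite /= aE /= (ses_comp0 _ kp) raddf0.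
have [b' b'E] : exists b' : {linear L -> K}, forall x, k (b' x) = b (l x).
  apply: (ses_lift (f := b \o l) kp) => x.
  by rewrite /= bE /= (ses_comp0 _ lp0) raddf0.
(* On F the lifts compose to the identity only up to an error, which [idE] forces into K. On K the
   term with [ga] disappears, so [e] after [k] is exactly the missing summand. *)
have [e eE] : exists e : {linear F -> K},
    forall x, k (e x) = x - b (a x) - d (ga (p x)).
  apply: (ses_lift (f := (idfun \- (b \o a)) \- ((d \o ga) \o p)) kp) => x.
  by rewrite /= !linearB /= bE /= aE /= dE -addrA -opprD idE subrr.
have id' x : b' (a' x) + e (k x) = x.
  apply: k_inj; rewrite linearD b'E a'E eE (ses_comp0 _ kp) !raddf0 addr0.
  by rewrite addrC subrK.
split; last by exists L, F, a', b', k, e; split.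
move=> f; have [g gE] := lB _ (@free_regular B) (f \o b').
exists ((g \o a) \+ (f \o e)) => x /=.
by rewrite -a'E gE /= -linearD id'.
Qed.

End CompleteResolutions.

Section FiniteAlgebra.
Variables (R : comPzRingType) (A : pzRingType) (phi : {rmorphism R -> A}).
Hypotheses (R_noetherian : noetherian R) (phiC : central_hom phi).
Hypothesis A_finite : fin_gen (restrict phi A^o).
Implicit Types U V X Y Z N K C M F P Q : lmodType A.

Lemma free_embedding X : fin_gen X ->
  (forall x, (forall u : {linear X -> A^o}, u x = 0) -> x = 0) ->
  exists n C (i : {linear X -> 'rV[A]_n}) (q : {linear 'rV[A]_n -> C}),
    ses i q /\ hom_ext A^o i.
Proof.
move=> Xfg Xtl; have [n [i iA]] := free_approximation R_noetherian phiC A_finite Xfg.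
have i_inj : injective i.
  apply: linear_inj => x ix; apply: Xtl => u; have [g <-] := iA u.
  by rewrite ix raddf0.
have [C [q iq]] := ex_cokernel i_inj.
by exists n, C, i, q.
Qed.

(** Dual to [stable_retract_syz], with extension along the embeddings in place of lifting. The
    targets P' and P need not be finitely generated, hence [hom_ext_projective]; the embedding of X
    exists because its forms separate points, as do those of Y and P. *)
Lemma stable_retract_cosyz X : fin_gen X -> stable_retract X ->
  exists C, [/\ syzygy C X, fin_gen C & stable_retract C].
Proof.
move=> Xfg [Y [P [al [be [ga [de [YC Pproj idE]]]]]]].
have Xtl x : (forall u : {linear X -> A^o}, u x = 0) -> x = 0.
  move=> ux; rewrite -(idE x).
  rewrite (complex_image_torsionless YC (y := al x)); last first.
    by move=> u; apply: (ux (u \o al)).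
  rewrite (projective_torsionless (x := ga x) Pproj) ?raddf0 ?addr0 // => u.
  exact: (ux (u \o ga)).
have [n [C [i [q [iq iA]]]]] := free_embedding Xfg Xtl.
have [D [P' [j [q' [jq P'proj DC jA]]]]] := complex_image_cosyz YC.
have [_ q_surj _] := iq.
exists C; split; first by exists n, i, q.
  by apply/fin_genP; exists n, q.
have [a aE] := hom_ext_projective P'proj Xfg iA (j \o al).
have [b bE] := jA _ (@free_projective A n) (i \o be).
have [c cE] := hom_ext_projective Pproj Xfg iA ga.
have [a' a'E] : exists a' : {linear C -> D}, forall x, a' (q x) = q' (a x).
  apply: (ses_factor (f := q' \o a) iq) => x.
  by rewrite /= aE /= (ses_comp0 _ jq).
have [b' b'E] : exists b' : {linear D -> C}, forall x, b' (q' x) = q (b x).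
  apply: (ses_factor (f := q \o b) jq) => x.
  by rewrite /= bE /= (ses_comp0 _ iq).
have [e eE] : exists e : {linear C -> 'rV[A]_n},
    forall x, e (q x) = x - b (a x) - i (de (c x)).
  apply: (ses_factor (f := (idfun \- (b \o a)) \- ((i \o de) \o c)) iq) => x.
  rewrite /= aE /= bE /= cE -addrA -opprD -linearD idE; exact: subrr.
exists D, 'rV[A]_n, a', b', e, q; split=> // [|x]; first exact: free_projective.
have [v <-] := q_surj x.
rewrite eE a'E b'E !linearB /= (ses_comp0 _ iq) subr0.
by rewrite addrC subrK.
Qed.

Lemma stable_retract_tot_refl X : fin_gen X -> stable_retract X -> tot_refl X.
Proof.
move=> Xfg XS; split; exists (fun Z => fin_gen Z /\ stable_retract Z); split=> //.
  move=> Z [Zfg ZS]; have /fin_genP[n [p p_surj]] := Zfg.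
  have [K [k kp]] := ex_kernel p_surj.
  have [kB KS] := stable_retract_syz ZS (@free_projective A n) kp.
  exists K; split; first by exists n, k, p.
  split=> //; have [k_inj _ _] := kp.
  exact: (fin_gen_sub R_noetherian A_finite k_inj (fin_gen_free A n)).
by move=> Z [Zfg ZS]; have [C [CZ Cfg CS]] := stable_retract_cosyz Zfg ZS; exists C.
Qed.

Lemma Gorenstein_complex_image M : Gorenstein_projective M -> complex_image M.
Proof. by move=> [P PT Mi]; exists P => //; exists 0. Qed.

Lemma tot_reflP M : fin_gen M -> (Gorenstein_projective M <-> tot_refl M).
Proof.
move=> Mfg; split; last exact: tot_refl_Gorenstein.
move=> /Gorenstein_complex_image MC; apply: stable_retract_tot_refl => //.
exists M, A^o, idfun, idfun, \0, \0; split=> // [|x]; last exact: addr0.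
exact: free_regular.
Qed.

(** The coinductive definition does not show this: a syzygy of a retract is a retract only up to a
    projective summand, which [stable_retract] absorbs. *)
Lemma tot_refl_retract X Y (a : {linear X -> Y}) (b : {linear Y -> X}) :
  (forall x, b (a x) = x) -> tot_refl Y -> tot_refl X.
Proof.
move=> ba YT; apply: stable_retract_tot_refl.
  apply: (@fin_gen_surj A Y X b) (tot_refl_fin_gen YT).
  by move=> x; exists (a x).
exists Y, A^o, a, b, \0, \0; split=> //=; last by move=> x; rewrite addr0.
- exact/Gorenstein_complex_image/tot_refl_Gorenstein.
- exact: free_regular.
Qed.

(** The pullback of [p] along a free cover A^n -> Z is an extension of Y by the syzygy W. Since the
    cover lifts to Y, this pullback is the direct sum of A^n and K, of which K is a retract. *)
Lemma tot_refl_kernel K Y Z (i : {linear K -> Y}) (p : {linear Y -> Z}) :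
  ses i p -> tot_refl Y -> tot_refl Z -> tot_refl K.
Proof.
move=> ip YT ZT; have [i_inj p_surj ipE] := ip.
have [W [[n [w [q [wq _]]]] WT]] := tot_refl_syz ZT.
have [w_inj q_surj wqE] := wq.
have [l lE] := free_lift q p_surj.
pose r : {linear ('rV[A]_n * K)%type -> Y} := (l \o fst) \+ (i \o snd).
have [m mE] : exists m : {linear W -> K}, forall x, i (m x) = l (w x).
  apply: (ses_lift (f := l \o w) ip) => x.
  by rewrite /= lE (ses_comp0 _ wq).
have [e eE] : exists e : {linear W -> ('rV[A]_n * K)%type},
    forall x, e x = (w x, - m x).
  by apply: ex_linear => c x y; apply/pair_equal_spec; rewrite /= !linearP.
have er : ses e r.
  split=> [x y|y|[v k]].
  - by rewrite !eE => -[/w_inj].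
  - have [v vE] := q_surj (p y).
    have /ipE[k kE] : p (y - l v) = 0 by rewrite linearB lE vE subrr.
    by exists (v, k); rewrite /r /= kE addrC subrK.
  - split=> [|[x]]; last first.
      by rewrite eE => -[<- <-]; rewrite /r /= linearN mE subrr.
    rewrite /r /= => lv; have /wqE[x xE] : q v = 0.
      by rewrite -lE -[l v](addrK (i k)) lv sub0r linearN (ses_comp0 _ ip) oppr0.
    exists x; rewrite eE xE; congr (_, _); apply: i_inj.
    by rewrite linearN mE xE; apply/eqP; rewrite eqr_oppLR -addr_eq0 lv.
have [a aE] : exists a : {linear K -> ('rV[A]_n * K)%type},
    forall k, a k = (0, k).
  by apply: ex_linear => c x y; apply/pair_equal_spec; rewrite /= scaler0 addr0.
apply: (@tot_refl_retract K ('rV[A]_n * K)%type a snd).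
  by move=> k; rewrite aE.
exact: tot_refl_extension er WT YT.
Qed.

(** The pushout of [i] along an embedding X -> A^n is an extension of the cosyzygy W by Y. Since the
    embedding extends to Y, this pushout is the direct sum of A^n and C. *)
Lemma tot_refl_cokernel X Y C (i : {linear X -> Y}) (p : {linear Y -> C}) :
  ses i p -> hom_ext A^o i -> tot_refl X -> tot_refl Y -> tot_refl C.
Proof.
move=> ip iA XT YT; have [i_inj p_surj ipE] := ip.
have [W [[n [j [q [jq jA]]]] WT]] := tot_refl_cosyz XT.
have [j_inj q_surj jqE] := jq.
have [e eE] := hom_ext_free iA j.
have [u uE] : exists u : {linear Y -> ('rV[A]_n * C)%type},
    forall y, u y = (e y, p y).
  by apply: ex_linear => c x y; apply/pair_equal_spec; rewrite /= !linearP.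
have [r rE] : exists r : {linear ('rV[A]_n * C)%type -> W},
    forall v y, r (v, p y) = q (v - e y).
  pose f : {linear ('rV[A]_n * Y)%type -> W} := q \o (fst \- (e \o snd)).
  have [g gE] : exists g : {linear ('rV[A]_n * Y)%type -> ('rV[A]_n * C)%type},
      forall z, g z = (z.1, p z.2).
    by apply: ex_linear => c x y; apply/pair_equal_spec; rewrite /= !linearP.
  have g_surj z : exists y, g y = z.
    case: z => v c; have [y <-] := p_surj c; by exists (v, y); rewrite gE.
  have gf z : g z = 0 -> f z = 0.
    case: z => v y; rewrite gE /f /= => -[-> /ipE[x <-]].
    by rewrite eE sub0r linearN (ses_comp0 _ jq) oppr0.
  have [r rE] := factor_surj g_surj gf.
  by exists r => v y; rewrite -[(v, p y)]/((v, y).1, p (v, y).2) -gE rE.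
have ur : ses u r.
  split=> [|w|[v c]].
  - apply: linear_inj => y; rewrite uE => -[ey /ipE[x xE]].
    move: ey; rewrite -xE eE -[0](raddf0 j) => /j_inj->; exact: raddf0.
  - have [v <-] := q_surj w; exists (v, p 0).
    by rewrite rE raddf0 subr0.
  - have [y <-] := p_surj c; rewrite rE; split=> [/jqE[x xE]|[z]].
      exists (i x + y); rewrite uE !linearD (ses_comp0 _ ip) add0r eE xE.
      by rewrite subrK.
    rewrite uE => -[ez zy]; rewrite -ez -linearB.
    have /ipE[x <-] : p (z - y) = 0 by rewrite linearB zy subrr.
    by rewrite eE (ses_comp0 _ jq).
have [a aE] : exists a : {linear C -> ('rV[A]_n * C)%type},
    forall k, a k = (0, k).
  by apply: ex_linear => c x y; apply/pair_equal_spec; rewrite /= scaler0 addr0.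
apply: (@tot_refl_retract C ('rV[A]_n * C)%type a snd).
  by move=> k; rewrite aE.
exact: tot_refl_extension ur YT WT.
Qed.

End FiniteAlgebra.

Lemma tot_refl_free (B : pzRingType) n : tot_refl ('rV[B]_n).
Proof.
split; exists (fun Z : lmodType B => exists n, Z = 'rV[B]_n :> lmodType B); (split; first by exists n).
  move=> _ [m ->]; exists 'rV[B]_0; split; last by exists 0%N.
  exists m, \0, idfun; split.
    split=> [x y _|z|y]; [by rewrite [x]thinmx0 [y]thinmx0 | by exists z|].
    by split=> [/= ->|[x <-]] //; exists 0.
  by move=> f; exists \0 => x; rewrite [x]thinmx0 !raddf0.
move=> _ [m ->]; exists 'rV[B]_0; split; last by exists 0%N.
exists m, idfun, \0; split; last by move=> f; exists f.
split=> // [z|y]; first by exists 0; rewrite [z]thinmx0 raddf0.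
by split=> // _; exists y.
Qed.

Lemma tot_refl_torsionless (B : pzRingType) (Z : lmodType B) z : tot_refl Z ->
  (forall f : {linear Z -> B^o}, f z = 0) -> z = 0.
Proof.
move=> /tot_refl_cosyz[D [[n [j [r [[j_inj _ _] _]]]] _]] fz.
apply: j_inj; rewrite raddf0; apply/rowP => i; have [c cE] := ex_coord B i.
by rewrite mxE -cE -[LHS]/((c \o j) z) fz.
Qed.

(* b identifies Z' with the dual of Z. *)
Definition dual_pairing (R : comPzRingType) (Z Z' : lmodType R)
    (b : Z -> Z' -> R) : Prop :=
  [/\ forall z', linear (b^~ z' : Z -> R^o), forall z, linear (b z : Z' -> R^o),
      forall f : {linear Z -> R^o}, exists z', forall z, b z z' = f z
    & forall z', (forall z, b z z' = 0) -> z' = 0].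

(** * Duals of totally reflexive modules over a commutative ring *)

Section Duality.
Variable R : comPzRingType.
Implicit Types (Z : lmodType R).

Let dot n (v w : 'rV[R]_n) : R := \sum_i v 0 i * w 0 i.

Let dotC n (v w : 'rV[R]_n) : dot v w = dot w v.
Proof. by apply: eq_bigr => i _; rewrite mulrC. Qed.

Let dot_linear n (v : 'rV[R]_n) : linear (dot v : _ -> R^o).
Proof.
move=> a x y; rewrite /dot scaler_sumr -big_split; apply: eq_bigr => i _.
by rewrite !mxE mulrDr mulrCA.
Qed.

Let dot_repr n (f : {linear 'rV[R]_n -> R^o}) : exists w, forall v, f v = dot w v.
Proof.
exists (\row_i f (delta_mx 0 i)) => v; rewrite free_mapE.
by apply: eq_bigr => i _; rewrite mxE mulrC.
Qed.

(** The dual map of [i], with R^n identified with its own dual by [dot]. *)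
Let ex_transpose n Z Z' b (i : {linear Z -> 'rV[R]_n}) : dual_pairing b ->
  exists t : {linear 'rV[R]_n -> Z'}, forall z v, b z (t v) = dot (i z) v.
Proof.
move=> [b_l b_r b_ex b_uniq].
have h v : exists z', forall z, b z z' = dot (i z) v.
  have [f fE] : exists f : {linear Z -> R^o}, forall z, f z = dot (i z) v.
    by apply: ex_linear => a x y; rewrite !(dotC _ v) linearP dot_linear.
  by have [z' z'E] := b_ex f; exists z' => z; rewrite z'E fE.
have [t tE] := choice h.
have t_lin : linear t.
  move=> a v w; apply/eqP; rewrite -subr_eq0; apply/eqP/b_uniq => z.
  have [g gE] := ex_linear (b_r z).
  by rewrite -gE linearB linearP !gE !tE dot_linear subrr.
by have [s sE] := ex_linear t_lin; exists s => z v; rewrite sE tE.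
Qed.

(** Z embeds in R^n with cokernel D, and R^n covers Z'. Pulled back to R^n, the form is the product
    with a vector [u]; every form on D kills the image of [u], and D is torsionless, so [u] lies in
    Z. *)
Lemma dual_reflexive Z Z' (b : Z -> Z' -> R) (f : {linear Z' -> R^o}) :
  tot_refl Z -> dual_pairing b -> exists z, forall z', f z' = b z z'.
Proof.
move=> ZT bP; have [b_l b_r b_ex b_uniq] := bP.
have [D [[n [j [r [jr jR]]]] DT]] := tot_refl_cosyz ZT.
have [t tE] := ex_transpose j bP; have [_ _ jrE] := jr.
have t_surj z' : exists v, t v = z'.
  have [g gE] := ex_linear (b_l z'); have [h hE] := jR g.
  have [w wE] := dot_repr h; exists w; apply/eqP; rewrite -subr_eq0.
  apply/eqP/b_uniq => z; have [k kE] := ex_linear (b_r z).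
  by rewrite -kE linearB !kE tE -gE -hE wE dotC subrr.
have [u uE] := dot_repr (f \o t).
have /jrE[z zE] : r u = 0.
  apply: tot_refl_torsionless DT _ => g; have [w wE] := dot_repr (g \o r).
  rewrite -[LHS]/((g \o r) u) wE dotC -uE /= (_ : t w = 0) ?raddf0 //.
  apply: b_uniq => z; rewrite tE dotC -wE /= (ses_comp0 _ jr); exact: raddf0.
exists z => z'; have [v <-] := t_surj z'.
by rewrite tE zE -uE.
Qed.

(** Dualizing reverses the sequences: cosyzygies of Z become syzygies of its dual and conversely.
    The class of all duals of totally reflexive modules is thus stable in both directions. *)
Lemma tot_refl_dual Z Z' (b : Z -> Z' -> R) :
  tot_refl Z -> dual_pairing b -> tot_refl Z'.
Proof.
move=> ZT bP.
pose P (Z' : lmodType R) := exists (Z : lmodType R) (b : Z -> Z' -> R),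
  tot_refl Z /\ dual_pairing b.
have PZ' : P Z' by exists Z, b.
split; exists P; split=> // {Z Z' b ZT bP PZ'} Z' [Z [b [ZT bP]]];
    have [b_l b_r b_ex b_uniq] := bP.
  (* Left half: the kernel K of the dual map [t] is to be the dual of the cosyzygy D. Forms on K
     then extend to R^n because, by reflexivity of D, they are evaluations at elements of D. *)
  have [D [[n [j [r [jr jR]]]] DT]] := tot_refl_cosyz ZT.
  have [t tE] := ex_transpose j bP; have [_ r_surj jrE] := jr.
  have t_surj z' : exists v, t v = z'.
    have [g gE] := ex_linear (b_l z'); have [h hE] := jR g.
    have [w wE] := dot_repr h; exists w; apply/eqP; rewrite -subr_eq0.
    apply/eqP/b_uniq => z; have [k kE] := ex_linear (b_r z).
    by rewrite -kE linearB !kE tE -gE -hE wE dotC subrr.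
  have [K [k kt]] := ex_kernel t_surj; have [k_inj _ ktE] := kt.
  have /choice[s sK] := r_surj.
  (* The pairing of D with K lifts an element of D to R^n; the lift does not matter, since K is
     orthogonal to the image of Z. *)
  have dot_s d x v : r v = d -> dot (s d) (k x) = dot v (k x).
    move=> rv; have /jrE[z zE] : r (v - s d) = 0 by rewrite linearB rv sK subrr.
    apply/eqP; rewrite eq_sym -subr_eq0 !(dotC _ (k x)); apply/eqP.
    have [g gE] := ex_linear (dot_linear (k x)).
    rewrite -!gE -linearB gE -zE dotC -tE (ses_comp0 _ kt).
    by have [l lE] := ex_linear (b_r z); rewrite -lE raddf0.
  have DK : dual_pairing (fun d x => dot (s d) (k x)).
    split=> [x a d1 d2|d a x y|f|x x0].
    - rewrite (dot_s _ _ (a *: s d1 + s d2)); last by rewrite linearP !sK.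
      by rewrite !(dotC _ (k x)) dot_linear.
    - by rewrite linearP dot_linear.
    - have [w wE] := dot_repr (f \o r).
      have /ktE[x xE] : t w = 0.
        apply: b_uniq => z; rewrite tE dotC -wE /= (ses_comp0 _ jr).
        exact: raddf0.
      by exists x => d; rewrite xE dotC -wE /= sK.
    - apply: k_inj; rewrite raddf0; apply/rowP => i; rewrite mxE.
      have := x0 (r (delta_mx 0 i)); rewrite (dot_s _ _ (delta_mx 0 i)) // => <-.
      rewrite /dot (bigD1 i) //= mxE !eqxx mul1r big1 ?addr0 // => l li.
      by rewrite mxE (negPf li) andbF mul0r.
  exists K; split; last by exists D, (fun d x => dot (s d) (k x)).
  exists n, k, t; split=> // f; have [d dE] := dual_reflexive f DT DK.
  have [g gE] := ex_linear (dot_linear (s d)).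
  by exists g => x; rewrite gE dE.
(* Right half: the cokernel C of the embedding of Z' in R^n is the dual of the syzygy K, and forms
   on Z' extend because Z is reflexive. *)
have [K [[n [k [p [kp kR]]]] KT]] := tot_refl_syz ZT.
have [k_inj p_surj kpE] := kp.
have /choice[q qE] : forall i, exists q : {linear Z' -> R^o},
    forall z', q z' = b (p (delta_mx 0 i)) z'.
  by move=> i; apply/ex_linear/b_r.
have [t tE] := ex_row q.
have dot_t v z' : dot v (t z') = b (p v) z'.
  have [g gE] := ex_linear (b_l z'); rewrite -gE.
  rewrite [p v]free_mapE linear_sum; apply: eq_bigr => i _.
  by rewrite tE qE linearZ gE.
have t_inj : injective t.
  apply: linear_inj => z' z'0; apply: b_uniq => z.
  have [v <-] := p_surj z; rewrite -dot_t z'0.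
  by rewrite /dot big1 // => i _; rewrite mxE mulr0.
have [C [c tc]] := ex_cokernel t_inj; have [_ c_surj tcE] := tc.
have /choice[s sK] := c_surj.
have dot_s x d v : c v = d -> dot (k x) (s d) = dot (k x) v.
  move=> cv; have /tcE[z' z'E] : c (s d - v) = 0 by rewrite linearB cv sK subrr.
  apply/eqP; rewrite -subr_eq0; apply/eqP.
  have [g gE] := ex_linear (dot_linear (k x)).
  rewrite -!gE -linearB gE -z'E dot_t (ses_comp0 _ kp).
  by have [l lE] := ex_linear (b_l z'); rewrite -lE raddf0.
have KC : dual_pairing (fun x d => dot (k x) (s d)).
  split=> [d a x y|x a d1 d2|f|d d0].
  - by rewrite linearP !(dotC _ (s d)) dot_linear.
  - rewrite (dot_s _ _ (a *: s d1 + s d2)); last by rewrite linearP !sK.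
    by rewrite dot_linear.
  - have [g gE] := kR f; have [w wE] := dot_repr g.
    by exists (c w) => x; rewrite (dot_s _ _ w) // -gE wE dotC.
  - have [g gE] := ex_linear (dot_linear (s d)).
    have gk x : g (k x) = 0 by rewrite gE dotC d0.
    have [h hE] := ses_factor kp gk; have [z' z'E] := b_ex h.
    rewrite -(sK d); apply/tcE; exists z'; apply/rowP => i.
    rewrite tE qE z'E hE gE /dot (bigD1 i) //= mxE !eqxx mulr1 big1 ?addr0 // => l li.
    by rewrite mxE (negPf li) andbF mulr0.
exists C; split; last by exists K, (fun x d => dot (k x) (s d)).
exists n, t, c; split=> // f; have [z zE] := dual_reflexive f ZT bP.
have [v vE] := p_surj z; have [g gE] := ex_linear (dot_linear v).
by exists g => z'; rewrite gE dot_t vE zE.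
Qed.

End Duality.

(** * The dual of the algebra *)

Section NoetherianBase.
Variable R : comPzRingType.
Implicit Types M X Y Z C K : lmodType R.

(** R is a finite algebra over itself, so the results on finite algebras specialize to R-modules. *)
Lemma id_central : central_hom (idfun : {rmorphism R -> R}).
Proof. by move=> r a; rewrite mulrC. Qed.

Lemma id_finite : fin_gen (restrict (idfun : {rmorphism R -> R}) R^o).
Proof.
by exists 1%N, (fun=> 1) => x; exists (fun=> x); rewrite big_ord1 [RHS]mulr1.
Qed.

Hypothesis R_noetherian : noetherian R.

Lemma base_tot_reflP M : fin_gen M -> (Gorenstein_projective M <-> tot_refl M).
Proof. exact: (tot_reflP R_noetherian id_central id_finite). Qed.

Lemma base_tot_refl_retract X Y (a : {linear X -> Y}) (b : {linear Y -> X}) :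
  (forall x, b (a x) = x) -> tot_refl Y -> tot_refl X.
Proof. exact: (tot_refl_retract R_noetherian id_central id_finite). Qed.

Lemma base_tot_refl_kernel K Y Z (i : {linear K -> Y}) (p : {linear Y -> Z}) :
  ses i p -> tot_refl Y -> tot_refl Z -> tot_refl K.
Proof. exact: (tot_refl_kernel R_noetherian id_central id_finite). Qed.

Lemma base_tot_refl_cokernel X Y C (i : {linear X -> Y}) (p : {linear Y -> C}) :
  ses i p -> hom_ext R^o i -> tot_refl X -> tot_refl Y -> tot_refl C.
Proof. exact: (tot_refl_cokernel R_noetherian id_central id_finite). Qed.

Lemma base_fin_gen_sub K M (i : {linear K -> M}) :
  injective i -> fin_gen M -> fin_gen K.
Proof. exact: (fin_gen_sub R_noetherian id_finite). Qed.

Lemma base_free_embedding X : fin_gen X ->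
  (forall x, (forall u : {linear X -> R^o}, u x = 0) -> x = 0) ->
  exists n C (i : {linear X -> 'rV[R]_n}) (q : {linear 'rV[R]_n -> C}),
    ses i q /\ hom_ext R^o i.
Proof. exact: (free_embedding R_noetherian id_central id_finite). Qed.

End NoetherianBase.

(* N belongs to add M. *)
Definition addin (B : pzRingType) (N M : lmodType B) : Prop :=
  exists n (u : 'I_n -> {linear N -> M}) (v : 'I_n -> {linear M -> N}),
    forall x, \sum_j v j (u j x) = x.

Lemma hom_ext_addin (B : pzRingType) (N M X Y : lmodType B)
    (i : {linear X -> Y}) : addin N M -> hom_ext M i -> hom_ext N i.
Proof.
move=> [n [u [v uv]]] iM f.
have /choice[g gE] := fun j => iM (u j \o f).
have [h hE] : exists h : {linear Y -> N}, forall y, h y = \sum_j v j (g j y).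
  apply: ex_linear => a x y; rewrite scaler_sumr -big_split.
  by apply: eq_bigr => j _; rewrite !linearP.
by exists h => x; rewrite hE -[RHS]uv; apply: eq_bigr => j _; rewrite gE.
Qed.

Section AlgebraDual.
Variables (R : comPzRingType) (A : pzRingType) (phi : {rmorphism R -> A}).
Hypothesis phiC : central_hom phi.

(* W is the left A-module Hom_R(A, R), with (b w)(a) = w(a b). *)
Definition algebra_dual (W : lmodType A) (ev : W -> A -> R) : Prop :=
  [/\ forall w r x y, ev w (phi r * x + y) = r * ev w x + ev w y,
      forall b w w' a, ev (b *: w + w') a = ev w (a * b) + ev w' a,
      forall f : {linear restrict phi A^o -> R^o}, exists w, forall a, ev w a = f a
    & forall w, (forall a, ev w a = 0) -> w = 0].

Record dual_type := DualType {
  dual_val :> A -> R;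
  _ : forall r x y, dual_val (phi r * x + y) = r * dual_val x + dual_val y }.

HB.instance Definition _ := gen_eqMixin dual_type.
HB.instance Definition _ := gen_choiceMixin dual_type.

Let dualP (w : dual_type) r x y : w (phi r * x + y) = r * w x + w y.
Proof. by case: w. Qed.

Let dual_eq (w w' : dual_type) : (forall a, w a = w' a) -> w = w'.
Proof.
case: w w' => w wP [w' w'P] /= /funext ww'.
by case: _ / ww' in w'P *; congr DualType; apply: Prop_irrelevance.
Qed.

Let dualD (w : dual_type) x y : w (x + y) = w x + w y.
Proof. by have := dualP w 1 x y; rewrite rmorph1 !mul1r. Qed.

Fact dual_add_subproof (u w : dual_type) r x y :
  u (phi r * x + y) + w (phi r * x + y) = r * (u x + w x) + (u y + w y).
Proof. by rewrite !dualP mulrDr addrACA. Qed.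
Fact dual_opp_subproof (w : dual_type) r x y :
  - w (phi r * x + y) = r * - w x + - w y.
Proof. by rewrite dualP opprD mulrN. Qed.
Fact dual_zero_subproof (r : R) (x y : A) : 0 = r * 0 + 0 :> R.
Proof. by rewrite mulr0 addr0. Qed.
Fact dual_scale_subproof b (w : dual_type) r x y :
  w ((phi r * x + y) * b) = r * w (x * b) + w (y * b).
Proof. by rewrite mulrDl -mulrA dualP. Qed.

Definition dual_add u w := DualType (dual_add_subproof u w).
Definition dual_opp w := DualType (dual_opp_subproof w).
Definition dual_zero := DualType dual_zero_subproof.
Definition dual_scale b w := DualType (dual_scale_subproof b w).

Fact dual_addA : associative dual_add.
Proof. by move=> u v w; apply: dual_eq => a; apply: addrA. Qed.
Fact dual_addC : commutative dual_add.
Proof. by move=> u v; apply: dual_eq => a; apply: addrC. Qed.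
Fact dual_add0 : left_id dual_zero dual_add.
Proof. by move=> u; apply: dual_eq => a; apply: add0r. Qed.
Fact dual_addN : left_inverse dual_zero dual_opp dual_add.
Proof. by move=> u; apply: dual_eq => a; apply: addNr. Qed.
HB.instance Definition _ :=
  GRing.isZmodule.Build dual_type dual_addA dual_addC dual_add0 dual_addN.

Fact dual_scalerA a b w : dual_scale a (dual_scale b w) = dual_scale (a * b) w.
Proof. by apply: dual_eq => x /=; rewrite mulrA. Qed.
Fact dual_scale1r : left_id 1 dual_scale.
Proof. by move=> w; apply: dual_eq => x /=; rewrite mulr1. Qed.
Fact dual_scalerDr : right_distributive dual_scale +%R.
Proof. by move=> a u v; apply: dual_eq. Qed.
Fact dual_scalerDl w : {morph dual_scale^~ w : a b / a + b}.
Proof. by move=> a b; apply: dual_eq => x /=; rewrite mulrDr dualD. Qed.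
HB.instance Definition _ := GRing.Zmodule_isLmodule.Build A dual_type
  dual_scalerA dual_scale1r dual_scalerDr dual_scalerDl.

Lemma ex_algebra_dual : exists (W : lmodType A) ev, algebra_dual (W := W) ev.
Proof.
exists dual_type, dual_val; split=> [w r x y|//|f|w w0].
- exact: dualP.
- have fP r x y : f (phi r * x + y) = r * f x + f y by apply: linearP.
  by exists (DualType fP).
- by apply: dual_eq => a; rewrite w0.
Qed.

Variables (W : lmodType A) (ev : W -> A -> R).
Hypothesis evP : algebra_dual ev.

Let evDr w r x y : ev w (phi r * x + y) = r * ev w x + ev w y.
Proof. by case: evP. Qed.
Let evDl b w w' a : ev (b *: w + w') a = ev w (a * b) + ev w' a.
Proof. by case: evP. Qed.
Let evD w w' a : ev (w + w') a = ev w a + ev w' a.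
Proof. by have := evDl 1 w w' a; rewrite scale1r mulr1. Qed.
Let ev0 w : ev w 0 = 0.
Proof.
apply: (addrI (ev w 0)); rewrite addr0.
by have := evDr w 1 0 0; rewrite mulr0 addr0 mul1r => <-.
Qed.
Lemma algebra_dual0 a : ev 0 a = 0.
Proof. by apply: (addrI (ev 0 a)); rewrite -evD !addr0. Qed.
Lemma algebra_dualZ b w a : ev (b *: w) a = ev w (a * b).
Proof. by have := evDl b w 0 a; rewrite !addr0 algebra_dual0 addr0. Qed.
Let ev_eq w w' : (forall a, ev w a = ev w' a) -> w = w'.
Proof.
case: evP => _ _ _ ev_inj e; apply/eqP; rewrite -subr_eq0; apply/eqP/ev_inj => a.
by apply: (addIr (ev w' a)); rewrite -evD subrK add0r.
Qed.

Let ev_ex (f : {linear restrict phi A^o -> R^o}) : exists w, forall a, ev w a = f a.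
Proof. by case: evP => _ _ + _; apply. Qed.

Lemma algebra_dual_pairing :
  dual_pairing (fun (a : restrict phi A^o) (w : restrict phi W) => ev w a).
Proof.
split=> [w r x y|a r w w'|//|]; first exact: evDr.
  rewrite -[LHS]/(ev (phi r *: (w : W) + w') a) evDl -phiC.
  by have := evDr w r a 0; rewrite !addr0 ev0 addr0 => ->.
by case: evP.
Qed.

(** Coinduction: Hom_R(X, R) is Hom_A(X, W). The inverse is evaluation at 1, see [ex_eval1]. *)
Lemma ex_adjoint (X : lmodType A) (f : {linear restrict phi X -> R^o}) :
  exists g : {linear X -> W}, forall x a, ev (g x) a = f (a *: x : X).
Proof.
have /choice[g gE] : forall x : X, exists w, forall a, ev w a = f (a *: x : X).
  move=> x.
  have lin : linear ((fun a : A => f (a *: x : X)) : restrict phi A^o -> R^o).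
    move=> r a b; rewrite -linearP; congr (f _).
    by rewrite -[in LHS]/(phi r * (a : A) + (b : A)) scalerDl -scalerA.
  by have [h hE] := ex_linear lin; have [w wE] := ev_ex h; exists w => a; rewrite wE hE.
have g_lin : linear g.
  move=> b x y; apply: ev_eq => a; rewrite evDl !gE scalerDr scalerA.
  exact: (linearD f).
by have [h hE] := ex_linear g_lin; exists h => x a; rewrite hE gE.
Qed.

Lemma ex_eval1 (X : lmodType A) (g : {linear X -> W}) :
  exists f : {linear restrict phi X -> R^o}, forall x : X, f x = ev (g x) 1.
Proof.
apply: ex_linear => r x y; rewrite -[in LHS]/(phi r *: (x : X) + (y : X)).
rewrite linearP evDl mul1r; congr (_ + _).
by have := evDr (g x) r 1 0; rewrite mulr1 !addr0 ev0 addr0.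
Qed.

(* Hom_A(-, W) and Hom_R(-, R) are naturally isomorphic on A-modules. *)
Lemma hom_ext_dual (X Y : lmodType A) (i : {linear X -> Y}) :
  hom_ext W i <-> hom_ext R^o (restrict_lin phi i).
Proof.
split=> iW f.
  have [F FE] := ex_adjoint f; have [G GE] := iW F.
  have [g gE] := ex_eval1 G; exists g => x.
  by rewrite -[LHS]/(g (i x : Y)) gE GE FE scale1r.
have [F FE] := ex_eval1 f; have [G GE] := iW F.
have [g gE] := ex_adjoint G; exists g => x; apply: ev_eq => a.
by rewrite gE -linearZ -[LHS]/(G (restrict_lin phi i (a *: x))) GE FE linearZ algebra_dualZ mul1r.
Qed.

End AlgebraDual.

(** * The criterion for ascent and descent *)

Section Criterion.
Variables (R : comPzRingType) (A : pzRingType) (phi : {rmorphism R -> A}).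

Definition module_ascent_descent : Prop := forall M : lmodType A, fin_gen M ->
  (Gorenstein_projective M <-> Gorenstein_projective (restrict phi M)).

(* A is Gorenstein projective over R and add A = add Hom_R(A, R). *)
Definition relative_Frobenius : Prop :=
  tot_refl (restrict phi A^o) /\
  exists (W : lmodType A) (ev : W -> A -> R),
    [/\ algebra_dual phi ev, addin W A^o & addin A^o W].

Hypotheses (R_noetherian : noetherian R) (phiC : central_hom phi).
Hypothesis A_finite : fin_gen (restrict phi A^o).
Implicit Types U V X Y Z N K C M F P Q : lmodType A.

Lemma module_ascent_descentE : module_ascent_descent <->
  forall M : lmodType A, fin_gen M -> (tot_refl M <-> tot_refl (restrict phi M)).
Proof.
split=> h M Mfg; have := h M Mfg; have MR := proj1 (fin_gen_restrict A_finite M) Mfg.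
  by rewrite (tot_reflP R_noetherian phiC A_finite Mfg)
    (base_tot_reflP R_noetherian MR).
by rewrite (tot_reflP R_noetherian phiC A_finite Mfg)
  (base_tot_reflP R_noetherian MR).
Qed.

Lemma tot_refl_regular : tot_refl (A^o : lmodType A).
Proof.
have [c cE] := @ex_coord A 1 ord0.
have [r rE] := ex_row (fun _ : 'I_1 => (idfun : {linear A^o -> A^o})).
apply: (tot_refl_retract R_noetherian phiC A_finite (a := r) (b := c)).
  by move=> x; rewrite cE rE.
exact: tot_refl_free.
Qed.

Lemma tot_refl_restrict_zero M : (forall x y : M, x = y) ->
  tot_refl (restrict phi A^o) -> tot_refl (restrict phi M).
Proof.
move=> M0 AT; pose z : {linear restrict phi M -> restrict phi A^o} := \0.
pose z' : {linear restrict phi A^o -> restrict phi M} := \0.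
apply: (base_tot_refl_retract R_noetherian (a := z) (b := z')) AT => x.
exact: M0.
Qed.

Lemma tot_refl_restrict_free n :
  tot_refl (restrict phi A^o) -> tot_refl (restrict phi 'rV[A]_n).
Proof.
move=> AT; elim: n => [|n IHn].
  by apply: tot_refl_restrict_zero => // x y; rewrite [x]thinmx0 [y]thinmx0.
have [i ip] := ex_ses_row_mx A n.
exact: tot_refl_extension (ses_restrict phi ip) AT IHn.
Qed.

Lemma tot_refl_restrict_power n W :
  tot_refl (restrict phi A^o) -> tot_refl (restrict phi W) ->
  tot_refl (restrict phi (fun_mod 'I_n W)).
Proof.
move=> AT WT; elim: n => [|n IHn].
  by apply: tot_refl_restrict_zero => // f g; apply: funext => -[].
have [i iE] : exists i : {linear W -> fun_mod 'I_n.+1 W},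
    forall w, i w = (fun k => if k == ord0 then w else 0).
  apply: ex_linear => a x y; apply: funext => k.
  rewrite -[RHS]/(a *: (if k == ord0 then x else 0) + (if k == ord0 then y else 0)).
  by case: ifP => // _; rewrite scaler0 addr0.
have [p pE] : exists p : {linear fun_mod 'I_n.+1 W -> fun_mod 'I_n W},
    forall f, p f = (fun k => f (lift ord0 k)).
  by apply: ex_linear.
have ip : ses i p.
  split=> [|f|f].
  - apply: linear_inj => w iw; have := congr1 (fun f => f ord0) iw.
    by rewrite iE eqxx.
  - exists (fun k => if unlift ord0 k is Some j then f j else 0).
    by rewrite pE; apply: funext => k; rewrite liftK.
  - rewrite pE; split=> [f0|[w <-]]; last by rewrite iE; apply: funext.
    exists (f ord0); rewrite iE; apply: funext => k.
    case: eqP => [->//|/eqP]; rewrite eq_sym => /unlift_some[j -> _].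
    by rewrite -[RHS]/((fun k => f (lift ord0 k)) j) f0.
exact: tot_refl_extension (ses_restrict phi ip) WT IHn.
Qed.

Lemma relative_Frobenius_of_ascent_descent :
  module_ascent_descent -> relative_Frobenius.
Proof.
move=> /module_ascent_descentE AD.
have Afg : fin_gen A^o by apply/(fin_gen_restrict A_finite).
have AT : tot_refl (restrict phi A^o) by apply/(AD _ Afg)/tot_refl_regular.
split=> //; have [W [ev evP]] := ex_algebra_dual phi.
have WTR : tot_refl (restrict phi W).
  exact: tot_refl_dual AT (algebra_dual_pairing phiC evP).
have Wfg : fin_gen W by apply/(fin_gen_restrict A_finite)/tot_refl_fin_gen.
have WT : tot_refl W by apply/AD.
(* A retraction onto W = Hom_R(A, R) amounts to an R-linear form on Y. *)
have split_W C Y (i : {linear W -> Y}) (q : {linear Y -> C}) : ses i q ->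
    tot_refl C -> exists s : {linear Y -> W}, forall w, s (i w) = w.
  move=> iq CT; have CTR : tot_refl (restrict phi C).
    by apply/AD => //; apply: tot_refl_fin_gen.
  have iR := tot_refl_ext0 CTR (ses_restrict phi iq).
  have iW : hom_ext W i by apply/(hom_ext_dual evP).
  by have [s sK] := iW idfun; exists s.
exists W, ev; split=> //.
  have [C [[n [i [q [iq _]]]] CT]] := tot_refl_cosyz WT.
  have [s sK] := split_W _ _ _ _ iq CT.
  have /choice[u uE] := @ex_coord A n.
  have /choice[v vE] : forall j, exists v : {linear A^o -> W},
      forall c, v c = (c : A) *: s (delta_mx 0 j).
    by move=> j; apply: ex_linear => a b c; rewrite scalerDl scalerA.
  exists n, (fun j => u j \o i), v => w; rewrite -[RHS]sK free_mapE.
  by apply: eq_bigr => j _; rewrite vE /= uE.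
have [n [g gP]] := tot_refl_fin_gen WTR.
have [d dE] : exists d : {linear A^o -> fun_mod 'I_n W},
    forall a, d a = (fun j => (a : A) *: (g j : W)).
  apply: ex_linear => a b c; apply: funext => j.
  by rewrite -[RHS]/(a *: ((b : A) *: (g j : W)) + (c : A) *: (g j : W))
     scalerDl scalerA.
have YT := tot_refl_restrict_power n AT WTR.
have /choice[e eE] : forall a : A, exists e : {linear restrict phi W -> R^o},
    forall w, e w = ev w a.
  by move=> a; have [_ b_r _ _] := algebra_dual_pairing phiC evP; apply: ex_linear.
have [_ _ ev_ex ev_inj] := evP.
(* An R-form on A is an element w of W, a combination of the generators [g j] with coefficients
   [c j]. The same combination of the values y_j(1) extends it to y in W^n, since (a g_j)(1) =
   g_j(a). *)
have dR : hom_ext R^o (restrict_lin phi d).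
  move=> f; have [w wE] := ev_ex f; have [c cE] := gP w.
  have [h hE] : exists h : {linear restrict phi (fun_mod 'I_n W) -> R^o},
      forall y, h y = \sum_j c j * ev ((y : fun_mod 'I_n W) j) 1.
    apply: ex_linear => r x y; rewrite scaler_sumr -big_split.
    apply: eq_bigr => j _ /=.
    rewrite -[X in ev X 1]/(phi r *: ((x : fun_mod 'I_n W) j : W) + (y : fun_mod 'I_n W) j).
    by rewrite -!eE (linearP (e 1)) mulrDr mulrCA.
  exists h => a; rewrite hE -wE -eE cE linear_sum; apply: eq_bigr => j _.
  by rewrite -[restrict_lin phi d a]/(d a) dE (algebra_dualZ evP) mul1r linearZ eE.
have d_inj : injective d.
  apply: linear_inj => a da; apply: (tot_refl_torsionless AT) => f.
  have [h <-] := dR f.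
  by rewrite -[restrict_lin phi d a]/(d a) da (raddf0 h).
have [C [q dq]] := ex_cokernel d_inj; have [_ q_surj _] := dq.
have CTR : tot_refl (restrict phi C).
  exact: (base_tot_refl_cokernel R_noetherian (ses_restrict phi dq) dR AT YT).
(* The cokernel is totally reflexive over R, and descent carries this to A. So Ext^1_A(C, A) = 0,
   and the identity of A extends to a retraction of W^n. *)
have CT : tot_refl C.
  by apply/AD => //; apply/(fin_gen_restrict A_finite)/tot_refl_fin_gen.
have [s sK] := tot_refl_ext0 CT dq idfun.
have /choice[u uE] : forall j, exists u : {linear A^o -> W},
    forall a, u a = (a : A) *: (g j : W).
  by move=> j; apply: ex_linear => a b c; rewrite scalerDl scalerA.
have /choice[l lE] : forall j, exists l : {linear W -> fun_mod 'I_n W},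
    forall w, l w = (fun k => if k == j then w else 0).
  move=> j; apply: ex_linear => a x y; apply: funext => k.
  rewrite -[RHS]/(a *: (if k == j then x else 0) + (if k == j then y else 0)).
  by case: ifP => // _; rewrite scaler0 addr0.
exists n, u, (fun j => s \o l j) => a; rewrite -[RHS]sK -linear_sum; congr (s _).
rewrite dE; apply: funext => k.
have sum_fun (r : seq 'I_n) (F : 'I_n -> fun_mod 'I_n W) :
    (\sum_(j <- r) F j) k = \sum_(j <- r) F j k.
  elim: r => [|j r IH]; first by rewrite !big_nil.
  by rewrite !big_cons -IH.
rewrite sum_fun (bigD1 k) //= lE eqxx uE big1 ?addr0 // => j jk.
by rewrite lE eq_sym (negPf jk).
Qed.

(** A complete resolution over A stays exact under Hom_R(-, R) = Hom_A(-, W) because W is in add A.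
    Its terms are powers of A, totally reflexive over R, and the stability theorem concludes. *)
Lemma ascent_of_relative_Frobenius M :
  relative_Frobenius -> tot_refl M -> tot_refl (restrict phi M).
Proof.
move=> [AT [W [ev [evP WA AW]]]] MT.
pose P (Z : lmodType R) := exists2 M : lmodType A, tot_refl M & Z = restrict phi M :> lmodType R.
have hom_ext_W X Y (i : {linear X -> Y}) :
    hom_ext A^o i -> hom_ext R^o (restrict_lin phi i).
  by move=> iA; apply/(hom_ext_dual evP)/(hom_ext_addin WA).
apply: (@tot_refl_stable R P); last by exists M.
  move=> _ [X XT ->]; have [K [[n [i [p [ip iA]]]] KT]] := tot_refl_syz XT.
  exists (restrict phi K), (restrict phi 'rV[A]_n), (restrict_lin phi i),
    (restrict_lin phi p); split=> //.
  - exact: hom_ext_W.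
  - by exists K.
  - exact: tot_refl_restrict_free.
move=> _ [X XT ->]; have [C [[n [i [p [ip iA]]]] CT]] := tot_refl_cosyz XT.
exists (restrict phi C), (restrict phi 'rV[A]_n), (restrict_lin phi i),
  (restrict_lin phi p); split=> //.
- exact: hom_ext_W.
- by exists C.
- exact: tot_refl_restrict_free.
Qed.

(** The resolution is built over A from any free cover and from the approximation by forms; total
    reflexivity over R passes to its kernels and cokernels. On the left, A in add W turns exactness
    for R into exactness for A; on the right, W in add A does the converse. *)
Lemma descent_of_relative_Frobenius M : relative_Frobenius ->
  fin_gen M -> tot_refl (restrict phi M) -> tot_refl M.
Proof.
move=> [AT [W [ev [evP WA AW]]]] Mfg MT.
pose P X := fin_gen X /\ tot_refl (restrict phi X).
split; exists P; split=> // {M Mfg MT} X [Xfg XT].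
  have /fin_genP[n [p p_surj]] := Xfg; have [K [k kp]] := ex_kernel p_surj.
  exists K; split.
    exists n, k, p; split=> //; apply: (hom_ext_addin AW).
    by apply/(hom_ext_dual evP)/(tot_refl_ext0 XT (ses_restrict phi kp)).
  split; last first.
    exact: (base_tot_refl_kernel R_noetherian (ses_restrict phi kp)
      (tot_refl_restrict_free n AT) XT).
  have [k_inj _ _] := kp.
  exact: (fin_gen_sub R_noetherian A_finite k_inj (fin_gen_free A n)).
(* R-forms separate the points of X. Each one comes from an A-linear map to W, and such a map is a
   sum of maps that factor through A. *)
have Xtl x : (forall u : {linear X -> A^o}, u x = 0) -> x = 0.
  move=> ux; apply: (tot_refl_torsionless XT) => f.
  have [F FE] := ex_adjoint evP f; have := FE x 1; rewrite scale1r => <-.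
  have [n [u [v uv]]] := WA.
  rewrite -(uv (F x)) big1 => [|j _].
    exact: (algebra_dual0 evP).
  by rewrite -[u j _]/((u j \o F) x) ux raddf0.
have [n [C [i [q [iq iA]]]]] :=
  free_embedding R_noetherian phiC A_finite Xfg Xtl.
exists C; split; first by exists n, i, q.
split; first by apply/fin_genP; have [_ q_surj _] := iq; exists n, q.
apply: (base_tot_refl_cokernel R_noetherian (ses_restrict phi iq) _ XT).
  by apply/(hom_ext_dual evP)/(hom_ext_addin WA).
exact: tot_refl_restrict_free.
Qed.

Lemma ascent_descent_criterion : module_ascent_descent <-> relative_Frobenius.
Proof.
split=> [|F]; first exact: relative_Frobenius_of_ascent_descent.
apply/module_ascent_descentE => M Mfg; split.
  exact: ascent_of_relative_Frobenius.
exact: descent_of_relative_Frobenius.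
Qed.

End Criterion.

(** * Localization *)

Section Localizes.
Variables (R R' : comPzRingType) (A A' : pzRingType).
Variables (phi : {rmorphism R -> A}) (phi' : {rmorphism R' -> A'}).
Variables (lam : {rmorphism R -> R'}) (lamA : {rmorphism A -> A'}).
Variable S : {pred R}.

(* f exhibits M' as the localization of M at S, once the elements of S are
   invertible in R'. *)
Definition localizes (M : lmodType A) (M' : lmodType A') (f : M -> M') : Prop :=
  [/\ forall a x y, f (a *: x + y) = lamA a *: f x + f y,
      forall x, f x = 0 -> exists2 s, s \in S & phi s *: x = 0
    & forall y, exists s x, s \in S /\ phi' (lam s) *: y = f x].

Record localization : Prop := Localization {
  loc_closed : mulr_closed S;
  loc_square : forall r, lamA (phi r) = phi' (lam r);
  loc_unit : forall s, s \in S -> exists u, u * lam s = 1;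
  loc_regular : localizes (lamA : A^o -> A'^o) }.

Hypothesis LP : localization.
Hypotheses (phiC : central_hom phi) (phiC' : central_hom phi').

Let S1 : 1 \in S. Proof. by case: LP => -[]. Qed.
Let SM s t : s \in S -> t \in S -> s * t \in S.
Proof. by case: LP => -[_ +] _ _ _; apply. Qed.
Let sq := loc_square LP.

Lemma common_multiple n (P : 'I_n -> R -> Prop) :
  (forall i s t, t \in S -> P i s -> P i (t * s)) ->
  (forall i, exists2 s, s \in S & P i s) -> exists2 s, s \in S & forall i, P i s.
Proof.
move=> PM exP.
have /choice[s sP] : forall i, exists s, s \in S /\ P i s.
  by move=> i; have [s sS Ps] := exP i; exists s.
have prodS (Q : pred 'I_n) : \prod_(i | Q i) s i \in S.
  by apply: (big_ind (fun x => x \in S)) => [||i _] //; case: (sP i).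
exists (\prod_i s i) => // i; rewrite (bigD1 i) //= mulrC.
by apply: PM => //; case: (sP i).
Qed.

Section Basic.
Variables (M : lmodType A) (M' : lmodType A') (f : M -> M').
Hypothesis fP : localizes f.

Let fl a x y : f (a *: x + y) = lamA a *: f x + f y. Proof. by case: fP. Qed.

Lemma localizesD x y : f (x + y) = f x + f y.
Proof. by have := fl 1 x y; rewrite rmorph1 !scale1r. Qed.
Lemma localizes0 : f 0 = 0.
Proof. by apply: (addrI (f 0)); rewrite -localizesD !addr0. Qed.
Lemma localizesZ a x : f (a *: x) = lamA a *: f x.
Proof. by have := fl a x 0; rewrite localizes0 !addr0. Qed.
Lemma localizesB x y : f (x - y) = f x - f y.
Proof. by apply: (addIr (f y)); rewrite -localizesD !subrK. Qed.
Lemma localizes_sum n (x : 'I_n -> M) : f (\sum_i x i) = \sum_i f (x i).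
Proof.
apply: (big_ind2 (fun x y => f x = y)) => [|x1 y1 x2 y2 <- <-|//].
  exact: localizes0.
exact: localizesD.
Qed.

Lemma localizesS r x : f (phi r *: x) = phi' (lam r) *: f x.
Proof. by rewrite localizesZ sq. Qed.

End Basic.

Lemma loc_cancel (M' : lmodType A') s (y : M') :
  s \in S -> phi' (lam s) *: y = 0 -> y = 0.
Proof.
move=> /(loc_unit LP)[u us] sy.
by rewrite -[y]scale1r -(rmorph1 phi') -us rmorphM -scalerA sy scaler0.
Qed.

Lemma loc_inj (M' : lmodType A') s (y z : M') :
  s \in S -> phi' (lam s) *: y = phi' (lam s) *: z -> y = z.
Proof.
move=> sS e; apply/eqP; rewrite -subr_eq0; apply/eqP/(loc_cancel sS).
by rewrite scalerBr e subrr.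
Qed.

Lemma loc_div (M' : lmodType A') s (y : M') :
  s \in S -> exists z, phi' (lam s) *: z = y.
Proof.
move=> /(loc_unit LP)[u us]; exists (phi' u *: y).
by rewrite scalerA -rmorphM mulrC us rmorph1 scale1r.
Qed.

Lemma localizes_ext (M : lmodType A) (M' N' : lmodType A') (f : M -> M')
    (g h : {linear M' -> N'}) :
  localizes f -> (forall x, g (f x) = h (f x)) -> g =1 h.
Proof.
move=> [_ _ f_surj] gh y; have [s [x [sS sy]]] := f_surj y.
by apply: (loc_inj sS); rewrite -!linearZ sy gh.
Qed.

Lemma loc_map (M N : lmodType A) (M' N' : lmodType A')
    (f : M -> M') (g : N -> N') (h : {linear M -> N}) :
  localizes f -> localizes g ->
  exists h' : {linear M' -> N'}, forall x, h' (f x) = g (h x).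
Proof.
move=> fP gP; have [_ f_inj f_surj] := fP.
(* The image is required to be compatible with every fraction that represents [y], not just one;
   linearity can then be checked on convenient fractions. *)
have ex y : exists z, forall s x, s \in S -> phi' (lam s) *: y = f x ->
    phi' (lam s) *: z = g (h x).
  have [s0 [x0 [s0S e0]]] := f_surj y.
  have [z ze] := loc_div (g (h x0)) s0S; exists z => s x sS e.
  have [t tS te] : exists2 t, t \in S & phi t *: (phi s *: x0 - phi s0 *: x) = 0.
    apply: f_inj; rewrite (localizesB fP) !(localizesS fP) -e -e0 !scalerA.
    by rewrite -!rmorphM mulrC subrr.
  apply: (loc_inj s0S); rewrite scalerA -!rmorphM mulrC !rmorphM -scalerA ze.
  apply/eqP; rewrite -!(localizesS gP) -subr_eq0 -(localizesB gP); apply/eqP.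
  apply: (loc_cancel tS); rewrite -(localizesS gP) -!linearZ -linearB -linearZ te.
  by rewrite raddf0 (localizes0 gP).
have [h' h'P] := choice ex.
have h'_lin : linear h'.
  move=> a y1 y2; have [s1 [x1 [s1S e1]]] := f_surj y1.
  have [s2 [x2 [s2S e2]]] := f_surj y2.
  (* Linearity is over A', so the scalar is a fraction as well; [s2 * s * s1] clears its denominator
     and those of both vectors. *)
  have [_ _ lamA_surj] := loc_regular LP; have [s [b [sS e]]] := lamA_surj a.
  have e' : phi' (lam s) * a = lamA b by [].
  have key1 : phi' (lam (s2 * s * s1)) * a = phi' (lam s2) * lamA b * phi' (lam s1).
    by rewrite !rmorphM -e' -!mulrA; congr (_ * (_ * _)); rewrite phiC'.
  have key2 : phi' (lam (s2 * s * s1)) = phi' (lam (s * s1)) * phi' (lam s2).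
    by rewrite -mulrA mulrC !rmorphM.
  have S3 : s2 * s * s1 \in S by rewrite !SM.
  have eq : phi' (lam (s2 * s * s1)) *: (a *: y1 + y2) =
            f ((phi s2 * b) *: x1 + phi (s * s1) *: x2).
    rewrite scalerDr scalerA key1 -scalerA e1.
    rewrite key2 -[(_ * phi' (lam s2)) *: y2]scalerA e2.
    by rewrite (localizesD fP) (localizesZ fP) (localizesS fP) [lamA (_ * _)]rmorphM sq.
  apply: (loc_inj S3); rewrite (h'P _ _ _ S3 eq) scalerDr scalerA key1 -[(_ * phi' (lam s1)) *: _]scalerA.
  rewrite (h'P _ _ _ s1S e1) key2 -[(_ * phi' (lam s2)) *: _]scalerA (h'P _ _ _ s2S e2) linearD !linearZ /=.
  by rewrite (localizesD gP) (localizesZ gP) (localizesS gP) [lamA (_ * _)]rmorphM sq.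
have [k kE] := ex_linear h'_lin; exists k => x; rewrite kE.
have := h'P (f x) 1 x S1; rewrite !rmorph1 !scale1r; exact.
Qed.

Lemma loc_map_surj (M N : lmodType A) (M' N' : lmodType A')
    (f : M -> M') (g : N -> N') (h : {linear M -> N}) (h' : {linear M' -> N'}) :
  localizes g -> (forall x, h' (f x) = g (h x)) ->
  (forall y, exists x, h x = y) -> forall y, exists x, h' x = y.
Proof.
move=> [_ _ g_surj] h'E h_surj y; have [s [n [sS e]]] := g_surj y.
have [x xn] := h_surj n; have [z ze] := loc_div (f x) sS.
by exists z; apply: (loc_inj sS); rewrite -linearZ ze h'E xn.
Qed.

Lemma loc_map_inj (M N : lmodType A) (M' N' : lmodType A')
    (f : M -> M') (g : N -> N') (h : {linear M -> N}) (h' : {linear M' -> N'}) :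
  localizes f -> localizes g -> (forall x, h' (f x) = g (h x)) ->
  injective h -> injective h'.
Proof.
move=> fP gP h'E h_inj; have [_ _ f_surj] := fP; have [_ g_inj _] := gP.
apply: linear_inj => y hy; have [s [x [sS e]]] := f_surj y.
have [t tS te] : exists2 t, t \in S & phi t *: h x = 0.
  by apply: g_inj; rewrite -h'E -e linearZ hy /= scaler0.
have tx : phi t *: x = 0 by apply: h_inj; rewrite linearZ /= te raddf0.
apply: (loc_cancel sS); apply: (loc_cancel tS).
by rewrite e -(localizesS fP) tx (localizes0 fP).
Qed.

Lemma loc_kernel (K M N : lmodType A) (K' M' N' : lmodType A')
    (i : {linear K -> M}) (p : {linear M -> N})
    (i' : {linear K' -> M'}) (p' : {linear M' -> N'}) (f : M -> M') (g : N -> N') :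
  ses i p -> ses i' p' -> localizes f -> localizes g ->
  (forall x, p' (f x) = g (p x)) ->
  exists k : K -> K', localizes k /\ forall x, i' (k x) = f (i x).
Proof.
move=> [i_inj p_surj ipE] [i'_inj p'_surj ipE'] fP gP p'E.
have [fl f_inj f_surj] := fP; have [_ g_inj _] := gP.
have /choice[k kE] : forall x, exists y, i' y = f (i x).
  by move=> x; apply/ipE'; rewrite p'E (proj2 (ipE _)) ?(localizes0 gP) //; exists x.
exists k; split=> //; split=> [a x y|x kx|y].
- by apply: i'_inj; rewrite linearP !kE linearP fl.
- have [s sS se] : exists2 s, s \in S & phi s *: i x = 0.
    by apply: f_inj; rewrite -kE kx raddf0.
  by exists s => //; apply: i_inj; rewrite linearZ /= se raddf0.
- have [s [m [sS e]]] := f_surj (i' y).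
  have [t tS te] : exists2 t, t \in S & phi t *: p m = 0.
    have pi : p' (i' y) = 0 by apply/ipE'; exists y.
    by apply: g_inj; rewrite -p'E -e linearZ /= pi scaler0.
  have /ipE[x xE] : p (phi t *: m) = 0 by rewrite linearZ /= te.
  exists (t * s), x; split; first exact: SM.
  apply: i'_inj; rewrite kE xE (localizesS fP) linearZ /= !rmorphM -scalerA.
  by rewrite -e.
Qed.

Lemma loc_cokernel (M N C : lmodType A) (M' N' C' : lmodType A')
    (i : {linear M -> N}) (p : {linear N -> C})
    (i' : {linear M' -> N'}) (p' : {linear N' -> C'}) (f : M -> M') (g : N -> N') :
  ses i p -> ses i' p' -> localizes f -> localizes g ->
  (forall x, i' (f x) = g (i x)) ->
  exists c : C -> C', localizes c /\ forall y, c (p y) = p' (g y).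
Proof.
move=> [i_inj p_surj ipE] [i'_inj p'_surj ipE'] fP gP i'E.
have [_ _ f_surj] := fP; have [gl g_inj g_surj] := gP.
have /choice[s sK] := p_surj.
have cE y : p' (g (s (p y))) = p' (g y).
  have /ipE[x xE] : p (s (p y) - y) = 0 by rewrite linearB sK subrr.
  apply/eqP; rewrite -subr_eq0 -linearB -(localizesB gP) -xE -i'E; apply/eqP.
  by apply/ipE'; exists (f x).
exists (fun z => p' (g (s z))); split=> //; split=> [a x y|x|z].
- by rewrite -{1}(sK x) -{1}(sK y) -linearP cE gl linearP.
- rewrite -(sK x); move: (s x) => y; rewrite cE => /ipE'[m' m'E].
  have [r [m [rS e]]] := f_surj m'.
  have [t tS te] : exists2 t, t \in S & phi t *: (phi r *: y - i m) = 0.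
    apply: g_inj; rewrite (localizesB gP) (localizesS gP) -i'E -e linearZ m'E.
    by rewrite subrr.
  exists (t * r); first exact: SM.
  have -> : phi (t * r) *: p y = p (phi t *: (phi r *: y - i m)).
    rewrite linearZ linearB (proj2 (ipE (i m))) ?subr0; last by exists m.
    by rewrite linearZ /= scalerA rmorphM.
  by rewrite te raddf0.
- have [y' <-] := p'_surj z; have [r [y [rS e]]] := g_surj y'.
  by exists r, (p y); split=> //; rewrite cE -e linearZ.
Qed.

End Localizes.

Section LocalizesHom.
Variables (R R' : comPzRingType) (A A' : pzRingType).
Variables (phi : {rmorphism R -> A}) (phi' : {rmorphism R' -> A'}).
Variables (lam : {rmorphism R -> R'}) (lamA : {rmorphism A -> A'}).
Variable S : {pred R}.
Local Notation localizes := (localizes phi phi' lam lamA S).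

Hypothesis LP : localization phi phi' lam lamA S.
Hypotheses (phiC : central_hom phi) (phiC' : central_hom phi').
Hypotheses (R_noetherian : noetherian R) (A_finite : fin_gen (restrict phi A^o)).

Let SM s t : s \in S -> t \in S -> s * t \in S.
Proof. by case: (loc_closed LP) => _; apply. Qed.

Lemma loc_annihilate (K N : lmodType A) (N' : lmodType A') (g : N -> N')
    (h1 h2 : {linear K -> N}) : localizes g -> fin_gen K ->
  (forall x, g (h1 x) = g (h2 x)) ->
  exists2 s, s \in S & forall x, phi s *: h1 x = phi s *: h2 x.
Proof.
move=> gP [n [k kP]] gh; have [_ g_inj _] := gP.
have [s sS sk] : exists2 s, s \in S & forall i, phi s *: (h1 (k i) - h2 (k i)) = 0.
  apply: (common_multiple LP) => [i s t _ e|i].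
    by rewrite rmorphM -scalerA e scaler0.
  by apply: g_inj; rewrite (localizesB gP) gh subrr.
exists s => // x; apply/eqP; rewrite -subr_eq0 -scalerBr; apply/eqP.
have [c ->] := kP x; rewrite -[h1 _ - h2 _]/((h1 \- h2) _) linear_sum.
by rewrite scaler_sumr big1 // => i _; rewrite linearZ scalerA phiC -scalerA sk scaler0.
Qed.

Lemma localizes_free n :
  localizes (map_mx lamA : 'rV[A]_n -> 'rV[A']_n).
Proof.
have [_ lam_inj lam_surj] := loc_regular LP.
split=> [a x y|x x0|y].
- by apply/rowP => i; rewrite !mxE rmorphD rmorphM.
- have [s sS sx] : exists2 s, s \in S & forall i, phi s * x 0 i = 0.
    apply: (common_multiple LP) => [i s t _ e|i].
      by rewrite rmorphM -mulrA e mulr0.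
    by apply: lam_inj; have /rowP/(_ i) := x0; rewrite !mxE.
  by exists s => //; apply/rowP => i; rewrite !mxE sx.
- have [s sS sy] : exists2 s, s \in S &
      forall i, exists x : A, phi' (lam s) * y 0 i = lamA x.
    apply: (common_multiple LP) => [i s t _ [x e]|i].
      exists (phi t * x); rewrite !rmorphM -mulrA e; congr (_ * _).
      by rewrite (loc_square LP).
    by have [s [x [sS e]]] := lam_surj (y 0 i); exists s => //; exists x.
  have [x xE] := choice sy; exists s, (\row_i x i); split=> //.
  by apply/rowP => i; rewrite !mxE xE.
Qed.

(** Hom commutes with localization for finitely presented M: one factor clears the denominators of
    the images of the generators, a second one kills the images of the relations, finitely generated
    since R is noetherian. *)
Lemma loc_hom_lift (M N : lmodType A) (M' N' : lmodType A')
    (f : M -> M') (g : N -> N') (g' : {linear M' -> N'}) :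
  localizes f -> localizes g -> fin_gen M ->
  exists2 s, s \in S & exists h : {linear M -> N},
    forall x, phi' (lam s) *: g' (f x) = g (h x).
Proof.
move=> fP gP /fin_genP[n [p p_surj]]; have [_ _ g_surj] := gP.
have [s sS sE] : exists2 s, s \in S & forall i : 'I_n,
    exists y, phi' (lam s) *: g' (f (p (delta_mx 0 i))) = g y.
  apply: (common_multiple LP) => [i s t _ [y e]|i].
    by exists (phi t *: y); rewrite !rmorphM -scalerA e (localizesS LP gP).
  have [s [y [sS e]]] := g_surj (g' (f (p (delta_mx 0 i)))).
  by exists s => //; exists y.
have [y yE] := choice sE; have [H HE] := ex_free_map y.
have gH v : g (H v) = phi' (lam s) *: g' (f (p v)).
  rewrite HE (localizes_sum gP) [in RHS]free_mapE (localizes_sum fP) linear_sum.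
  rewrite scaler_sumr; apply: eq_bigr => i _.
  rewrite (localizesZ gP) -yE (localizesZ fP) linearZ /= !scalerA.
  by rewrite phiC'.
have [K [k kp]] := ex_kernel p_surj; have [k_inj _ _] := kp.
have Kfg : fin_gen K.
  exact: (fin_gen_sub R_noetherian A_finite k_inj (fin_gen_free A n)).
have gHk x : g ((H \o k) x) = g ((\0 : {linear K -> N}) x).
  rewrite /= gH (ses_comp0 _ kp) (localizes0 fP) raddf0 scaler0.
  by rewrite (localizes0 gP).
have [t tS tE] := loc_annihilate gP Kfg gHk.
have [T TE] : exists T : {linear 'rV[A]_n -> N}, forall v, T v = phi t *: H v.
  by apply: ex_linear => a u v; rewrite linearP scalerDr !scalerA phiC.
have Tk x : T (k x) = 0 by rewrite TE tE scaler0.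
have [h hE] := ses_factor kp Tk.
exists (t * s); first exact: SM.
exists h => x; have [v <-] := p_surj x.
by rewrite hE TE (localizesS LP gP) gH scalerA -!rmorphM.
Qed.

(** A form on K' has a numerator on K. Extend the numerator along [i], localize it and divide by the
    denominator. *)
Lemma loc_hom_ext (K M : lmodType A) (K' M' : lmodType A') (k : K -> K')
    (f : M -> M') (i : {linear K -> M}) (i' : {linear K' -> M'}) :
  localizes k -> localizes f -> fin_gen K -> (forall x, i' (k x) = f (i x)) ->
  hom_ext A^o i -> hom_ext A'^o i'.
Proof.
move=> kP fP Kfg i'E iA g'; have rP := loc_regular LP.
have [s sS [h hE]] := loc_hom_lift g' kP rP Kfg.
have [H HE] := iA h; have [H' H'E] := loc_map LP phiC' H fP rP.
have [u us] := loc_unit LP sS.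
have [G GE] : exists G : {linear M' -> A'^o}, forall y, G y = phi' u *: H' y.
  by apply: ex_linear => a x y; rewrite linearP scalerDr !scalerA phiC'.
exists G; apply: (localizes_ext LP (g := G \o i') kP) => x.
rewrite /= GE i'E H'E HE -hE scalerA -rmorphM us rmorph1; exact: scale1r.
Qed.

Lemma loc_tot_refl (M : lmodType A) (M' : lmodType A') (f : M -> M') :
  tot_refl M -> localizes f -> tot_refl M'.
Proof.
move=> MT fP.
pose P (Y : lmodType A') := exists (X : lmodType A) (f : X -> Y), tot_refl X /\ localizes f.
split; exists P; (split; first by exists M, f) => {M M' f MT fP} X' [X [f [XT fP]]].
  have [K [[n [i [p [ip iA]]]] KT]] := tot_refl_syz XT.
  have [p' p'E] := loc_map LP phiC' p (localizes_free n) fP.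
  have [_ p_surj _] := ip.
  have [K' [i' ip']] := ex_kernel (loc_map_surj LP fP p'E p_surj).
  have [k [kP kE]] := loc_kernel LP ip ip' (localizes_free n) fP p'E.
  exists K'; split; last by exists K, k.
  exists n, i', p'; split=> //.
  exact: loc_hom_ext kP (localizes_free n) (tot_refl_fin_gen KT) kE iA.
have [C [[n [i [p [ip iA]]]] CT]] := tot_refl_cosyz XT.
have [i' i'E] := loc_map LP phiC' i fP (localizes_free n).
have [i_inj _ _] := ip.
have [C' [p' ip']] := ex_cokernel (loc_map_inj LP fP (localizes_free n) i'E i_inj).
have [c [cP cE]] := loc_cokernel LP ip ip' fP (localizes_free n) i'E.
exists C'; split; last by exists C, c.
exists n, i', p'; split=> //.
exact: loc_hom_ext fP (localizes_free n) (tot_refl_fin_gen XT) i'E iA.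
Qed.

Lemma loc_addin (N M : lmodType A) (N' M' : lmodType A')
    (g : N -> N') (f : M -> M') :
  localizes g -> localizes f -> addin N M -> addin N' M'.
Proof.
move=> gP fP [n [u [v uv]]].
have [u' u'E] := choice (fun j => loc_map LP phiC' (u j) gP fP).
have [v' v'E] := choice (fun j => loc_map LP phiC' (v j) fP gP).
exists n, u', v'.
have [w wE] : exists w : {linear N' -> N'}, forall x, w x = \sum_j v' j (u' j x).
  apply: ex_linear => a x y; rewrite scaler_sumr -big_split.
  by apply: eq_bigr => j _; rewrite !linearP.
move=> x; rewrite -wE; move: x.
apply: (localizes_ext LP (h := idfun) gP) => x; rewrite wE /= -[in RHS](uv x).
by rewrite (localizes_sum gP); apply: eq_bigr => j _; rewrite u'E v'E.
Qed.

End LocalizesHom.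

Section LocalizationOfAlgebras.
Variables (R R' : comPzRingType) (A A' : pzRingType).
Variables (phi : {rmorphism R -> A}) (phi' : {rmorphism R' -> A'}).
Variables (lam : {rmorphism R -> R'}) (lamA : {rmorphism A -> A'}).
Variable S : {pred R}.

(** R is taken as an algebra over itself, so that modules restricted to R are covered by the same
    results as A-modules. *)
Definition base_localization : Prop := localization
  (idfun : {rmorphism R -> R}) (idfun : {rmorphism R' -> R'}) lam lam S.

Local Notation localizes_base := (localizes (idfun : {rmorphism R -> R})
  (idfun : {rmorphism R' -> R'}) lam lam S).

Hypothesis RP : base_localization.
Hypothesis LP : localization phi phi' lam lamA S.
Hypotheses (phiC : central_hom phi) (phiC' : central_hom phi').
Hypotheses (R_noetherian : noetherian R) (A_finite : fin_gen (restrict phi A^o)).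

Lemma noetherian_localization : noetherian R'.
Proof.
move=> I' I'I; have [I'0 I'D] := I'I; have [_ _ lam_surj] := loc_regular RP.
pose I : {pred R} := fun r => lam r \in I'.
have II : ideal I.
  split=> [|a u v]; rewrite /I !unfold_in; first by rewrite raddf0.
  by rewrite rmorphD rmorphM; apply: I'D.
have [n [g gP]] := R_noetherian II.
exists n, (fun i => lam (g i)) => y; split=> [yI|[c ->]].
  have [s [x [sS e]]] := lam_surj y.
  have {}e : lam s * y = lam x by [].
  have /gP[c cE] : x \in I by rewrite /I unfold_in -e idealMl.
  have [u us] := loc_unit RP sS.
  exists (fun i => u * lam (c i)); rewrite -[y]mul1r -us -mulrA e cE rmorph_sum.
  by rewrite mulr_sumr; apply: eq_bigr => i _; rewrite rmorphM mulrA.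
apply: (big_ind (fun y => y \in I')) => // [x z xI zI|i _].
  exact: idealD.
apply: idealMl => //; have /gP : exists c, g i = \sum_(j < n) c j * g j.
  exists (fun j => (j == i)%:R); rewrite (bigD1 i) //= eqxx mul1r big1 ?addr0 //.
  by move=> j /negPf->; rewrite mul0r.
by rewrite /I unfold_in.
Qed.

Lemma finite_localization : fin_gen (restrict phi' A'^o).
Proof.
have [_ _ lamA_surj] := loc_regular LP; have [n [g gP]] := A_finite.
exists n, (fun i => lamA (g i)) => y; have [s [x [sS e]]] := lamA_surj y.
have {}e : phi' (lam s) * y = lamA x by [].
have [u us] := loc_unit LP sS; have [c cE] := gP x.
exists (fun i => u * lam (c i)).
have -> : y = phi' u * lamA x by rewrite -e mulrA -rmorphM us rmorph1 mul1r.
rewrite cE rmorph_sum mulr_sumr; apply: eq_bigr => i _.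
rewrite -[in LHS]/(phi (c i) * (g i : A)) rmorphM (loc_square LP) mulrA -rmorphM.
by [].
Qed.

Lemma localizes_restrict (M : lmodType A) (M' : lmodType A') (f : M -> M') :
  localizes phi phi' lam lamA S f ->
  localizes_base (f : restrict phi M -> restrict phi' M').
Proof.
move=> fP; have [_ f_inj f_surj] := fP; split=> // r x y.
rewrite -[LHS]/(f (phi r *: (x : M) + (y : M))) (localizesD fP).
by rewrite (localizesS LP fP).
Qed.

Let rP := loc_regular RP.
Let AP := localizes_restrict (loc_regular LP).

(** Hom_R(A, R) commutes with localization, A being finitely presented over R: [loc_annihilate]
    gives injectivity and [loc_hom_lift] surjectivity, up to denominators. *)
Lemma localizes_dual (W : lmodType A) (ev : W -> A -> R)
    (W' : lmodType A') (ev' : W' -> A' -> R') :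
  algebra_dual phi ev -> algebra_dual phi' ev' ->
  exists l : W -> W', localizes phi phi' lam lamA S l.
Proof.
move=> evP evP'; have [ev_r ev_l ev_ex ev_inj] := evP.
have [ev_r' ev_l' ev_ex' ev_inj'] := evP'.
have /choice[e eE] : forall w, exists e : {linear restrict phi A^o -> R^o},
    forall a, e a = ev w a by move=> w; apply/ex_linear/ev_r.
have /choice[e' eE'] : forall w, exists e : {linear restrict phi' A'^o -> R'^o},
    forall a, e a = ev' w a by move=> w; apply/ex_linear/ev_r'.
have /choice[l lE] : forall w, exists w', forall a, ev' w' (lamA a) = lam (ev w a).
  move=> w; have [h hE] := loc_map RP (@id_central R') (e w) AP rP.
  have [w' wE'] := ev_ex' h; exists w' => a.
  by rewrite wE' -eE; apply: hE.
(* A form on A' is determined by its restriction to A, so identities in W' need only be tested on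
   the image of A. *)
have ext w1 w2 : (forall a, ev' w1 (lamA a) = ev' w2 (lamA a)) -> w1 = w2.
  move=> ee; have : e' w1 =1 e' w2.
    by apply: (localizes_ext RP AP) => a; rewrite !eE'.
  move=> e12; apply/eqP; rewrite -subr_eq0; apply/eqP/ev_inj' => a.
  have [_ b_r _ _] := algebra_dual_pairing phiC' evP'.
  have [k kE] := ex_linear (b_r a).
  by rewrite -[LHS]kE (linearB k) !kE -!eE' e12 subrr.
exists l; split=> [b w1 w2|w lw|w'].
- apply: ext => a; rewrite lE !ev_l ev_l' !lE -rmorphM lE.
  exact: rmorphD.
- have le a : (lam : R^o -> R'^o) (e w a) = lam ((\0 : {linear restrict phi A^o -> R^o}) a).
    by rewrite eE -lE lw (algebra_dual0 evP') raddf0.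
  have [s sS se] := loc_annihilate RP (@id_central R) rP A_finite le.
  exists s => //; apply: ev_inj => a; rewrite (algebra_dualZ evP) -phiC.
  have := se a; rewrite eE /= => se'; have := ev_r w s a 0.
  rewrite !addr0 => ->; have := ev_r w 0 0 0; rewrite mulr0 addr0 mul0r add0r => _.
  have -> : ev w 0 = 0 by rewrite -eE raddf0.
  by rewrite addr0 [LHS]se' [LHS]scaler0.
- have [s sS [h hE]] := loc_hom_lift RP (@id_central R) (@id_central R') R_noetherian (@id_finite R)
    (e' w') AP rP A_finite.
  have [w wE] := ev_ex h; exists s, w; split=> //; apply: ext => a.
  rewrite (algebra_dualZ evP') lE -phiC' wE.
  have := ev_r' w' (lam s) (lamA a) 0; rewrite !addr0 => ->.
  have -> : ev' w' 0 = 0 by rewrite -eE' raddf0.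
  by rewrite addr0 -eE'; apply: hE.
Qed.

Lemma relative_Frobenius_localization :
  relative_Frobenius phi -> relative_Frobenius phi'.
Proof.
move=> [AT [W [ev [evP WA AW]]]]; split.
  exact: (loc_tot_refl RP (@id_central R) (@id_central R') R_noetherian (@id_finite R) AT AP).
have [W' [ev' evP']] := ex_algebra_dual phi'.
have [l lP] := localizes_dual evP evP'.
exists W', ev'; split=> //.
  exact: (loc_addin LP phiC' lP (loc_regular LP) WA).
exact: (loc_addin LP phiC' (loc_regular LP) lP AW).
Qed.

End LocalizationOfAlgebras.

(** * The local-global principle for the criterion *)

Section LocalGlobal.
Variables (R : comPzRingType) (A : pzRingType) (phi : {rmorphism R -> A}).
Variables (J : Type) (R' : J -> comPzRingType) (A' : J -> pzRingType).
Variable phi' : forall j, {rmorphism R' j -> A' j}.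
Variables (lam : forall j, {rmorphism R -> R' j}).
Variables (lamA : forall j, {rmorphism A -> A' j}) (S : J -> {pred R}).

Hypothesis RP : forall j, base_localization (lam j) (S j).
Hypothesis LP : forall j, localization phi (phi' j) (lam j) (lamA j) (S j).
Hypotheses (phiC : central_hom phi) (phiC' : forall j, central_hom (phi' j)).
Hypotheses (R_noetherian : noetherian R) (A_finite : fin_gen (restrict phi A^o)).

(** For complements of maximal ideals: an ideal contained in no maximal ideal is the whole ring.
    Each use takes the ideal of the scalars r for which the desired property holds after
    multiplication by r. *)
Hypothesis S_cover : forall I : {pred R}, ideal I ->
  (forall j, exists2 s, s \in S j & s \in I) -> 1 \in I.

Let SM j s t : s \in S j -> t \in S j -> s * t \in S j.
Proof. by case: (loc_closed (RP j)) => _; apply. Qed.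

Let addin_global (M N : lmodType A) (M' N' : forall j, lmodType (A' j))
    (f : forall j, M -> M' j) (g : forall j, N -> N' j) :
  (forall j, localizes phi (phi' j) (lam j) (lamA j) (S j) (f j)) ->
  (forall j, localizes phi (phi' j) (lam j) (lamA j) (S j) (g j)) ->
  fin_gen M -> fin_gen N -> (forall j, addin (N' j) (M' j)) -> addin N M.
Proof.
move=> fP gP Mfg Nfg add'.
(* The scalars r for which r times the identity of N is a sum of composites through M; N is in add M
   exactly when 1 is such a scalar. *)
pose I : {pred R} := fun r => `[< exists n (u : 'I_n -> {linear N -> M})
  (v : 'I_n -> {linear M -> N}), forall x, \sum_j v j (u j x) = phi r *: x >].
have II : ideal I.
  split=> [|a r1 r2 /asboolP[n1 [u1 [v1 e1]]] /asboolP[n2 [u2 [v2 e2]]]].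
    apply/asboolP; exists 0%N, (fun=> \0), (fun=> \0) => x.
    by rewrite big_ord0 rmorph0 scale0r.
  apply/asboolP.
  have /choice[w wE] : forall j, exists w : {linear M -> N}, forall x,
      w x = phi a *: v1 j x.
    by move=> j; apply: ex_linear => b x y; rewrite linearP scalerDr !scalerA phiC.
  exists (n1 + n2)%N,
    (fun j => match split j with inl k => u1 k | inr k => u2 k end),
    (fun j => match split j with inl k => w k | inr k => v2 k end) => x.
  rewrite big_split_ord /=.
  under eq_bigr => k _ do rewrite (unsplitK (inl k)) wE.
  under [X in _ + X]eq_bigr => k _ do rewrite (unsplitK (inr k)).
  by rewrite -scaler_sumr e1 e2 rmorphD rmorphM scalerDl scalerA.
suff /asboolP[n [u [v uv]]] : 1 \in I.
  by exists n, u, v => x; rewrite uv rmorph1 scale1r.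
apply: S_cover => // j; have [n [u' [v' uv']]] := add' j.
have lift (X Y : lmodType A) (X' Y' : lmodType (A' j)) (a : X -> X') (b : Y -> Y')
    (h' : 'I_n -> {linear X' -> Y'}) :
    localizes phi (phi' j) (lam j) (lamA j) (S j) a ->
    localizes phi (phi' j) (lam j) (lamA j) (S j) b -> fin_gen X ->
    exists2 s, s \in S j & forall k, exists h : {linear X -> Y},
      forall x, phi' j (lam j s) *: h' k (a x) = b (h x).
  move=> aP bP Xfg; apply: (common_multiple (LP j)) => [k s t _ [h hE]|k].
    have [h1 h1E] : exists h1 : {linear X -> Y}, forall x, h1 x = phi t *: h x.
      by apply: ex_linear => c x y; rewrite linearP scalerDr !scalerA phiC.
    exists h1 => x; rewrite !rmorphM -scalerA hE h1E.
    by rewrite (localizesS (LP j) bP).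
  exact: (loc_hom_lift (LP j) phiC (@phiC' j) R_noetherian A_finite (h' k) aP bP Xfg).
have [s sS /choice[u uE]] := lift _ _ _ _ _ _ u' (gP j) (fP j) Nfg.
have [t tS /choice[v vE]] := lift _ _ _ _ _ _ v' (fP j) (gP j) Mfg.
have [w wE] : exists w : {linear N -> N}, forall x, w x = \sum_k v k (u k x).
  apply: ex_linear => a x y; rewrite scaler_sumr -big_split.
  by apply: eq_bigr => k _; rewrite !linearP.
have [m mE] : exists m : {linear N -> N}, forall x, m x = phi (t * s) *: x.
  by apply: ex_linear => c x y; rewrite scalerDr !scalerA phiC.
(* The numerators of the local maps compose to multiplication by t s, but only in the localization;
   a further factor from S j gives the equality in N itself. *)
have gw x : g j (w x) = g j (m x).
  rewrite wE mE (localizes_sum (gP j)) (localizesS (LP j) (gP j)).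
  rewrite !rmorphM -scalerA -(uv' (g j x)) !scaler_sumr.
  apply: eq_bigr => k _; rewrite -vE -uE linearZ /=.
  by [].
have [q qS qE] := loc_annihilate (LP j) phiC (gP j) Nfg gw.
exists (q * (t * s)); first by rewrite !SM.
apply/asboolP.
have /choice[v1 v1E] : forall k, exists v1 : {linear M -> N},
    forall x, v1 x = phi q *: v k x.
  by move=> k; apply: ex_linear => b x y; rewrite linearP scalerDr !scalerA phiC.
exists n, u, v1 => x; under eq_bigr do rewrite v1E.
by rewrite -scaler_sumr -wE qE mE scalerA -rmorphM.
Qed.

Local Notation localizes_base j := (localizes (idfun : {rmorphism R -> R})
  (idfun : {rmorphism R' j -> R' j}) (lam j) (lam j) (S j)).

(** Free covers and embeddings over R localize to such sequences, in which the local kernels and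
    cokernels are again totally reflexive. What remains is local: forms extend to R^n, and they
    separate points. *)
Lemma tot_refl_local_global (M : lmodType R) : fin_gen M ->
  (forall j, exists (M' : lmodType (R' j)) (f : M -> M'),
     localizes_base j f /\ tot_refl M') -> tot_refl M.
Proof.
move=> Mfg Mloc; have Rj_noeth j := noetherian_localization (RP j) R_noetherian.
have freeP j n := @localizes_free _ _ _ _ _ _ _ _ _ (RP j) n.
pose P (X : lmodType R) := fin_gen X /\
  forall j, exists (X' : lmodType (R' j)) (f : X -> X'),
    localizes_base j f /\ tot_refl X'.
split; exists P; (split; first by []) => {M Mfg Mloc} X [Xfg Xloc].
  have /fin_genP[n [p p_surj]] := Xfg; have [K [i ip]] := ex_kernel p_surj.
  have [i_inj _ _] := ip.
  have Kfg := base_fin_gen_sub R_noetherian i_inj (fin_gen_free R n).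
  have loc j : exists (K' X' : lmodType (R' j)) (i' : {linear K' -> 'rV_n})
      (p' : {linear 'rV_n -> X'}) (k : K -> K'),
      [/\ ses i' p', localizes_base j k,
          forall x, i' (k x) = map_mx (lam j) (i x) & tot_refl X'].
    have [X' [f [fP X'T]]] := Xloc j.
    have [p' p'E] := loc_map (RP j) (@id_central (R' j)) p (freeP j n) fP.
    have [K' [i' ip']] := ex_kernel (loc_map_surj (RP j) fP p'E p_surj).
    have [k [kP kE]] := loc_kernel (RP j) ip ip' (freeP j n) fP p'E.
    by exists K', X', i', p', k.
  exists K; split.
    exists n, i, p; split=> // h.
    (* The scalars r for which r h extends to R^n. Locally [h] itself extends, since Ext^1 of the
       localized X vanishes, and a numerator of that extension yields an element of S j in [I]. *)
    pose I : {pred R} := fun r => `[< exists g : {linear 'rV[R]_n -> R^o},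
      forall x, g (i x) = r * h x >].
    have II : ideal I.
      split=> [|a r1 r2 /asboolP[g1 e1] /asboolP[g2 e2]]; apply/asboolP.
        by exists \0 => x; rewrite mul0r.
      have [g gE] : exists g : {linear 'rV[R]_n -> R^o},
          forall x, g x = a *: g1 x + g2 x.
        apply: ex_linear => b x y; rewrite [g1 _]linearP [g2 _]linearP !scalerDr !scalerA addrACA.
        by rewrite mulrC.
      by exists g => x; rewrite gE e1 e2 mulrDl -mulrA.
    suff /asboolP[g gE] : 1 \in I by exists g => x; rewrite gE mul1r.
    apply: S_cover => // j; have [K' [X' [i' [p' [k [ip' kP kE X'T]]]]]] := loc j.
    have rP := loc_regular (RP j).
    have [h' h'E] := loc_map (RP j) (@id_central (R' j)) h kP rP.
    have [g' g'E] := tot_refl_ext0 X'T ip' h'.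
    have [s sS [g gE]] := loc_hom_lift (RP j) (@id_central R) (@id_central (R' j)) R_noetherian
      (@id_finite R) g' (freeP j n) rP (fin_gen_free R n).
    have [m mE] : exists m : {linear K -> R^o}, forall x, m x = s *: h x.
      by apply: ex_linear => b x y; rewrite [X in _ *: X]linearP scalerDr !scalerA mulrC.
    have gm x : lam j ((g \o i) x) = lam j (m x).
      by rewrite mE [RHS]rmorphM -h'E -g'E kE; apply/esym/gE.
    have [t tS tE] := loc_annihilate (RP j) (@id_central R) rP Kfg gm.
    exists (t * s); first exact: SM.
    apply/asboolP.
    have [g1 g1E] : exists g1 : {linear 'rV[R]_n -> R^o}, forall x, g1 x = t *: g x.
      by apply: ex_linear => b x y; rewrite [X in _ *: X]linearP scalerDr !scalerA mulrC.
    by exists g1 => x; rewrite g1E -mulrA; have := tE x; rewrite mE.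
  split=> // j; have [K' [X' [i' [p' [k [ip' kP kE X'T]]]]]] := loc j.
  exists K', k; split=> //.
  exact: (base_tot_refl_kernel (Rj_noeth j) ip' (tot_refl_free _ n) X'T).
have Xtl x : (forall u : {linear X -> R^o}, u x = 0) -> x = 0.
  (* The annihilator of [x]: each local form has a numerator on X, which kills [x], so [x] becomes
     zero in every localization. *)
  move=> ux; pose I : {pred R} := fun r => r *: x == 0.
  have II : ideal I.
    split=> [|a r1 r2]; rewrite /I !unfold_in; first by rewrite scale0r.
    by move=> /eqP e1 /eqP e2; rewrite scalerDl -scalerA e1 e2 scaler0 addr0.
  suff : 1 \in I by rewrite /I unfold_in scale1r => /eqP.
  apply: S_cover => // j; have [X' [f [fP X'T]]] := Xloc j.
  have rP := loc_regular (RP j); have [_ f_inj _] := fP.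
  have /f_inj[s sS sx] : f x = 0.
    apply: (tot_refl_torsionless X'T) => u'.
    have [s sS [u uE]] := loc_hom_lift (RP j) (@id_central R) (@id_central (R' j)) R_noetherian
      (@id_finite R) u' fP rP Xfg.
    by apply: (loc_cancel (RP j) sS); rewrite uE ux raddf0.
  by exists s; rewrite // /I unfold_in; apply/eqP.
have [n [C [i [p [ip iR]]]]] := base_free_embedding R_noetherian Xfg Xtl.
have [i_inj p_surj _] := ip.
exists C; split; first by exists n, i, p.
split; first by apply/fin_genP; exists n, p.
move=> j; have [X' [f [fP X'T]]] := Xloc j.
have [i' i'E] := loc_map (RP j) (@id_central (R' j)) i fP (freeP j n).
have [C' [p' ip']] := ex_cokernel (loc_map_inj (RP j) fP (freeP j n) i'E i_inj).
have [c [cP cE]] := loc_cokernel (RP j) ip ip' fP (freeP j n) i'E.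
exists C', c; split=> //.
apply: (base_tot_refl_cokernel (Rj_noeth j) ip' _ X'T (tot_refl_free _ n)).
exact: (loc_hom_ext (RP j) (@id_central R) (@id_central (R' j)) R_noetherian (@id_finite R)
  fP (freeP j n) Xfg i'E iR).
Qed.

Lemma relative_Frobenius_local_global :
  (forall j, relative_Frobenius (phi' j)) -> relative_Frobenius phi.
Proof.
move=> F'.
have AT : tot_refl (restrict phi A^o).
  apply: tot_refl_local_global => // j; have [A'T _] := F' j.
  exists (restrict (phi' j) (A' j)^o), (lamA j); split=> //.
  exact: (localizes_restrict (LP j) (loc_regular (LP j))).
split=> //; have [W [ev evP]] := ex_algebra_dual phi.
have WT := tot_refl_dual AT (algebra_dual_pairing phiC evP).
have Wfg : fin_gen W by apply/(fin_gen_restrict A_finite)/tot_refl_fin_gen.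
have Afg : fin_gen A^o by apply/(fin_gen_restrict A_finite).
(* [addin_global] takes families of modules and maps indexed by j, so the local witnesses are
   extracted as data. *)
have locW j : {t : {W' : lmodType (A' j) & W -> W'} |
    [/\ localizes phi (phi' j) (lam j) (lamA j) (S j) (projT2 t),
       addin (projT1 t) (A' j)^o & addin (A' j)^o (projT1 t)]}.
  apply: cid; have [_ [W' [ev' [evP' WA AW]]]] := F' j.
  have [l lP] := localizes_dual (RP j) (LP j) phiC (@phiC' j) R_noetherian
    A_finite evP evP'.
  by exists (existT _ W' l).
have lP j := let: And3 l _ _ := svalP (locW j) in l.
have WA j := let: And3 _ l _ := svalP (locW j) in l.
have AW j := let: And3 _ _ l := svalP (locW j) in l.
have rP j := loc_regular (LP j).
by exists W, ev; split=> //; [apply: addin_global rP lP _ _ WA | apply: addin_global lP rP _ _ AW].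
Qed.

End LocalGlobal.

(** * Ascent and descent *)

Section AscentDescentLocalization.
Variables (R : comPzRingType) (A : pzRingType) (phi : {rmorphism R -> A}).
Hypotheses (phiC : central_hom phi) (R_noetherian : noetherian R).
Hypothesis A_finite : fin_gen (restrict phi A^o).

Lemma ascent_descent_localization (R' : comPzRingType) (A' : pzRingType)
    (phi' : {rmorphism R' -> A'}) (lam : {rmorphism R -> R'})
    (lamA : {rmorphism A -> A'}) (S : {pred R}) :
  base_localization lam S -> localization phi phi' lam lamA S ->
  central_hom phi' -> module_ascent_descent phi -> module_ascent_descent phi'.
Proof.
move=> RP LP phiC' /(ascent_descent_criterion R_noetherian phiC A_finite) F.
apply/(ascent_descent_criterion (noetherian_localization RP R_noetherian) phiC'
  (finite_localization LP A_finite)).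
exact: relative_Frobenius_localization RP LP phiC phiC' R_noetherian A_finite F.
Qed.

Lemma ascent_descent_local_global (J : Type) (R' : J -> comPzRingType)
    (A' : J -> pzRingType) (phi' : forall j, {rmorphism R' j -> A' j})
    (lam : forall j, {rmorphism R -> R' j})
    (lamA : forall j, {rmorphism A -> A' j}) (S : J -> {pred R}) :
  (forall j, base_localization (lam j) (S j)) ->
  (forall j, localization phi (phi' j) (lam j) (lamA j) (S j)) ->
  (forall j, central_hom (phi' j)) ->
  (forall I : {pred R}, ideal I ->
    (forall j, exists2 s, s \in S j & s \in I) -> 1 \in I) ->
  (forall j, module_ascent_descent (phi' j)) -> module_ascent_descent phi.
Proof.
move=> RP LP phiC' cover AD.
apply/(ascent_descent_criterion R_noetherian phiC A_finite).
apply: (relative_Frobenius_local_global RP LP phiC phiC' R_noetherian A_finite cover).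
move=> j; apply/(ascent_descent_criterion
  (noetherian_localization (RP j) R_noetherian) (@phiC' j)
  (finite_localization (LP j) A_finite)).
exact: AD.
Qed.

End AscentDescentLocalization.

(** * Existence of maximal ideals *)

Lemma ex_maximal_ideal (R : comPzRingType) (I : {pred R}) :
  ideal I -> 1 \notin I -> exists m, maximal_ideal m /\ {subset I <= m}.
Proof.
(* The lemma of Zorn is applied to the sets X whose union with I is a proper ideal. The empty chain,
   whose union is empty and not an ideal, is then harmless. *)
move=> II I1; pose J (X : R -> Prop) : {pred R} := fun r => `[< r \in I \/ X r >].
have JP X r : reflect (r \in I \/ X r) (r \in J X) by apply: asboolP.
pose P (X : R -> Prop) := ideal (J X) /\ 1 \notin J X.
have chain (F : (R -> Prop) -> Prop) : (forall X, F X -> P X) ->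
    (forall X Y, F X -> F Y -> (forall r, X r -> Y r) \/ (forall r, Y r -> X r)) ->
    P (fun r => exists2 X, F X & X r).
  move=> FP Ftot; split; last first.
    apply/negP => /JP[|[X /FP[_ /negP X1] X1']]; first exact/negP.
    by apply: X1; apply/JP; right.
  split; first by apply/JP; left; case: II.
  have step X a u v : F X -> u \in J X -> v \in J X ->
      a * u + v \in J (fun r => exists2 X, F X & X r).
    move=> FX uX vX; have [[_ XI] _] := FP X FX.
    have /JP[|Xr] := XI a u v uX vX; first by move=> ?; apply/JP; left.
    by apply/JP; right; exists X.
  move=> a u v /JP[uI|[X FX uX]] /JP[vI|[Y FY vY]].
  - by apply/JP; left; case: II => _; apply.
  - by apply: (step Y) => //; apply/JP; [left | right].
  - by apply: (step X) => //; apply/JP; [right | left].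
  - case: (Ftot X Y FX FY) => h.
      by apply: (step Y) => //; apply/JP; right => //; apply: h.
    by apply: (step X) => //; apply/JP; right => //; apply: h.
have [m0 [[mI m1] m_max]] := @classical_sets.Zorn_bigcup R P chain.
exists (J m0); split; last by move=> r rI; apply/JP; left.
split=> // K KI mK K1 r rK; apply: contrapT => rm.
apply: (m_max (fun x => x \in K)).
  split=> [x mx|h]; first by apply: mK; apply/JP; right.
  by apply: rm; apply/JP; right; apply: h.
have JK x : (x \in J (fun x => x \in K)) = (x \in K).
  by apply/JP/idP => [[xI|//]|]; [apply: mK; apply/JP; left | right].
split; last by rewrite JK.
by split=> [|a u v]; rewrite !JK; [case: KI | case: KI => _; apply].
Qed.

(* The square-zero extension of R by A. It is commutative even if A is not, so
   that its ring of fractions provides the localization of A as a target for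
   the tensor product. *)
Section TrivialExtension.
Variables (R : comPzRingType) (A : pzRingType) (phi : {rmorphism R -> A}).

Definition triv_ext of {rmorphism R -> A} : Type := (R * A)%type.
Local Notation E := (triv_ext phi).
HB.instance Definition _ := GRing.Zmodule.on E.

Definition triv_ext_mul (x y : E) : E :=
  (x.1 * y.1, phi x.1 * y.2 + phi y.1 * x.2).

Let phiMC r s a : phi r * (phi s * a) = phi s * (phi r * a).
Proof. by rewrite !mulrA -!rmorphM mulrC. Qed.

Fact triv_ext_mulA : associative triv_ext_mul.
Proof.
move=> [r a] [s b] [t c]; congr (_, _); rewrite /= ?mulrA //.
by rewrite !rmorphM !mulrDr !mulrA addrA; congr (_ + _ + _);
  rewrite -!rmorphM ?(mulrC t).
Qed.
Fact triv_ext_mulC : commutative triv_ext_mul.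
Proof. by move=> [r a] [s b]; congr (_, _); rewrite /= 1?mulrC // addrC. Qed.
Fact triv_ext_mul1 : left_id ((1, 0) : E) triv_ext_mul.
Proof. by move=> [r a]; congr (_, _); rewrite /= ?rmorph1 mul1r ?mulr0 ?addr0. Qed.
Fact triv_ext_mulDl : left_distributive triv_ext_mul +%R.
Proof.
move=> [r a] [s b] [t c]; congr (_, _); rewrite /= ?mulrDl //.
by rewrite rmorphD mulrDl mulrDr addrACA.
Qed.
HB.instance Definition _ := GRing.Zmodule_isComPzRing.Build E
  triv_ext_mulA triv_ext_mulC triv_ext_mul1 triv_ext_mulDl.

End TrivialExtension.

(** * The tensor product as a localization *)

Section TensorLocalization.
Variables (R : comPzRingType) (A : pzRingType) (phi : {rmorphism R -> A}).
Variables (phiC : central_hom phi) (S : {pred R}) (Sm : mulr_closed S).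

Local Notation F := (fracRing Sm).
Local Notation fr := (@Defs.frac R S Sm).
Local Notation T := (tensorRing (frac_inj Sm) phiC).
Local Notation tpure := (@tpure R F A (frac_inj Sm) phi phiC).

Let S1 : 1 \in S. Proof. by case: Sm. Qed.
Let SM s t : s \in S -> t \in S -> s * t \in S.
Proof. by case: Sm => _; apply. Qed.

Lemma frac_localization : base_localization (frac_inj Sm) S.
Proof.
split=> // [s sS|].
  exists (fr 1 (exist _ s sS)); rewrite -[LHS]/(frac_mul _ _) frac_mulE.
  by apply/frac_eqP; exists 1; rewrite //= !mul1r !mulr1.
split=> [a x y|x x0|y]; first by rewrite rmorphD rmorphM.
  have /frac_eqP[u uS] : \pi_(fracRing Sm)%qT (x, den1 Sm) = \pi_(fracRing Sm)%qT (0, den1 Sm).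
    exact: x0.
  by rewrite /= !mulr1 mulr0 => ux; exists u.
have [[r [s sS]] ->] := fracP y; exists s, r; split=> //.
rewrite -[LHS]/(frac_mul (frac_inj Sm s) _) frac_mulE.
by apply/frac_eqP; exists 1; rewrite //= !mul1r !mulr1 mulrC.
Qed.

Definition tensor_inr (a : A) : T := tpure 1 a.

Fact tensor_inr_zmod_morphism : zmod_morphism tensor_inr.
Proof.
move=> a b; apply: (addIr (tensor_inr b)); rewrite subrK.
by rewrite /tensor_inr -[LHS]pureDr subrK.
Qed.
Fact tensor_inr_monoid_morphism : monoid_morphism tensor_inr.
Proof.
split=> // a b; rewrite -[RHS]/(tensor_mul _ _).
by rewrite tensor_mul_pure mulr1.
Qed.
HB.instance Definition _ :=
  GRing.isZmodMorphism.Build A T tensor_inr tensor_inr_zmod_morphism.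
HB.instance Definition _ :=
  GRing.isMonoidMorphism.Build A T tensor_inr tensor_inr_monoid_morphism.

Local Notation hom := (tensor_hom (frac_inj Sm) phiC).

Let tpureE b a : tpure b a = hom b * tensor_inr a.
Proof. by rewrite -[RHS]/(tensor_mul _ _) tensor_mul_pure mulr1 mul1r. Qed.

Let square r : tensor_inr (phi r) = hom (frac_inj Sm r).
Proof.
have : tpure (frac_inj Sm r * 1) 1 = tpure 1 (phi r * 1).
  exact: (@pure_bal R (restrict (frac_inj Sm) F^o) (restrict phi A^o)).
by rewrite !mulr1 => /esym.
Qed.

Let T_ind (P : T -> Prop) :
  P 0 -> (forall b a u, P u -> P (tpure b a + u)) -> forall u, P u.
Proof. exact: (@tensor_ind R (restrict (frac_inj Sm) F^o) (restrict phi A^o)). Qed.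

Lemma tensor_hom_central : central_hom hom.
Proof.
move=> b u; elim/T_ind: u => [|c a u IH]; first by rewrite mulr0 mul0r.
rewrite mulrDr mulrDl IH; congr (_ + _).
rewrite -[LHS]/(tensor_mul _ _) -[RHS]/(tensor_mul _ _) !tensor_mul_pure.
by rewrite mulr1 mul1r mulrC.
Qed.

Let E := triv_ext phi.
Let SE : {pred E} := fun x => x.1 \in S.
Let SEm : mulr_closed SE.
Proof. by split=> [|x y]; rewrite /SE !unfold_in //; apply: SM. Qed.

(** For x = (r, s), this is the fraction r a / s in the localized square-zero ideal, written with
    numerator (0, r a) and denominator (s, 0). *)
Let emb (x : fracPair S) (a : A) : fracRing SEm :=
  @Defs.frac E SE SEm ((0, phi x.1 * a) : E)
    (exist (fun x => x \in SE) ((sval x.2, 0) : E) (svalP x.2)).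

Let phiMC r s a : phi r * (phi s * a) = phi (r * s) * a.
Proof. by rewrite mulrA rmorphM. Qed.

Let emb_eqP (x y : fracPair S) a b :
  (exists2 u, u \in S &
     phi (u * (sval y.2 * x.1)) * a = phi (u * (sval x.2 * y.1)) * b) ->
  emb x a = emb y b.
Proof.
move=> [u uS e]; apply/frac_eqP; exists ((u, 0) : E) => //.
congr (_, _) => /=; first by rewrite !mul0r.
rewrite !(mulr0, mul0r, rmorph0, addr0, add0r, phiMC).
exact: e.
Qed.

Let emb_addl (x y : fracPair S) a :
  emb (x.1 * sval y.2 + y.1 * sval x.2, den_mul Sm x y) a = emb x a + emb y a.
Proof.
rewrite -[RHS]/(frac_add (emb x a) (emb y a)) [frac_add _ _]frac_addE.
apply/frac_eqP; exists (1 : E) => //; rewrite !mul1r.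
congr (_, _) => /=; rewrite !(mulr0, mul0r, rmorph0, addr0, add0r, phiMC) //.
by rewrite -mulrDl -rmorphD phiMC (mulrC x.1) (mulrC y.1).
Qed.

Let emb_addr (x : fracPair S) a b : emb x (a + b) = emb x a + emb x b.
Proof.
rewrite -[RHS]/(frac_add (emb x a) (emb x b)) [frac_add _ _]frac_addE.
apply/frac_eqP; exists (1 : E) => //; rewrite !mul1r.
congr (_, _) => /=; rewrite !(mulr0, mul0r, rmorph0, addr0, add0r, phiMC) //.
by rewrite -mulrDr phiMC mulrA.
Qed.

Let emb_repr (x : fracPair S) a :
  emb (repr (\pi_(fracRing Sm)%qT x)) a = emb x a.
Proof.
apply: emb_eqP; have /frac_eqP[u uS e] :
    \pi_(fracRing Sm)%qT (repr (\pi_(fracRing Sm)%qT x)) = \pi_(fracRing Sm)%qT x.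
  by rewrite reprK.
by exists u => //; rewrite (mulrC (sval x.2)) e (mulrC x.1).
Qed.

(** Tensors are classes of formal sums, so a zero tensor is analysed through a balanced map. The one
    induced by [emb] sends 1 (x) a to the fraction (0, a) / 1, whose vanishing provides a multiplier
    (u, b) with u in S and u a = 0. *)
Lemma tensor_inr_eq0 a : tensor_inr a = 0 -> exists2 s, s \in S & phi s * a = 0.
Proof.
pose f (b : restrict (frac_inj Sm) F^o) (c : restrict phi A^o) :=
  emb (repr (b : F)) (c : A).
have f_bal : balanced f.
  split=> [b1 b2 c|b c1 c2|r b c]; rewrite /f.
  - have [[x ->] [y ->]] := (fracP b1, fracP b2).
    transitivity (emb (x.1 * sval y.2 + y.1 * sval x.2, den_mul Sm x y) c).
      by rewrite -[RHS]emb_repr; congr (emb (repr _) c); apply: frac_addE.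
    by rewrite emb_addl !emb_repr.
  - exact: emb_addr.
  - have [x ->] := fracP b.
    transitivity (emb (r * x.1, den_mul Sm (r, den1 Sm) x) c).
      rewrite -[RHS]emb_repr; congr (emb (repr _) c).
      exact: (frac_mulE Sm (r, den1 Sm) x).
    rewrite emb_repr; apply: emb_eqP; exists 1 => //=.
    rewrite -[r *: c]/(phi r * (c : A)) phiMC !mul1r; congr (phi _ * c).
    by rewrite -mulrA (mulrC r).
move=> a0; have := tensor_lift_pure f_bal (1 : F) (a : A).
have -> : pure (1 : restrict (frac_inj Sm) F^o) (a : restrict phi A^o) = 0 by exact: a0.
rewrite tensor_lift0 // /f => /esym.
rewrite -[X in repr X]/(\pi_(fracRing Sm)%qT (1, den1 Sm)) emb_repr.
rewrite -[0]/(frac_inj SEm 0) => /frac_eqP[[u b] uS /(congr1 snd)] /=.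
rewrite !(mul0r, mul1r, rmorph0, rmorph1, mulr0, add0r, addr0) => ua.
by exists u.
Qed.

Lemma tensor_localization : localization phi hom (frac_inj Sm) tensor_inr S.
Proof.
have [_ _ Funit [_ _ F_surj]] := frac_localization.
split=> //; split=> [a x y|a /tensor_inr_eq0 //|y].
  by rewrite rmorphD rmorphM.
elim/T_ind: y => [|b a y [s [x [sS e]]]].
  by exists 1, 0; split=> //; rewrite scaler0 raddf0.
have [t [r [tS e']]] := F_surj b.
have {}e' : frac_inj Sm t * b = frac_inj Sm r by [].
have {}e : hom (frac_inj Sm s) * y = tensor_inr x by [].
exists (t * s), (phi (s * r) * a + phi t * x); split; first exact: SM.
transitivity (hom (frac_inj Sm (s * r)) * tensor_inr a +
              hom (frac_inj Sm t) * tensor_inr x); last first.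
  rewrite -[RHS]/(tensor_inr (phi (s * r) * a + phi t * x)).
  have iM u v : tensor_inr (u * v) = tensor_inr u * tensor_inr v by apply: rmorphM.
  have iD u v : tensor_inr (u + v) = tensor_inr u + tensor_inr v by apply: rmorphD.
  by rewrite iD !iM !square.
rewrite -[LHS]/(hom (frac_inj Sm (t * s)) * (tpure b a + y)) mulrDr.
congr (_ + _); last by rewrite -e mulrA -!rmorphM.
rewrite tpureE mulrA -rmorphM; congr (hom _ * _).
by rewrite mulrC [frac_inj Sm (t * s)]rmorphM mulrA (mulrC b) e' mulrC -rmorphM.
Qed.

End TensorLocalization.

(** * Transfer to opposite rings, for right modules *)

Section Opposite.
Variables (R R' : comPzRingType) (A A' : pzRingType).
Variables (phi : {rmorphism R -> A}) (phi' : {rmorphism R' -> A'}).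
Variables (lam : {rmorphism R -> R'}) (lamA : {rmorphism A -> A'}).
Variable S : {pred R}.

(** The product of [R^c] is the reversed one. It equals that of R by commutativity but is not
    convertible to it, so each hypothesis must be carried over explicitly. *)
Lemma opp_central : central_hom phi ->
  @central_hom (R^c : comPzRingType) A^c (opp_hom phi).
Proof. by move=> phiC r a; apply/esym/phiC. Qed.

Lemma opp_ideal (I : {pred R}) : @ideal (R^c : comPzRingType) I <-> ideal I.
Proof.
by split=> -[I0 IP]; split=> // a u v uI vI; have := IP a u v uI vI;
  rewrite -[X in X + v]mulrC.
Qed.

Lemma opp_noetherian : noetherian R -> noetherian (R^c : comPzRingType).
Proof.
move=> Rn I /opp_ideal/Rn[n [g gP]]; exists n, g => x; rewrite gP.
by split=> -[c ->]; exists c; apply: eq_bigr => i _; apply: mulrC.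
Qed.

Lemma opp_finite : central_hom phi -> fin_gen (restrict phi A^o) ->
  fin_gen (@restrict (R^c : comPzRingType) A^c (opp_hom phi) (A^c)^o).
Proof.
move=> phiC [n [g gP]]; exists n, g => x; have [c cE] := gP x.
exists c; rewrite {1}cE; apply: eq_bigr => i _; exact: phiC.
Qed.

Lemma opp_localization : central_hom phi -> central_hom phi' ->
  localization phi phi' lam lamA S ->
  @localization (R^c : comPzRingType) (R'^c : comPzRingType) A^c A'^c
    (opp_hom phi) (opp_hom phi') (opp_hom lam) (opp_hom lamA) S.
Proof.
move=> phiC phiC' [[S1 SM] sq un [_ lam_inj lam_surj]]; split=> //.
- by split=> // x y xS yS; apply: SM.
- by move=> s /un[u us]; exists u; apply: etrans us; apply: (@mulrC R').
- split=> [a x y|x /lam_inj[s sS sx]|y].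
  + have e (b u v : A) : lamA (u * b + v) = lamA u * lamA b + lamA v.
      by rewrite rmorphD rmorphM.
    exact: e.
  + by exists s => //; rewrite -[RHS]sx; apply/esym/phiC.
  + have [s [x [sS e]]] := lam_surj y; exists s, x; split=> //.
    by rewrite -[RHS]e; apply/esym/phiC'.
Qed.

Lemma opp_base_localization : base_localization lam S ->
  @base_localization (R^c : comPzRingType) (R'^c : comPzRingType) (opp_hom lam) S.
Proof.
move=> [[S1 SM] _ un [_ lam_inj lam_surj]]; split=> //.
- by split=> // x y xS yS; apply: SM.
- by move=> s /un[u us]; exists u; apply: etrans us; apply: (@mulrC R').
- split=> [a x y|x /lam_inj[s sS sx]|y].
  + have e (b u v : R) : lam (u * b + v) = lam u * lam b + lam v.
      by rewrite rmorphD rmorphM.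
    exact: e.
  + by exists s => //; rewrite -[RHS]sx; apply: mulrC.
  + have [s [x [sS e]]] := lam_surj y; exists s, x; split=> //.
    by rewrite -[RHS]e; apply: mulrC.
Qed.

End Opposite.

Theorem corollary4p6 (R : comPzRingType) (A : pzRingType)
    (phi : {rmorphism R -> A}) (R_noetherian : noetherian R)
    (phiC : central_hom phi) (A_finite : fin_gen (restrict phi A^o)) :
  [<-> ascent_descent phi;
       forall (p : {pred R}) (pP : prime_ideal p),
         ascent_descent (loc_hom phiC pP);
       forall (m : {pred R}) (mP : maximal_ideal m),
         ascent_descent (loc_hom phiC (maximal_prime mP))].
Proof.
have phiC_op := opp_central phiC.
have R_noeth_op := opp_noetherian R_noetherian.
have A_fin_op := opp_finite phiC A_finite.
have RP (p : {pred R}) (pP : prime_ideal p) :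
    base_localization (frac_inj (prime_mulr_closed pP)) [predC p].
  exact: frac_localization.
have LP (p : {pred R}) (pP : prime_ideal p) : localization phi (loc_hom phiC pP)
    (frac_inj (prime_mulr_closed pP))
    (tensor_inr phiC (prime_mulr_closed pP)) [predC p].
  exact: tensor_localization.
have phiC' (p : {pred R}) (pP : prime_ideal p) : central_hom (loc_hom phiC pP).
  exact: tensor_hom_central.
tfae=> [[AD AD_op] p pP|AD m mP|AD].
- split.
    exact: (ascent_descent_localization phiC R_noetherian A_finite (RP p pP)
      (LP p pP) (phiC' p pP) AD).
  exact: (ascent_descent_localization phiC_op R_noeth_op A_fin_op
    (opp_base_localization (RP p pP))
    (opp_localization phiC (phiC' p pP) (LP p pP))
    (opp_central (phiC' p pP)) AD_op).
- exact: AD.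
pose J := {m : {pred R} | maximal_ideal m}.
pose pP (j : J) := maximal_prime (svalP j).
have cover (I : {pred R}) : ideal I ->
    (forall j : J, exists2 s, s \in [predC sval j] & s \in I) -> 1 \in I.
  move=> II IJ; apply: contrapT => /negP I1.
  have [m [mP Im]] := ex_maximal_ideal II I1.
  have [s] := IJ (exist _ m mP); rewrite inE /= => /negP sm sI.
  by apply: sm; apply: Im.
have ADj (j : J) := AD _ (svalP j).
split.
  apply: (ascent_descent_local_global phiC R_noetherian A_finite
    (fun j => RP _ (pP j)) (fun j => LP _ (pP j)) (fun j => phiC' _ (pP j)) cover).
  by move=> j; case: (ADj j).
apply: (ascent_descent_local_global phiC_op R_noeth_op A_fin_op
  (fun j => opp_base_localization (RP _ (pP j)))
  (fun j => opp_localization phiC (phiC' _ (pP j)) (LP _ (pP j)))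
  (fun j => opp_central (phiC' _ (pP j)))).
  by move=> I /opp_ideal; apply: cover.
by move=> j; case: (ADj j).
Qed.
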